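(* Let $(\mathbb{X},d_{\mathbb{X}})$ be a Polish metric space with bounded diameter, $\alpha>0$, $P_0\in\mathcal{P}(\mathbb{X})$, $N\ge1$ an integer, and $\tilde P\sim\mathrm{DP}(\alpha,P_0)$. Let $\tilde P_1$, $\tilde P_2$, $\tilde P_3$ be respectively the Dirichlet multinomial process, the truncated stick-breaking process and the hierarchical empirical measure with $N$ atoms and parameters $(\alpha,P_0)$. Then $$\mathcal{W}_{\mathcal{W}}(\tilde P,\tilde P_1)\le\mathbb{E}\Big(\mathcal{W}\Big(P_0,\frac1N\sum_{i=1}^N\delta_{X_i}\Big)\Big),$$ $$\mathcal{W}_{\mathcal{W}}(\tilde P,\tilde P_2)\le\mathbb{E}\big(d_{\mathbb{X}}(X_1,X_2)\big)\Big(\frac{\alpha}{\alpha+1}\Big)^N,$$ $$\mathcal{W}_{\mathcal{W}}(\tilde P,\tilde P_3)\le\mathbb{E}\Big(\mathcal{W}\Big(\tilde P,\frac1N\sum_{i=1}^N\delta_{Y_i}\Big)\Big),$$ where the $X_i$ are i.i.d. with law $P_0$ and, conditionally on $\tilde P$, $Y_1,\dots,Y_N$ are i.i.d. with law $\tilde P$ (the last expectation being over the joint law of $\tilde P$ and $Y_1,\dots,Y_N$). In particular, if $\mathbb{X}\subseteq\mathbb{R}$ with the usual distance, so that $P_0$ is a probability on $\mathbb{R}$, and $F_0$ denotes the cumulative distribution function of $P_0$, then $$\mathcal{W}_{\mathcal{W}}(\tilde P,\tilde P_1)\le\frac1{\sqrt N}\int_{-\infty}^{+\infty}\sqrt{F_0(x)(1-F_0(x))}\,\mathrm{d}x,$$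 $$\mathcal{W}_{\mathcal{W}}(\tilde P,\tilde P_2)\le2\Big(\frac{\alpha}{\alpha+1}\Big)^N\int_{-\infty}^{+\infty}F_0(x)(1-F_0(x))\,\mathrm{d}x,$$ $$\mathcal{W}_{\mathcal{W}}(\tilde P,\tilde P_3)\le\sqrt{\frac{\alpha}{N(\alpha+1)}}\int_{-\infty}^{+\infty}\sqrt{F_0(x)(1-F_0(x))}\,\mathrm{d}x.$$
   Context: $(\mathbb{X},d_{\mathbb{X}})$ is a complete separable metric space with finite diameter. $\mathcal{P}(\mathbb{X})$ is the space of Borel probability measures on $\mathbb{X}$ with the weak topology; a random probability is a random element of $\mathcal{P}(\mathbb{X})$. $\mathcal{W}$ is the Wasserstein distance of order 1 on $\mathcal{P}(\mathbb{X})$: $\mathcal{W}(P,P')=\inf_{\gamma\in\Gamma(P,P')}\mathbb{E}_{(Y,Y')\sim\gamma}(d_{\mathbb{X}}(Y,Y'))$, with $\Gamma$ the set of couplings. The Wasserstein over Wasserstein distance between laws of random probabilities is $\mathcal{W}_{\mathcal{W}}(\mathbb{Q},\mathbb{Q}')=\inf_{\gamma\in\Gamma(\mathbb{Q},\mathbb{Q}')}\mathbb{E}_{(\tilde R,\tilde R')\sim\gamma}(\mathcal{W}(\tilde R,\tilde R'))$, and $\mathcal{W}_{\mathcal{W}}(\tilde R,\tilde R')$ denotes the distance between the laws of $\tilde R$ and $\tilde R'$. Dirichlet process: $\tilde P\sim\mathrm{DP}(\alpha,P_0)$ if $\tilde P$ has the same law as $\sum_{i\ge1}J_i\delta_{X_i}$,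 where $X_i$ are i.i.d. with law $P_0$, independent of $V_i$ i.i.d. $\mathrm{Beta}(1,\alpha)$, and $J_i=V_i\prod_{j=1}^{i-1}(1-V_j)$ (stick-breaking weights). Approximations with $N$ atoms: 1. Dirichlet multinomial process: conditionally on $X_1,\dots,X_N$ i.i.d. with law $P_0$, $\tilde P_1\sim\mathrm{DP}(\alpha,\frac1N\sum_{i=1}^N\delta_{X_i})$; equivalently $\tilde P_1=\sum_{i=1}^NJ_i\delta_{X_i}$ with $(J_1,\dots,J_N)$ Dirichlet distributed with parameter $(\alpha/N,\dots,\alpha/N)$ and independent of the i.i.d. atoms $X_i\sim P_0$. 2. Truncated stick-breaking process: $\tilde P_2=\sum_{i=1}^{N-1}J_i\delta_{X_i}+\big(1-\sum_{i=1}^{N-1}J_i\big)\delta_{X_N}$, with $X_i$ i.i.d. of law $P_0$ and $J_1,\dots,J_{N-1}$ the first $N-1$ stick-breaking weights (independent of the $X_i$). 3. Hierarchical empirical measure: $\tilde P_3=\frac1N\sum_{i=1}^N\delta_{Y_i}$, where conditionally on $\tilde P\sim\mathrm{DP}(\alpha,P_0)$ the $Y_1,\dots,Y_N$ are i.i.d. with law $\tilde P$. *)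

(* Defs.v *)
From HB Require Import structures.
From mathcomp Require Import all_boot all_order all_algebra finmap.
From mathcomp Require Import all_classical all_reals all_analysis.

Set Implicit Arguments.
Unset Strict Implicit.
Unset Printing Implicit Defensive.

Import Order.TTheory GRing.Theory Num.Theory.
Import numFieldNormedType.Exports.

Local Open Scope classical_set_scope.
Local Open Scope ring_scope.
Local Open Scope ereal_scope.

#[short(type="completeMetricType")]
HB.structure Definition CompleteMetric (R : numDomainType) :=
  {T of Metric R T & Complete T}.

Definition separable_space (T : topologicalType) :=
  exists2 D : set T, countable D & dense D.

Definition finite_diameter (R : realType) (T : metricType R) :=
  exists M : R, forall x y : T, (mdist x y <= M)%R.

Definition borel (T : ptopologicalType) : measurableType (@open T).-sigma :=
  g_sigma_algebraType (@open T).

Section probability_space.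
Context (R : realType) (T : ptopologicalType).

Definition bounded_continuous : Type :=
  {f : T -> R | continuous f /\ exists M : R, forall x, (`|f x| <= M)%R}.

Definition integral_against (mu : probability (borel T) R) :
    {ptws bounded_continuous -> R} :=
  fun f => Rintegral mu setT (sval f).

(* The weak topology: the coarsest one for which [mu |-> \int f dmu] is
   continuous for every bounded continuous [f]. Two probabilities that agree on
   all Borel sets, but not as functions on all subsets of [T], are
   topologically indistinguishable points of this space. *)
Definition weak_probability : ptopologicalType :=
  initial_topology integral_against.

Definition Pspace : measurableType (@open weak_probability).-sigma :=
  borel weak_probability.

Definition as_probability (mu : Pspace) : probability (borel T) R := mu.

End probability_space.

Definition coupling {d d'} {T : measurableType d} {T' : measurableType d'}
    {R : realType} (mu : probability T R) (nu : probability T' R) :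
    set (probability (T * T')%type R) :=
  [set g | (forall A, measurable A -> g (fst @^-1` A) = mu A) /\
           (forall B, measurable B -> g (snd @^-1` B) = nu B)].

Definition transport {d} {T : measurableType d} {R : realType}
    (c : T -> T -> \bar R) (mu nu : probability T R) : \bar R :=
  ereal_inf [set \int[g]_z c z.1 z.2 | g in coupling mu nu].

Definition Wasserstein {R : realType} {X : completeMetricType R}
    (mu nu : probability (borel X) R) : \bar R :=
  transport (fun x y : borel X => (@mdist R X x y)%:E) mu nu.

Definition WoW {R : realType} {X : completeMetricType R}
    (Q Q' : probability (Pspace R X) R) : \bar R :=
  transport (fun p q : Pspace R X =>
    Wasserstein (as_probability p) (as_probability q)) Q Q'.

Definition WoW_rv {R : realType} {X : completeMetricType R}
    {d d'} {Omega : measurableType d} {Omega' : measurableType d'}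
    {Pr : probability Omega R} {Pr' : probability Omega' R}
    (S : {RV Pr >-> Pspace R X}) (S' : {RV Pr' >-> Pspace R X}) : \bar R :=
  WoW (distribution Pr S) (distribution Pr' S').

Section independence.
Context {d} {Omega : measurableType d} {R : realType} (Pr : probability Omega R).

Definition mutually_independent (I : choiceType) (F : I -> set_system Omega) :=
  forall (J : {fset I}) (A : I -> set Omega),
    (forall i, i \in J -> F i (A i)) ->
    Pr (\bigcap_(i in [set` J]) A i) = \prod_(i <- J) Pr (A i).

Definition sigma_of {d'} {E : measurableType d'} (Z : Omega -> E) :
    set_system Omega :=
  preimage_set_system setT Z measurable.

Definition has_law {d'} {E : measurableType d'} (Z : {RV Pr >-> E})
    (mu : set E -> \bar R) :=
  forall A, measurable A -> distribution Pr Z A = mu A.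

Definition iid (I : choiceType) {d'} {E : measurableType d'}
    (Z : I -> {RV Pr >-> E}) (mu : set E -> \bar R) :=
  mutually_independent (fun i => sigma_of (Z i)) /\
  forall i, has_law (Z i) mu.

End independence.

Section beta.
Context {R : realType}.
Local Notation leb := (@lebesgue_measure R).

Definition beta_kernel (a b x : R) : R := (x `^ (a - 1) * (1 - x) `^ (b - 1))%R.

Definition beta_law (a b : R) (A : set R) : \bar R :=
  \int[leb]_(x in A `&` `]0%R, 1%R[)
    (beta_kernel a b x / \int[leb]_(y in `]0%R, 1%R[) beta_kernel a b y)%:E.

End beta.

Section empirical.
Context {d} {T : measurableType d} (R : realType) {N : nat}.

(* [mnormalize] divides the counting measure of the tuple by its mass [N]; the
   default value, used for [N = 0] only, is irrelevant. *)
Definition empirical (x : N.-tuple T) : probability T R :=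
  mnormalize (msum (fun i => dirac (nth point x i)) N) (dirac point).

Lemma empiricalE (x : N.-tuple T) (A : set T) : (0 < N)%N ->
  empirical x A = (N%:R^-1)%:E * \sum_(i < N) \d_(tnth x i) A.
Proof.
move=> N0; rewrite /empirical/= /mnormalize/=.
have -> : msum (fun i => @dirac _ T (nth point x i) R) N setT = N%:R%:E.
  rewrite /msum (eq_bigr (fun=> 1%:E)) => [|i _].
    by rewrite sumEFin sumr_const card_ord.
  exact: diracT.
rewrite eqe pnatr_eq0 eqn0Ngt N0/= muleC; congr (_ * _).
by apply: eq_bigr => i _; rewrite (tnth_nth point).
Qed.

End empirical.

Section processes.
Context {R : realType} {X : completeMetricType R}.

(* The atoms [X_ i] are i.i.d. of law [P0], the variables [V_ i] are i.i.d. of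
   law Beta(1, alpha), and the two sequences are independent of each other. *)
Definition stick_breaking_variables {d} {Omega : measurableType d}
    (Pr : probability Omega R) (alpha : R) (P0 : probability (borel X) R)
    (X_ : nat -> {RV Pr >-> borel X}) (V_ : nat -> {RV Pr >-> R}) :=
  [/\ mutually_independent Pr (fun k : nat + nat =>
        match k with inl i => sigma_of (X_ i) | inr i => sigma_of (V_ i) end),
      forall i, has_law (X_ i) P0 &
      forall i, has_law (V_ i) (beta_law 1 alpha)].

Definition stick_weight {Omega : Type} (V_ : nat -> Omega -> R) (i : nat)
    (w : Omega) : R :=
  (V_ i w * \prod_(j < i) (1 - V_ j w))%R.

(* The following predicates apply to the law [Q] of a random probability. *)

Definition dirichlet_process (alpha : R) (P0 : probability (borel X) R)
    (Q : set (Pspace R X) -> \bar R) :=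
  exists d (Omega : measurableType d) (Pr : probability Omega R)
    (X_ : nat -> {RV Pr >-> borel X}) (V_ : nat -> {RV Pr >-> R})
    (S : {RV Pr >-> Pspace R X}),
  [/\ stick_breaking_variables alpha P0 X_ V_,
      {ae Pr, forall w, forall A, measurable A ->
        as_probability (S w) A =
        \sum_(0 <= i <oo) (stick_weight V_ i w)%:E * \d_(X_ i w) A} &
      has_law S Q].

(* [kappa] is the conditional law of [S] given the atoms. *)
Definition dirichlet_multinomial (alpha : R) (P0 : probability (borel X) R) (N : nat)
    (Q : set (Pspace R X) -> \bar R) :=
  exists d (Omega : measurableType d) (Pr : probability Omega R)
    (X_ : 'I_N -> {RV Pr >-> borel X}) (S : {RV Pr >-> Pspace R X})
    (kappa : R.-pker (N.-tuple (borel X)) ~> Pspace R X),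
  let Xs w := [tuple X_ i w | i < N] in
  [/\ iid X_ P0,
      forall x, dirichlet_process alpha (empirical R x) (kappa x),
      forall A B, measurable A -> measurable B ->
        Pr (Xs @^-1` A `&` S @^-1` B) =
        \int[Pr]_(w in Xs @^-1` A) kappa (Xs w) B &
      has_law S Q].

(* With indices starting at [0], the [N]-th atom is [X_ N.-1]. *)
Definition truncated_stick_breaking (alpha : R) (P0 : probability (borel X) R) (N : nat)
    (Q : set (Pspace R X) -> \bar R) :=
  exists d (Omega : measurableType d) (Pr : probability Omega R)
    (X_ : nat -> {RV Pr >-> borel X}) (V_ : nat -> {RV Pr >-> R})
    (S : {RV Pr >-> Pspace R X}),
  [/\ stick_breaking_variables alpha P0 X_ V_,
      {ae Pr, forall w, forall A, measurable A ->
        as_probability (S w) A =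
        \sum_(i < N.-1) (stick_weight V_ i w)%:E * \d_(X_ i w) A +
        (1 - \sum_(i < N.-1) stick_weight V_ i w)%R%:E * \d_(X_ N.-1 w) A} &
      has_law S Q].

Definition conditionally_iid {d} {Omega : measurableType d}
    {Pr : probability Omega R} {N : nat}
    (Pt : {RV Pr >-> Pspace R X}) (Y_ : 'I_N -> {RV Pr >-> borel X}) :=
  forall (A : set (Pspace R X)) (B : 'I_N -> set (borel X)),
    measurable A -> (forall i, measurable (B i)) ->
    Pr (Pt @^-1` A `&` \bigcap_i (Y_ i @^-1` B i)) =
    \int[Pr]_(w in Pt @^-1` A) \prod_(i < N) as_probability (Pt w) (B i).

Definition hierarchical_empirical (alpha : R) (P0 : probability (borel X) R) (N : nat)
    (Q : set (Pspace R X) -> \bar R) :=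
  exists d (Omega : measurableType d) (Pr : probability Omega R)
    (Pt : {RV Pr >-> Pspace R X}) (Y_ : 'I_N -> {RV Pr >-> borel X})
    (S : {RV Pr >-> Pspace R X}),
  [/\ dirichlet_process alpha P0 (distribution Pr Pt),
      conditionally_iid Pt Y_,
      forall w A, measurable A ->
        as_probability (S w) A = empirical R [tuple Y_ i w | i < N] A &
      has_law S Q].

End processes.

(* The inclusion of a subspace of the real line carrying the usual distance. *)
Definition real_isometry {R : realType} {X : metricType R} (iota : X -> R) :=
  forall x y, mdist x y = `|iota x - iota y|%R.

(* The cumulative distribution function of [P0] seen, through [iota], as a
   probability on the real line. *)
Definition cdf_along {R : realType} {X : completeMetricType R} (iota : X -> R)
    (P0 : probability (borel X) R) (x : R) : R :=
  fine (P0 (iota @^-1` `]-oo, x])).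

(* Main.v *)
Require Import Defs.
From HB Require Import structures.
From mathcomp Require Import all_boot all_order all_algebra finmap.
From mathcomp Require Import all_classical all_reals all_analysis.
From mathcomp Require Import measurable_realfun metric_structure.
From mathcomp Require Import ring lra.

Set Implicit Arguments.
Unset Strict Implicit.
Unset Printing Implicit Defensive.

Import Order.TTheory GRing.Theory Num.Theory.
Import numFieldNormedType.Exports.

Local Open Scope classical_set_scope.
Local Open Scope ring_scope.
Local Open Scope ereal_scope.

(** Each bound comes from a coupling: the Dirichlet process and its approximation
    are built on one probability space, and the expected Wasserstein distance
    between the two random probabilities bounds the distance between their laws
    ([WoW_le_integral]).

    A Dirichlet process is a sum [\sum_i J_i \d_(x_i)] computed from an i.i.d.
    sequence of pairs of an atom and a stick; its law is determined by the law of
    these pairs, whatever the space that carries them ([dirichlet_process_law]).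
    Two sums with the same weights and atoms [x_i] and [y_i] are at distance at most
    [\sum_i J_i mdist x_i y_i] ([Wasserstein_stick_prob]). Expectations of such sums
    follow from the decomposition of the sequence into its first pair and an
    independent tail with the same law: the unknown expectation solves a linear
    equation ([integral_stick_sum], [integral_trunc_cost], [stick_covariance]).

    - Truncation moves the atoms that follow the last one kept to that last one,
      at a cost of one factor [alpha / (alpha + 1)] for each of [N] sticks and of
      the distance between two independent atoms ([WoW_truncated]).
    - A random probability and the empirical measure of its sample live on the same
      space, so that the third bound is immediate once the law of the sample is
      identified ([WoW_hierarchical]).
    - The Dirichlet multinomial process is a mixture over a sample [x] of Dirichlet
      processes whose base measure is the empirical measure of [x]. Given [x], the
      same sticks are used, and every atom is replaced by an entry of [x] chosen
      through a nearly optimal coupling of [P0] with this empirical measure; the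
      chosen atoms are i.i.d. with the right law ([WoW_selection]). The choice is a
      function of the atom and of an independent uniform variable
      ([coupling_selector]), and can be made to depend measurably on [x] because
      nearly optimal couplings for a dense sequence of tuples suffice
      ([measurable_selection]).

    On the real line the monotone coupling gives the bound
    [Wasserstein P P' <= \int_t `|F t - F' t|] ([Wasserstein_le_cdf]). The frequency
    of an event [A] in a sample of size [N] from a random probability [P] differs
    from [P A] by at most the square root of ['E (P A * (1 - P A)) / N] in mean
    ([sample_fluctuation]), and for a Dirichlet process this expectation is
    [alpha / (alpha + 1) * (P0 A * (1 - P0 A))] ([dirichlet_variance]). With the
    constant random probability [P0] this also covers i.i.d. samples; the mean
    distance of two independent points is computed in [integral_dist_cdf].

    Laws of random probabilities are handled through the values on Borel sets: the
    weak topology of a separable space has a countable subbase made of sets defined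
    by integrals of continuous functions, so that evaluations are measurable and
    generate the Borel sets ([measurable_evaluation], [measurable_Pspace]). *)

(** * Integrals of functions that need not be measurable *)

Section integration.
Context d (T : measurableType d) (R : realType).
Variable mu : {measure set T -> \bar R}.

Import HBNNSimple.

(** The integral of a nonnegative function is a supremum over the simple functions
    below it, so it is monotone on all functions. Wasserstein distances are infima
    over couplings, and their integrals are compared in this way. *)
Lemma ge0_le_lower_integral (f g : T -> \bar R) :
  (forall x, 0 <= f x) -> (forall x, f x <= g x) ->
  \int[mu]_x f x <= \int[mu]_x g x.
Proof.
move=> f0 fg; have g0 x : 0 <= g x by exact: le_trans (fg x).
rewrite !ge0_integralTE//; apply: ereal_sup_le => _ [h hf <-].
by exists h => // x; exact: le_trans (fg x).
Qed.

End integration.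

Definition to_mfun d1 d2 (T1 : measurableType d1) (T2 : measurableType d2)
  (f : T1 -> T2) (mf : measurable_fun setT f) : {mfun T1 >-> T2} :=
  mfun_Sub (mem_set mf).

Import HBNNSimple.

(** A simple function below [f] is carried by [X] to a simple function below
    [f \o X]; the two sides may differ when [f] is not measurable. *)
Lemma ge0_le_lower_integral_pushforward d1 d2 (T1 : measurableType d1)
    (T2 : measurableType d2) (R : realType) (P : probability T1 R)
    (X : {mfun T1 >-> T2}) (f : T2 -> \bar R) :
  (forall x, 0 <= f x) ->
  \int[distribution P X]_y f y <= \int[P]_x f (X x).
Proof.
move=> f0; rewrite ge0_integralTE//; apply: ge_ereal_sup => _ [h hf <-].
rewrite -integralT_nnsfun ge0_integral_distribution//; last 2 first.
- exact/measurable_EFinP.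
- by move=> y; rewrite lee_fin.
- apply: ge0_le_lower_integral => x; last exact: hf.
  by rewrite lee_fin.
Qed.

Lemma ge0_integral_comp d1 d2 (T1 : measurableType d1) (T2 : measurableType d2)
    (R : realType) (P : probability T1 R) (X : T1 -> T2)
    (mX : measurable_fun setT X) (f : T2 -> \bar R) :
  (forall y, 0 <= f y) -> measurable_fun setT f ->
  \int[P]_x f (X x) = \int[distribution P (to_mfun mX)]_y f y.
Proof.
move=> f0 mf; by rewrite (@ge0_integral_distribution _ _ _ _ _ P (to_mfun mX)).
Qed.

Lemma probability_integral_cst d (T : measurableType d) (R : realType)
  (P : probability T R) (r : \bar R) : \int[P]_x r = r.
Proof.
have h := integral_cst P measurableT r.
rewrite (_ : r * P [set: T] = r) in h; last by rewrite [P _]probability_setT mule1.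
exact: h.
Qed.

Lemma countable_bigcup_measurable d (T : measurableType d) (I : countType)
    (D : set I) (F : I -> set T) :
  (forall i, D i -> measurable (F i)) -> measurable (\bigcup_(i in D) F i).
Proof.
move=> mF; pose G n := if choice.unpickle n is Some i then
  (if i \in D then F i else set0) else set0.
rewrite (_ : \bigcup_(i in D) F i = \bigcup_n G n).
  apply: bigcup_measurable => n _; rewrite /G; case: choice.unpickle => // i.
  by case: ifPn => // /set_mem; exact: mF.
apply/seteqP; split => [x [i Di Fi]|x [n _]]; last first.
  by rewrite /G; case: choice.unpickle => // i; case: ifPn => // /set_mem Di Fi; exists i.
by exists (choice.pickle i) => //; rewrite /G choice.pickleK mem_set.
Qed.

(** * Infinite sequences of independent variables *)

Section sequence_space.
Context d (T : measurableType d).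

Definition cylinder (n : nat) (B : nat -> set T) : set (nat -> T) :=
  [set z | forall i, (i < n)%N -> B i (z i)].

Definition cylinders : set_system (nat -> T) :=
  [set C | exists n (B : nat -> set T),
    (forall i, measurable (B i)) /\ C = cylinder n B].

Definition seqspace := g_sigma_algebraType cylinders.

Lemma measurable_cylinder n (B : nat -> set T) :
  (forall i, measurable (B i)) -> measurable (cylinder n B : set seqspace).
Proof. by move=> mB; apply: sub_sigma_algebra; exists n, B. Qed.

Lemma measurable_coord i : measurable_fun setT (fun z : seqspace => z i).
Proof.
move=> _ B mB; rewrite setTI.
rewrite [X in measurable X](_ : _ =
    cylinder i.+1 (fun j => if j == i then B else setT)); last first.
  apply/seteqP; split => z /=.
    by move=> Bz j _; case: eqP => // ->.
  by move=> /(_ i); rewrite ltnSn eqxx; exact.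
by apply: measurable_cylinder => j; case: eqP.
Qed.

Lemma measurable_seqspaceP d' (U : measurableType d') (f : U -> seqspace) :
  (forall i, measurable_fun setT (fun u => f u i)) -> measurable_fun setT f.
Proof.
move=> mf; apply: (@measurability _ _ U seqspace setT f cylinders) => //.
move=> _ [_ [n [B [mB ->]] <-]]; rewrite setTI.
rewrite [X in measurable X](_ : _ =
    \bigcap_(i < n) ((fun u => f u i) @^-1` B i)); last first.
  by apply/seteqP; split => u.
apply: bigcap_measurableType => i _.
by rewrite -[X in measurable X]setTI; exact: mf.
Qed.

Lemma cylinders_setI : setI_closed cylinders.
Proof.
move=> _ _ [n [B [mB ->]]] [m [C [mC ->]]].
exists (maxn n m), (fun i => (if (i < n)%N then B i else setT) `&`
                             (if (i < m)%N then C i else setT)); split.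
  by move=> i; apply: measurableI; case: ifP.
apply/seteqP; split => z /=.
  by move=> [Bz Cz] i _; split; case: ifP => // /[dup]; [move=> /Bz|move=> /Cz].
move=> BC; split => i im.
  by have [|+ _] := BC i; rewrite ?leq_max ?im.
by have [|_] := BC i; rewrite ?leq_max ?im ?orbT.
Qed.

Lemma seqspace_measure_unique (R : realType) (mu mu' : probability seqspace R) :
  (forall n B, (forall i, measurable (B i)) ->
    mu (cylinder n B) = mu' (cylinder n B)) ->
  forall A, measurable A -> mu A = mu' A.
Proof.
move=> mumu' A mA; apply: (@measure_unique _ R seqspace cylinders (fun=> setT)) => //.
- exact: cylinders_setI.
- move=> i; exists 0%N, (fun=> setT); split => //.
  by apply/seteqP; split.
- by rewrite bigcup_const //; exists 0%N.
- by move=> _ [n [B [mB ->]]]; exact: mumu'.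
- by move=> k; apply: (le_lt_trans (probability_le1 _ _)) => //; rewrite ltry.
Qed.

Definition shift (z : seqspace) : seqspace := fun i => z i.+1.

Lemma measurable_shift : measurable_fun setT shift.
Proof. by apply: measurable_seqspaceP => i; exact: measurable_coord. Qed.

End sequence_space.

Section iid_law.
Context d (T : measurableType d) (R : realType).

(** [mu] is the countable power of [nu]. Such laws are not constructed: they are
    read on the variables that a stick-breaking representation provides. *)
Definition iid_law (mu : probability (seqspace T) R) (nu : probability T R) :=
  forall n B, (forall i, measurable (B i)) ->
    mu (cylinder n B) = \prod_(i < n) nu (B i).

Lemma iid_law_unique (mu mu' : probability (seqspace T) R) nu :
  iid_law mu nu -> iid_law mu' nu ->
  forall A, measurable A -> mu A = mu' A.
Proof.
by move=> munu mu'nu; apply: seqspace_measure_unique => n B mB; rewrite munu// mu'nu.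
Qed.

Lemma measurable_uncons : measurable_fun setT
  (fun z : seqspace T => (z 0%N, shift z) : T * seqspace T).
Proof.
apply: measurable_fun_pair; first exact: measurable_coord.
exact: measurable_shift.
Qed.

Variables (mu : probability (seqspace T) R) (nu : probability T R).
Hypothesis munu : iid_law mu nu.

(** The tail of an i.i.d. sequence is independent of the head and has the law
    of the whole sequence: this is what every expectation of a functional of
    stick-breaking type is computed from. *)
Lemma iid_law_uncons (C : set (T * seqspace T)) : measurable C ->
  mu [set z | C (z 0%N, shift z)] = (nu \x mu) C.
Proof.
pose h := to_mfun measurable_uncons.
suff heq (A : set T) : measurable A ->
    forall E, measurable E -> mu (h @^-1` (A `*` E)) = nu A * mu E.
  move=> mC; rewrite (@product_measure_unique _ _ _ _ R nu mu (distribution mu h))//.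
  by move=> A E mA mE; exact: heq.
move=> mA.
have mA0 : measurable (cylinder 1 (fun=> A) : set (seqspace T)).
  exact: measurable_cylinder.
pose m1 := pushforward (mrestr mu mA0) (@shift _ T).
pose m2 := mscale (NngNum (fine_ge0 (measure_ge0 nu A))) mu.
move=> E mE.
have -> : mu (h @^-1` (A `*` E)) = m1 E.
  rewrite /m1 /pushforward /= /mrestr; congr (mu _).
  apply/seteqP; split => z /=; first by move=> [Az Ez]; split => // -[|].
  by move=> [Ez Az]; split => //; exact: Az.
have m2E X : m2 X = nu A * mu X.
  by rewrite /m2 /mscale/= fineK// fin_num_measure.
rewrite -m2E.
apply: (@measure_unique _ R (seqspace T) (@cylinders _ T) (fun=> setT) _ _ _ _ m1 m2) => //.
- exact: cylinders_setI.
- by move=> i; exists 0%N, (fun=> setT); split => //; apply/seteqP; split.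
- by rewrite bigcup_const //; exists 0%N.
- exact: measurable_shift.
- move=> ? _ [n [B [mB ->]]].
  apply: (etrans _ (esym (m2E _))); rewrite munu//.
  pose B' i := if i is j.+1 then B j else A.
  transitivity (mu (cylinder n.+1 B')).
    congr (mu _); apply/seteqP; split => z /=.
      by move=> [Bz Az] [_|i]; [exact: Az|exact: Bz].
    move=> B'z; split; first by move=> i ni; exact: (B'z i.+1).
    by move=> [_|//]; exact: (B'z 0%N).
  by rewrite munu; [rewrite big_ord_recl|case].
- move=> ? k; apply: (@le_lt_trans _ _ (mu setT)).
    apply: le_measure; rewrite ?inE//=.
    by rewrite preimage_setT setTI.
  by rewrite probability_setT ltry.
Qed.

Lemma iid_law_integral_uncons (f : T * seqspace T -> \bar R) :
  (forall x, 0 <= f x) -> measurable_fun setT f ->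
  \int[mu]_z f (z 0%N, shift z) = \int[nu]_t \int[mu]_z f (t, z).
Proof.
move=> f0 mf; rewrite -fubini_tonelli1//.
rewrite (ge0_integral_comp mu measurable_uncons)//.
by apply: eq_measure_integral => C mC _; exact: iid_law_uncons.
Qed.

End iid_law.

Section iid_law_map.
Context d d' (T : measurableType d) (U : measurableType d') (R : realType).
Variables (g : T -> U) (mg : measurable_fun setT g).

Definition map_seq (z : seqspace T) : seqspace U := fun i => g (z i).

Lemma measurable_map_seq : measurable_fun setT map_seq.
Proof.
apply: measurable_seqspaceP => i.
by apply: measurableT_comp => //; exact: measurable_coord.
Qed.

Lemma iid_law_map (mu : probability (seqspace T) R) (nu : probability T R)
    (nu' : probability U R) :
  iid_law mu nu -> (forall A, measurable A -> nu (g @^-1` A) = nu' A) ->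
  iid_law (distribution mu (to_mfun measurable_map_seq)) nu'.
Proof.
move=> munu nunu' n B mB.
transitivity (mu (cylinder n (fun i => g @^-1` (B i)))) => //.
rewrite munu => [|i]; last by rewrite -[X in measurable X]setTI; exact: mg.
by apply: eq_bigr => i _; exact: nunu'.
Qed.

End iid_law_map.

Lemma rectangle_measure_unique d1 d2 (T1 : measurableType d1)
    (T2 : measurableType d2) (R : realType)
    (m1 m2 : {measure set (T1 * T2) -> \bar R}) :
  m1 setT < +oo ->
  (forall A B, measurable A -> measurable B -> m1 (A `*` B) = m2 (A `*` B)) ->
  forall C, measurable C -> m1 C = m2 C.
Proof.
move=> m1oo m12 C mC.
pose G : set_system (T1 * T2) := [set A `*` B | A in measurable & B in measurable].
apply: (@measure_unique _ R _ G (fun=> setT)) => //.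
- exact: measurable_prod_measurableType.
- move=> _ _ [A mA [B mB <-]] [A' mA' [B' mB' <-]].
  exists (A `&` A'); first exact: measurableI.
  by exists (B `&` B'); [exact: measurableI|rewrite setXI].
- by move=> i; exists setT => //; exists setT => //; rewrite setXTT.
- by rewrite bigcup_const //; exists 0%N.
- by move=> _ [A mA [B mB <-]]; exact: m12.
Qed.

Lemma prode_fin_num (R : realType) (I : Type) (r : seq I) (P : pred I) (F : I -> \bar R) :
  (forall i, P i -> F i \is a fin_num) -> \prod_(i <- r | P i) F i \is a fin_num.
Proof. by move=> FF; elim/big_ind : _ => // x y; exact: fin_numM. Qed.

Section pair_sequences.
Context d d1 d2 (Omega : measurableType d) (T1 : measurableType d1)
  (T2 : measurableType d2) (R : realType) (Pr : probability Omega R).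
Variables (nu1 : probability T1 R) (nu2 : probability T2 R).
Variable Z : nat -> Omega -> T1 * T2.
Hypothesis mZ : forall i, measurable_fun setT (Z i).
Hypothesis Zrect : forall n (A : nat -> set T1) (B : nat -> set T2),
  (forall i, measurable (A i)) -> (forall i, measurable (B i)) ->
  Pr [set w | forall i, (i < n)%N -> (A i `*` B i) (Z i w)] =
  \prod_(i < n) (nu1 (A i) * nu2 (B i)).

Lemma measurable_sequence : measurable_fun setT (fun w => Z^~ w : seqspace (T1 * T2)%type).
Proof. exact: measurable_seqspaceP. Qed.

Let meas_cyl n (C : nat -> set (T1 * T2)) (P : pred nat) :
  (forall i, measurable (C i)) ->
  measurable [set w | forall i, (i < n)%N -> P i -> C i (Z i w)].
Proof.
move=> mC; rewrite (_ : mkset _ =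
    \bigcap_(i in [set i | (i < n)%N /\ P i]) (Z i @^-1` C i)); last first.
  by apply/seteqP; split => w /= h; [move=> i []; exact: h|move=> i ? ?; exact: h].
apply: bigcap_measurableType => i _.
by rewrite -[X in measurable X]setTI; exact: mZ.
Qed.

Let prob_cyl n k (C : nat -> set (T1 * T2)) :
  (forall i, measurable (C i)) ->
  (forall i, (k <= i)%N -> exists A B, [/\ measurable A, measurable B & C i = A `*` B]) ->
  Pr [set w | forall i, (i < n)%N -> C i (Z i w)] = \prod_(i < n) (nu1 \x nu2) (C i).
Proof.
elim: k C => [|k IH] C mC rC.
  have /choice[A] : forall i, exists A, exists B, [/\ measurable A, measurable B & C i = A `*` B].
    by move=> i; exact: rC.
  move=> /choice[B AB].
  have -> : C = fun i => A i `*` B i by apply/funext => i; have [_ _ ->] := AB i.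
  rewrite Zrect; last 2 first.
  - by move=> i; have [] := AB i.
  - by move=> i; have [] := AB i.
  by apply: eq_bigr => i _; have [mA mB _] := AB i; rewrite product_measure1E.
have [nk|kn] := leqP n k.
  pose C' i := if (i < k)%N then C i else setT.
  have -> : [set w | forall i, (i < n)%N -> C i (Z i w)] =
            [set w | forall i, (i < n)%N -> C' i (Z i w)].
    by apply/seteqP; split => w /= + i ni => /(_ i ni); rewrite /C' (leq_trans ni nk).
  rewrite IH.
  - by apply: eq_bigr => i _; rewrite /C' (leq_trans (ltn_ord i) nk).
  - by move=> i; rewrite /C'; case: ifP.
  - move=> i ki; exists setT, setT; split => //.
    by rewrite /C' ltnNge ki /= setXTT.
have mCk := meas_cyl n (fun i => i != k) mC.
pose m1 := pushforward (mrestr Pr mCk) (Z k).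
pose K := \prod_(i < n | i != Ordinal kn) (nu1 \x nu2) (C i).
have K0 : (0 <= fine K)%R.
  by rewrite fine_ge0// /K prode_ge0.
pose m2 := mscale (NngNum K0) (nu1 \x nu2).
have m1E D : m1 D = Pr [set w | forall i, (i < n)%N -> (if i == k then D else C i) (Z i w)].
  rewrite /m1 /pushforward /mrestr; congr (Pr _); apply/seteqP; split => w /=.
    by move=> [DZ CZ] i ni; case: eqVneq => [->//|ik]; exact: CZ.
  move=> h; split; first by have := h k kn; rewrite eqxx.
  by move=> i ni ik; have := h i ni; rewrite (negbTE ik).
have m2E D : m2 D = \prod_(i < n) (nu1 \x nu2) (if i == k :> nat then D else C i).
  rewrite /m2 /mscale/= fineK; last first.
    by rewrite /K; apply: prode_fin_num => i _; exact: (fin_num_measure (nu1 \x nu2 : probability _ _)).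
  rewrite [RHS](bigD1 (Ordinal kn))//= eqxx muleC; congr (_ * _).
  by apply: eq_bigr => i ik; rewrite -val_eqE/= in ik; rewrite (negbTE ik).
transitivity (m1 (C k)).
  rewrite m1E; congr (Pr _); apply/seteqP; split => w /= + i ni => /(_ i ni).
    by case: eqVneq => // ->.
  by case: eqVneq => // ->.
transitivity (m2 (C k)); last first.
  by rewrite m2E; apply: eq_bigr => i _; case: eqVneq => // ->.
apply: (@rectangle_measure_unique _ _ T1 T2 R m1 m2) => //.
- apply: (@le_lt_trans _ _ (Pr setT)); last by rewrite probability_setT ltry.
  apply: le_measure; rewrite ?inE//=.
  by rewrite preimage_setT setTI.
- move=> A B mA mB.
  apply: (etrans (m1E _)); apply: (etrans _ (esym (m2E _))).
  rewrite (IH (fun i => if i == k then A `*` B else C i))//.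
    by move=> i; case: ifP => // _; exact: measurableX.
  move=> i; rewrite leq_eqVlt eq_sym => /predU1P[->|ki].
    by exists A, B; rewrite eqxx.
  by rewrite gtn_eqF//; exact: rC.
Qed.

Lemma pair_iid_law :
  iid_law (distribution Pr (to_mfun measurable_sequence)) (nu1 \x nu2).
Proof.
move=> n C mC.
pose C' i := if (i < n)%N then C i else setT.
transitivity (Pr [set w | forall i, (i < n)%N -> C' i (Z i w)]).
  congr (Pr _); apply/seteqP; split => w /= + i ni => /(_ i ni);
  by rewrite /C' ni.
rewrite (@prob_cyl _ n).
- by apply: eq_bigr => i _; rewrite /C' ltn_ord.
- by move=> i; rewrite /C'; case: ifP.
- by move=> i ni; exists setT, setT; split => //; rewrite /C' ltnNge ni/= setXTT.
Qed.

End pair_sequences.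

(** Consecutive terms of an i.i.d. sequence form an i.i.d. sequence of pairs;
    the second components are then a supply of fresh randomness. *)
Section pair_up.
Context d (T : measurableType d) (R : realType).
Variables (mu : probability (seqspace T) R) (nu : probability T R).

Definition pair_up (i : nat) (z : seqspace T) : T * T := (z i.*2, z i.*2.+1).

Lemma measurable_pair_up i : measurable_fun setT (pair_up i).
Proof. by apply: measurable_fun_pair; exact: measurable_coord. Qed.

Lemma pair_up_iid_law : iid_law mu nu ->
  iid_law (distribution mu (to_mfun (measurable_sequence measurable_pair_up)))
    (nu \x nu).
Proof.
move=> munu; apply: pair_iid_law => n A B mA mB.
pose C i := if odd i then B i./2 else A i./2.
transitivity (mu (cylinder n.*2 C)).
  congr (mu _); apply/seteqP; split => z /=.
    move=> AB i ni; rewrite /C -[in z i](odd_double_half i).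
    have /AB[/= Az Bz] : (i./2 < n)%N.
      by rewrite -ltn_double (leq_ltn_trans _ ni)// -[leqRHS](odd_double_half i) leq_addl.
    by case: (odd i).
  move=> Cz i ni; split => /=.
    by have := Cz i.*2; rewrite /C odd_double doubleK ltn_double; exact.
  have := Cz i.*2.+1; rewrite /C/= odd_double/= uphalf_double; apply.
  by rewrite -doubleS leq_double in ni *.
rewrite munu; last by move=> i; rewrite /C; case: ifP.
elim: n => [|n IH]; first by rewrite !big_ord0.
rewrite doubleS !big_ord_recr/= IH -muleA; congr (_ * (_ * _)).
  by rewrite /C odd_double doubleK.
by rewrite /C/= odd_double/= uphalf_double.
Qed.

End pair_up.

(** * From stick-breaking variables to an i.i.d. sequence *)

Lemma mutually_independent_seq d (Omega : measurableType d) (R : realType)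
    (Pr : probability Omega R) (I : choiceType) (F : I -> set_system Omega)
    (s : seq I) (A : I -> set Omega) :
  mutually_independent Pr F -> uniq s -> (forall i, i \in s -> F i (A i)) ->
  Pr [set w | forall i, i \in s -> A i w] = \prod_(i <- s) Pr (A i).
Proof.
move=> FI us FA; pose J := [fset x in s]%fset.
have Js : perm_eq (enum_fset J) s.
  by apply: uniq_perm => // i; rewrite /J !inE.
rewrite -(perm_big _ Js) -(FI J A); last by move=> i; rewrite /J !inE; exact: FA.
congr (Pr _); apply/seteqP; split => w /=.
  by move=> h i; rewrite /J /= !inE; exact: h.
by move=> h i si; apply: h; rewrite /J /= !inE.
Qed.

Section stick_breaking_sequence.
Context (R : realType) (X : completeMetricType R).
Context d (Omega : measurableType d) (Pr : probability Omega R).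
Variables (alpha : R) (P0 : probability (borel X) R).
Variables (X_ : nat -> {RV Pr >-> borel X}) (V_ : nat -> {RV Pr >-> R}).
Hypothesis sbv : stick_breaking_variables alpha P0 X_ V_.

Definition atom_stick (i : nat) (w : Omega) : borel X * R := (X_ i w, V_ i w).

Lemma measurable_atom_stick i : measurable_fun setT (atom_stick i).
Proof. by apply: measurable_fun_pair. Qed.

(** Independence of the family of all atoms and sticks makes the pairs of an atom
    and a stick i.i.d.; what follows on Dirichlet processes uses only the law of
    this sequence of pairs. *)
Lemma stick_breaking_iid_law (b : probability R R) :
  (forall A, measurable A -> b A = beta_law 1 alpha A) ->
  iid_law (distribution Pr (to_mfun (measurable_sequence measurable_atom_stick)))
    (P0 \x b).
Proof.
move=> bE; have [VI XP0 Vb] := sbv.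
apply: pair_iid_law => n A B mA mB.
pose s : seq (nat + nat) := map inl (iota 0 n) ++ map inr (iota 0 n).
pose E (k : nat + nat) := match k with inl i => X_ i @^-1` A i | inr i => V_ i @^-1` B i end.
have us : uniq s.
  rewrite cat_uniq !map_inj_uniq ?iota_uniq//=; try by move=> ? ? [].
  by rewrite andbT; apply/hasPn => _ /mapP[i _ ->]; apply/mapP => -[].
rewrite -(_ : [set w | forall i, i \in s -> E i w] = mkset _); last first.
  apply/seteqP; split => w /= h.
    move=> i ni; split.
      by apply: (h (inl i)); rewrite mem_cat map_f// mem_iota.
    by apply: (h (inr i)); rewrite mem_cat map_f ?orbT// mem_iota.
  by move=> [] i; rewrite mem_cat => /orP[] /mapP[j + [->]]; rewrite mem_iota/= => /h[].
rewrite (mutually_independent_seq VI us); last first.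
  move=> [] i _ /=.
    by exists (A i) => //; rewrite setTI.
  by exists (B i) => //; rewrite setTI.
rewrite big_cat/= !big_map -[X in iota 0 X]subn0 -/(index_iota _ _) !big_mkord.
rewrite -big_split/=; apply: eq_bigr => i _; congr (_ * _).
  exact: XP0.
by rewrite bE//; exact: Vb.
Qed.

End stick_breaking_sequence.

Section tuple_law.
Context d (E : measurableType d) (N : nat) (R : realType).

Definition rectangle (B : 'I_N -> set E) : set (N.-tuple E) :=
  [set t | forall i, B i (tnth t i)].

Definition rectangles : set_system (N.-tuple E) :=
  [set rectangle B | B in [set B | forall i, measurable (B i)]].

Lemma measurable_rectangle (B : 'I_N -> set E) :
  (forall i, measurable (B i)) -> measurable (rectangle B).
Proof.
move=> mB; rewrite (_ : rectangle B =
    \bigcap_(i in [set: 'I_N]) ((fun t => tnth t i) @^-1` (B i))); last first.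
  by apply/seteqP; split => t /= h i => [_|]; exact: h.
apply: fin_bigcap_measurable => [//|i _].
by rewrite -[X in measurable X]setTI; exact: measurable_tnth.
Qed.

Lemma measurable_tupleE : measurable = <<s rectangles >>.
Proof.
apply/seteqP; split.
  apply: smallest_sub; first exact: smallest_sigma_algebra.
  rewrite -bigcup_seq => A /= [i _ [B mB <-]].
  apply: sub_sigma_algebra.
  exists (fun j => if j == i then B else setT); first by move=> j /=; case: ifP.
  apply/seteqP; split => t /=; last by move=> [_ Bt] j; case: eqP => [->|].
  by move=> /(_ i); rewrite eqxx.
apply: smallest_sub; first exact: sigma_algebra_measurable.
by move=> _ [B mB <-]; exact: measurable_rectangle.
Qed.

Lemma tuple_measure_unique (m1 m2 : probability (N.-tuple E) R) :
  (forall B, (forall i, measurable (B i)) -> m1 (rectangle B) = m2 (rectangle B)) ->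
  forall A, measurable A -> m1 A = m2 A.
Proof.
move=> m12 A mA; apply: (@measure_unique _ R _ rectangles (fun=> setT)) => //.
- exact: measurable_tupleE.
- move=> _ _ [B mB <-] [B' mB' <-]; exists (fun i => B i `&` B' i).
    by move=> i; apply: measurableI.
  apply/seteqP; split => t /=; first by move=> h; split=> i; have [] := h i.
  by move=> [h h'] i; split; [exact: h|exact: h'].
- by move=> i; exists (fun=> setT) => //; apply/seteqP; split.
- by rewrite bigcup_const //; exists 0%N.
- by move=> _ [B mB <-]; exact: m12.
- by move=> k; apply: (le_lt_trans (probability_le1 _ _)) => //; rewrite ltry.
Qed.

End tuple_law.

(** * Measurability in separable metric spaces *)

Section metric_facts.
Context (R : realType) (X : completeMetricType R).
Implicit Types x y : X.

Lemma near_mdist x (e : R) : (0 < e)%R -> \forall y \near x, (mdist x y < e)%R.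
Proof.
by move=> e0; have := nbhsx_ballx x e e0; rewrite ballEmdist.
Qed.

Lemma nbhs_mdistP x (A : set X) :
  nbhs x A -> exists2 e : R, (0 < e)%R & forall y, (mdist x y < e)%R -> A y.
Proof.
by move=> /nbhs_ballP[e /= e0]; rewrite ballEmdist => h; exists e.
Qed.

Lemma continuous_mdist x : continuous (mdist x : X -> R).
Proof.
move=> y; apply/cvgrPdist_lt => e e0.
have := near_mdist y e0; apply: filterS => z yz.
have h1 := metric_triangle x y z; have h2 := metric_triangle x z y.
rewrite (metric_sym z y) in h2.
by rewrite ltr_distl; apply/andP; split; lra.
Qed.

Lemma continuous_borel_measurable (f : X -> R) :
  continuous f -> measurable_fun setT (f : borel X -> R).
Proof.
move=> /continuousP cf; apply: (measurability _ (RGenOpens.measurableE R)) => //.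
move=> _ [_ [a [b ->]] <-]; rewrite setTI.
by apply: sub_sigma_algebra; apply: cf; exact: interval_open.
Qed.

Lemma open_borel_measurable (A : set X) : open A -> measurable (A : set (borel X)).
Proof. by move=> oA; exact: sub_sigma_algebra. Qed.

Lemma closed_borel_measurable (A : set X) : closed A -> measurable (A : set (borel X)).
Proof.
move=> cA; rewrite -(setCK A); apply: measurableC.
by apply: open_borel_measurable; exact: closed_openC.
Qed.

Lemma measurable_borel_set1 x : measurable ([set x] : set (borel X)).
Proof.
apply: closed_borel_measurable; apply: accessible_closed_set1.
exact/hausdorff_accessible/metric_hausdorff.
Qed.

Hypothesis X_separable : separable_space X.

Lemma dense_sequence : exists u : nat -> X,
  forall x (e : R), (0 < e)%R -> exists n, (mdist x (u n) < e)%R.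
Proof.
have [D cD dD] := X_separable.
have [D0|[u]] := pfcard_geP cD.
  have [|x []] := dD setT _ openT; last by rewrite D0.
  by exists point.
exists u => x e e0.
have [||y [xy Dy]] := dD [set y | (mdist x y < e)%R].
- by exists x => /=; rewrite mdistxx.
- have : open ((mdist x : X -> R) @^-1` [set r | (r < e)%R]).
    apply: open_comp; last exact: open_lt.
    by move=> y _; exact: continuous_mdist.
  by [].
have [n _ un] := 'surj_u Dy; exists n.
by rewrite un.
Qed.

(** By density of [u], [mdist x y] is the infimum over [n] of
    [mdist (u n) x + mdist (u n) y], a sum of functions of one variable. *)
Lemma measurable_mdist :
  measurable_fun setT (fun z : borel X * borel X => mdist (z.1 : X) (z.2 : X)).
Proof.
have [u hu] := dense_sequence.
have md (x : X) : measurable_fun setT (mdist x : borel X -> R).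
  by apply: continuous_borel_measurable; exact: continuous_mdist.
apply: (measurability _ (RGenInftyO.measurableE R)) => //.
move=> _ [_ [r ->] <-]; rewrite setTI.
rewrite [X in measurable X](_ : _ = \bigcup_n
    (fun z : borel X * borel X => (mdist (u n) (z.1 : X) + mdist (u n) (z.2 : X))%R)
      @^-1` `]-oo, r[); last first.
  apply/seteqP; split => [[x y]|[x y] [n _]]; rewrite /= !in_itv/= => xyr.
    have [n xn] : exists n, (mdist x (u n) < (r - mdist x y) / 2)%R.
      by apply: hu; rewrite divr_gt0// subr_gt0.
    exists n => //=; rewrite in_itv/= metric_sym.
    have := metric_triangle (u n) x y; rewrite (metric_sym (u n) x) => h.
    by move: xn h => xn h; lra.
  apply: le_lt_trans xyr; rewrite (metric_sym (u n) x); exact: metric_triangle.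
apply: bigcup_measurable => n _; rewrite -[X in measurable X]setTI.
apply: (_ : measurable_fun setT _) => //.
by apply: measurable_funD; apply: measurableT_comp.
Qed.

Lemma measurable_fun_mdist d (U : measurableType d) (f g : U -> borel X) :
  measurable_fun setT f -> measurable_fun setT g ->
  measurable_fun setT (fun t => mdist (f t : X) (g t : X)).
Proof.
move=> mf mg.
exact: (measurableT_comp measurable_mdist (measurable_fun_pair mf mg)).
Qed.

End metric_facts.

(** * The weak topology has a countable subbase *)

Section cones.
Context (R : realType) (X : completeMetricType R).
Variable u : nat -> X.

(** The cones with rational height, integer slope and apex in a dense sequence are
    countably many; their finite maxima with [0] serve as test functions. *)
Definition cone (i : rat * nat * nat) (x : X) : R :=
  (ratr i.1.1 - i.1.2%:R * mdist (u i.2) x)%R.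

Definition cones (s : seq (rat * nat * nat)) (x : X) : R :=
  foldr (fun i m => Num.max (cone i x) m) 0%R s.

Lemma cones_ge0 s x : (0 <= cones s x)%R.
Proof. by elim: s => //= i s IH; rewrite le_max IH orbT. Qed.

Lemma cones_ub s (x : X) (r : R) : (0 <= r)%R ->
  (forall i, i \in s -> (cone i x <= r)%R) -> (cones s x <= r)%R.
Proof.
move=> r0; elim: s => //= i s IH h; rewrite ge_max h ?mem_head//= IH// => j js.
by rewrite h// in_cons js orbT.
Qed.

Lemma cones_sup s i (x : X) : i \in s -> (cone i x <= cones s x)%R.
Proof.
elim: s => //= j s IH; rewrite in_cons le_max => /predU1P[->|/IH ->].
  by rewrite lexx.
by rewrite orbT.
Qed.

Lemma continuous_cone i : continuous (cone i).
Proof.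
move=> x; rewrite /cone; apply: cvgB; first exact: cvg_cst.
by apply: cvgMr; exact: continuous_mdist.
Qed.

Lemma continuous_cones s : continuous (cones s).
Proof.
elim: s => [|i s IH] x /=; first exact: cvg_cst.
apply: (@continuous_max R X (cone i) (cones s)); [exact: continuous_cone|exact: IH].
Qed.

Lemma cones_bounded s : exists M : R, forall x, (`|cones s x| <= M)%R.
Proof.
exists (\sum_(i <- s) `|ratr i.1.1 : R|)%R => x.
rewrite ger0_norm ?cones_ge0//; apply: cones_ub; first exact: sumr_ge0.
move=> i si; rewrite (big_rem i)//=.
have h : (cone i x <= ratr i.1.1 :> R)%R.
  by rewrite /cone gerBl mulr_ge0// mdist_ge0.
apply: (le_trans h); apply: (le_trans (ler_norm _)).
by rewrite lerDl sumr_ge0.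
Qed.

Hypothesis hu : forall (x : X) (e : R), (0 < e)%R -> exists n, (mdist x (u n) < e)%R.

(** The apex is taken close to [x] and the slope steep enough for the cone to be
    negative where [g] is not known to exceed its height. *)
Lemma cone_approx (g : X -> R) (x : X) (t : R) :
  (forall y, 0 <= g y)%R ->
  (forall s, (s < g x)%R -> \forall y \near x, (s < g y)%R) ->
  (t < g x)%R ->
  exists i, (t < cone i x)%R /\ forall y, (cone i y <= g y)%R.
Proof.
move=> g0 lsc tg.
have [q] := rat_in_itvoo tg; rewrite in_itv/= => /andP[tq qg].
have [d d0 hd] := nbhs_mdistP (lsc _ qg).
pose q' : R := ratr q.
have [k kq] : exists k : nat, (`|q'| / (d / 2) < k%:R)%R.
  by exists (Num.bound (`|q'| / (d / 2)))%R; apply: archi_boundP; rewrite divr_ge0// ltW// divr_gt0.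
have k0 : (0 < k%:R :> R)%R by apply: le_lt_trans kq; rewrite divr_ge0// divr_ge0// ltW.
have kd : (`|q'| < k%:R * (d / 2))%R by rewrite -ltr_pdivrMr// divr_gt0.
have e0 : (0 < Num.min (d / 2) ((q' - t) / k%:R))%R.
  by rewrite lt_min divr_gt0//= divr_gt0// subr_gt0.
have [n] := hu x e0; rewrite lt_min => /andP[xn1 xn2].
rewrite metric_sym in xn1; rewrite metric_sym in xn2.
exists (q, k, n); split; rewrite /cone/= -/q'.
  rewrite ltr_pdivlMr// mulrC in xn2.
  by move: xn2; set a := (_ * _)%R => h; lra.
move=> y; have [yd|yd] := ltP (mdist x y) d.
  apply: ltW; apply: le_lt_trans (hd _ yd).
  by rewrite gerBl mulr_ge0// mdist_ge0.
apply: le_trans (g0 y).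
have h := metric_triangle x (u n) y; rewrite (metric_sym x (u n)) in h.
have {}h : (d / 2 <= mdist (u n) y)%R by lra.
rewrite subr_le0; apply: (le_trans (ler_norm _)); apply: (le_trans (ltW kd)).
by rewrite ler_pM2l.
Qed.

(** A nonnegative lower semicontinuous function is the increasing limit of
    finite maxima of cones, so that its integral is the supremum of theirs. *)
Lemma cones_integral_approx (mu : probability (borel X) R) (g : X -> R) (t : \bar R) :
  (forall y, 0 <= g y)%R ->
  (forall x s, (s < g x)%R -> \forall y \near x, (s < g y)%R) ->
  t < \int[mu]_x (g x)%:E ->
  exists s, (forall x, (cones s x <= g x)%R) /\ t < \int[mu]_x (cones s x)%:E.
Proof.
move=> g0 lsc tg.
pose ok (i : rat * nat * nat) := `[< forall y, (cone i y <= g y)%R >].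
pose e (n : nat) : seq (rat * nat * nat) :=
  if choice.unpickle n is Some i then (if ok i then [:: i] else [::]) else [::].
pose s n := flatten [seq e i | i <- iota 0 n].
have sok n i : i \in s n -> ok i.
  move=> /flatten_mapP[j _]; rewrite /e; case: choice.unpickle => // i'.
  by case: ifP => // oki'; rewrite inE => /eqP ->.
have sg n x : (cones (s n) x <= g x)%R.
  by apply: cones_ub => // i /sok /asboolP.
have snd n m x : (n <= m)%N -> (cones (s n) x <= cones (s m) x)%R.
  move=> nm; apply: cones_ub; first exact: cones_ge0.
  move=> i /flatten_mapP[j jn ij]; apply: cones_sup; apply/flatten_mapP.
  by exists j => //; move: jn; rewrite !mem_iota !add0n => /leq_trans; exact.
have scvg x : (cones (s n) x)%:E @[n --> \oo] --> (g x)%:E.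
  apply: cvg_EFin; first exact: nearW.
  apply/cvgrPdist_lt => eps eps0.
  have [i [ti oki]] := @cone_approx g x (g x - eps)%R g0 (lsc x) ltac:(lra).
  near=> n.
  have : (cone i x <= cones (s n) x)%R.
    apply: cones_sup; apply/flatten_mapP; exists (choice.pickle i).
      by rewrite mem_iota add0n; near: n; exists (choice.pickle i).+1.
    by rewrite /e choice.pickleK (_ : ok i) ?inE//; exact/asboolP.
  have := sg n x => h1 h2.
  by rewrite /= ger0_norm ?subr_ge0//; lra.
have mcones n : measurable_fun setT (fun x : borel X => (cones (s n) x)%:E).
  by apply/measurable_EFinP; apply: continuous_borel_measurable; exact: continuous_cones.
have limE : limn (fun n => \int[mu]_x (cones (s n) x)%:E) = \int[mu]_x (g x)%:E.
  rewrite -monotone_convergence//.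
  - by apply: eq_integral => x _; apply/cvg_lim => //; exact: scvg.
  - by move=> n x _; rewrite lee_fin cones_ge0.
  - by move=> x _ n m nm; rewrite lee_fin snd.
have nd : nondecreasing_seq (fun n => \int[mu]_x (cones (s n) x)%:E).
  move=> n m nm; apply: ge0_le_lower_integral => x; rewrite lee_fin ?cones_ge0//.
  exact: snd.
apply: contrapT => h; move: tg; apply/negP; rewrite -leNgt -limE.
apply: lime_le; first exact: ereal_nondecreasing_is_cvgn.
apply: nearW => n; rewrite leNgt; apply/negP => tn; apply: h.
by exists (s n).
Unshelve. all: by end_near. Qed.

End cones.

Lemma cvg_ptwsP (I : Type) (T : topologicalType) (F : set_system {ptws I -> T})
    (f : {ptws I -> T}) : Filter F ->
  F --> f <-> forall i, g i @[g --> F] --> f i.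
Proof.
move=> FF; split=> [Ff i A fA|Ff].
  have /(_ i) h := (@cvg_sup _ I (fun i => Topological.class
    (initial_topology (fun g : I -> T => g i))) F f FF).1 Ff.
  apply: h.
  exact: (@initial_continuous (I -> T) T (fun g : I -> T => g i) f A fA).
apply/(@cvg_sup _ I (fun i => Topological.class
    (initial_topology (fun g : I -> T => g i)))) => i A /=.
rewrite (@nbhsE (initial_topology (fun g : I -> T => g i))).
move=> [B [[V oV <-] Vf] BA].
apply: filterS BA _; apply: (Ff i V).
exact: open_nbhs_nbhs.
Qed.

Section weak_topology.
Context (R : realType) (X : completeMetricType R).
Hypothesis X_separable : separable_space X.

Local Notation W := (weak_probability R X).

Let u := sval (cid (dense_sequence X_separable)).
Let hu : forall (x : X) (e : R), (0 < e)%R -> exists n, (mdist x (u n) < e)%R.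
Proof. exact: svalP (cid (dense_sequence X_separable)). Qed.

Let cint (P : probability (borel X) R) (s : seq (rat * nat * nat)) : \bar R :=
  \int[P]_x (cones u s x)%:E.

Let lsc_continuous (g : X -> R) : continuous g ->
  forall x s, (s < g x)%R -> \forall y \near x, (s < g y)%R.
Proof.
move=> cg x s sg; have := cg x; move/cvgrPdist_lt => /(_ (g x - s)%R).
rewrite subr_gt0 => /(_ sg); apply: filterS => y /=.
by rewrite ltr_distl => /andP[]; lra.
Qed.

Let bounded_integrable (P : probability (borel X) R) (g : X -> R) :
  continuous g -> (exists M : R, forall x, (`|g x| <= M)%R) ->
  P.-integrable setT (fun x : borel X => (g x)%:E).
Proof.
move=> cg [M gM]; apply/integrableP; split.
  by apply/measurable_EFinP; exact: continuous_borel_measurable.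
apply: (@le_lt_trans _ _ (\int[P]_x (M%:E))).
  apply: ge0_le_lower_integral => x; first exact: abse_ge0.
  by rewrite lee_fin gM.
by rewrite probability_integral_cst ltry.
Qed.

Let Rintegral_shift (P : probability (borel X) R) (g : X -> R) (M : R) :
  continuous g -> (forall x, (`|g x| <= M)%R) ->
  \int[P]_x (M + g x)%:E = (M + Rintegral P setT g)%:E.
Proof.
move=> cg gM; have ig := bounded_integrable P cg (ex_intro _ M gM).
under eq_integral do rewrite EFinD.
rewrite integralD//; last first.
  apply: (@bounded_integrable P (cst M)); first by move=> x; exact: cvg_cst.
  by exists `|M|%R.
rewrite probability_integral_cst EFinD; congr (_ + _).
by rewrite fineK// integrable_fin_num.
Qed.

Let subbase (P : W) (l : seq (seq (rat * nat * nat) * rat)) (P' : W) :=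
  forall i, i \in l -> (ratr i.2)%:E < cint P' i.1.

Let Fnbhs (P : W) : set_system W :=
  [set A | exists l, subbase P l P /\ subbase P l `<=` A].

Let Fnbhs_filter P : Filter (Fnbhs P).
Proof.
split.
- by exists [::].
- move=> A B [l [lP lA]] [m [mP mB]]; exists (l ++ m); split.
    by move=> i; rewrite mem_cat => /orP[/lP|/mP].
  move=> P' h; split; [apply: lA|apply: mB] => i il; apply: h;
  by rewrite mem_cat il ?orbT.
- by move=> A B AB [l [lP lA]]; exists l; split => // P' /lA /AB.
Qed.

Let Fnbhs_lsc (P : W) (g : X -> R) (t : R) : continuous g ->
  (exists M : R, forall x, (`|g x| <= M)%R) ->
  (t < Rintegral P setT g)%R -> Fnbhs P [set P' : W | (t < Rintegral P' setT g)%R].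
Proof.
move=> cg [M gM] tg.
have cM : continuous (fun x => M + g x)%R.
  by move=> x; apply: cvgD; [exact: cvg_cst|exact: cg].
have [|||s [sg st]] := @cones_integral_approx R X u hu P (fun x => M + g x)%R (M + t)%:E.
- by move=> y; have := gM y; rewrite ler_norml => /andP[]; lra.
- exact: lsc_continuous.
- by rewrite Rintegral_shift// lte_fin ltrD2l.
have sfin : cint P s \is a fin_num.
  apply: integrable_fin_num => //; apply: bounded_integrable; last exact: cones_bounded.
  exact: continuous_cones.
have : (M + t < fine (cint P s))%R by rewrite -lte_fin fineK.
move=> /rat_in_itvoo[q]; rewrite in_itv/= => /andP[tq qs].
exists [:: (s, q)]; split.
  by move=> i; rewrite inE => /eqP ->/=; rewrite -[ltRHS]fineK.
move=> P' /(_ (s, q)); rewrite mem_head => /(_ isT)/= h.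
rewrite /= -(ltrD2l M) -lte_fin -(@Rintegral_shift P' g)//.
apply: (@lt_trans _ _ (ratr q)%:E); first by rewrite lte_fin.
apply: (lt_le_trans h); apply: ge0_le_lower_integral => x; rewrite lee_fin//.
exact: cones_ge0.
Qed.

Let RintegralN (P : probability (borel X) R) (g : X -> R) :
  continuous g -> (exists M : R, forall x, (`|g x| <= M)%R) ->
  Rintegral P setT (fun x => - g x)%R = (- Rintegral P setT g)%R.
Proof.
move=> cg bg; rewrite -[RHS]mulN1r -RintegralZl//; last exact: bounded_integrable.
by apply: eq_Rintegral => x _; rewrite mulN1r.
Qed.

Let Fnbhs_cvg (P : W) (f : bounded_continuous R X) :
  integral_against Q f @[Q --> Fnbhs P] --> integral_against P f.
Proof.
have FF := Fnbhs_filter P.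
have [cf bf] := svalP f; have [M fM] := bf.
apply/cvgrPdist_lt => e e0.
have h1 : Fnbhs P [set P' : W |
    (integral_against P f - e < integral_against P' f)%R].
  by apply: Fnbhs_lsc => //; rewrite ltrBlDr ltrDl.
have h2 : Fnbhs P [set P' : W |
    (- integral_against P f - e < - integral_against P' f)%R].
  rewrite /integral_against.
  have -> : [set P' : W | (- Rintegral P setT (sval f) - e < - Rintegral P' setT (sval f))%R] =
    [set P' : W | (- Rintegral P setT (sval f) - e < Rintegral P' setT (fun x => - sval f x))%R].
    by apply/seteqP; split => P' /=; rewrite RintegralN.
  apply: Fnbhs_lsc.
  - by move=> x; apply: cvgN; exact: cf.
  - by exists M => x; rewrite normrN.
  - by rewrite RintegralN// ltrBlDr ltrDl.
apply: filterS2 h1 h2 => P' /= h1 h2.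
by rewrite ltr_distl; apply/andP; split; lra.
Qed.

(** A bounded continuous function and its opposite are nonnegative up to a constant,
    so that their integrals are suprema of integrals of maxima of cones: countably
    many conditions describe all weak neighbourhoods. *)
Lemma weak_open_subbase (O : set W) (P : W) : open O -> O P ->
  exists l, subbase P l P /\ subbase P l `<=` O.
Proof.
move=> [U oU <-] UP.
suff : Fnbhs P (integral_against (R := R) (T := X) @^-1` U) by [].
have FF := Fnbhs_filter P.
suff h : integral_against Q @[Q --> Fnbhs P] -->
    (integral_against P : {ptws bounded_continuous R X -> R}).
  by apply: h; apply: open_nbhs_nbhs.
by apply/cvg_ptwsP => f; exact: Fnbhs_cvg.
Qed.

(** The countable subbase makes every weakly open set a countable union of finite
    intersections of sets defined by the integral of one function. *)
Lemma measurable_Pspace d (U : measurableType d) (S : U -> Pspace R X) :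
  (forall A, measurable A -> measurable_fun setT (fun u => as_probability (S u) A)) ->
  measurable_fun setT S.
Proof.
move=> mS; apply: (@measurability _ _ U (Pspace R X) setT S (@open W)) => //.
move=> _ [D openD <-]; rewrite setTI.
rewrite [X in measurable X](_ : _ =
  \bigcup_(l in [set l | subbase point l `<=` D])
    \bigcap_(i in [set` l]) [set u | (ratr i.2)%:E < cint (as_probability (S u)) i.1]).
  apply: countable_bigcup_measurable => // l _.
  apply: fin_bigcap_measurable => // i _.
  rewrite -[X in measurable X]setTI.
  apply: emeasurable_fun_o_infty => //.
  apply: measurable_fun_integral_kernel => //.
  - by move=> z; rewrite lee_fin cones_ge0.
  - by apply/measurable_EFinP; apply: continuous_borel_measurable; exact: continuous_cones.
apply/seteqP; split => w /=.
  by move=> /(weak_open_subbase openD)[l [lS lD]]; exists l.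
by move=> [l /= lD lS]; exact: lD.
Qed.

Let open_evaluation (A : set X) : open A ->
  measurable_fun setT (fun p : Pspace R X => as_probability p A).
Proof.
move=> oA.
have mA := open_borel_measurable oA.
apply: (measurability _ (ErealGenOInfty.measurableE R)) => //.
move=> _ [_ [r ->] <-]; rewrite setTI.
rewrite [X in measurable X](_ : _ =
  \bigcup_(s in [set s | forall x : X, (cones u s x <= \1_A x)%R])
    [set p : Pspace R X | r%:E < cint (as_probability p) s]).
  apply: countable_bigcup_measurable => // s _.
  apply: sub_sigma_algebra.
  have cs : continuous (cones u s) := @continuous_cones _ _ u s.
  have bs : exists M : R, forall x, (`|cones u s x| <= M)%R := cones_bounded u s.
  pose f : bounded_continuous R X := exist _ (cones u s) (conj cs bs).
  have cf : continuous (fun p : W => integral_against p f).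
    move=> p; apply: ((@cvg_ptwsP _ R ((fun q : W => integral_against q) @ nbhs p)
      (integral_against p) _).1 _ f).
    exact: (@initial_continuous _ _ (@integral_against R X) p).
  have cE (p : W) : cint p s = (integral_against p f)%:E.
    rewrite /integral_against fineK//; apply: integrable_fin_num => //.
    exact: bounded_integrable.
  have : open ((fun p : W => integral_against p f) @^-1` [set x | (r < x)%R]).
    by apply: open_comp; [move=> p _; exact: cf|exact: open_gt].
  congr (open _); apply/seteqP; split => p /=; by rewrite cE lte_fin.
apply/seteqP; split => p /=; rewrite in_itv/= andbT.
  move=> rA.
  have [|||s [sA sr]] := @cones_integral_approx R X u hu (as_probability p) \1_A r%:E.
  - by [].
  - move=> x t; rewrite indicE; have [xA|xA] := boolP (x \in A).
      rewrite in_setE in xA => t1.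
      have := open_nbhs_nbhs (conj oA xA); apply: filterS => y Ay.
      by rewrite indicE mem_set.
    by move=> t0; apply: nearW => y; rewrite (lt_le_trans t0).
  - by rewrite integral_indic// setIT.
  - by exists s.
move=> [s sA rs]; apply: (lt_le_trans rs).
rewrite -(@setIT _ A) -integral_indic//.
by apply: ge0_le_lower_integral => x; rewrite lee_fin ?cones_ge0.
Qed.

(** The indicator of an open set is lower semicontinuous, and its integral is a
    supremum of integrals of maxima of cones; Dynkin's lemma does the rest. *)
Lemma measurable_evaluation (A : set (borel X)) : measurable A ->
  measurable_fun setT (fun p : Pspace R X => as_probability p A).
Proof.
pose G := [set A : set (borel X) | measurable A /\
  measurable_fun setT (fun p : Pspace R X => as_probability p A)].
suff : <<s @open X >> `<=` G by move=> h /h[].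
rewrite -setI_closed_g_dynkin_g_sigma_algebra; last exact: openI.
apply: smallest_sub; last first.
  by move=> B oB; split; [exact: open_borel_measurable|exact: open_evaluation].
split.
- split => //; under eq_fun do rewrite probability_setT.
  exact: measurable_cst.
- move=> B [mB eB]; split; first exact: measurableC.
  under eq_fun do rewrite probability_setC//.
  exact: emeasurable_funB.
- move=> F tF GF; have mF n : measurable (F n : set (borel X)) by have [] := GF n.
  split; first exact: bigcup_measurable.
  under eq_fun do rewrite measure_bigcup//.
  apply: ge0_emeasurable_sum => // n _; by have [] := GF n.
Qed.

(** Probabilities that agree on Borel sets have the same integrals of continuous
    functions, so that no weakly open set separates them; laws on [Pspace] can then
    be computed from values on Borel sets only. *)
Lemma Pspace_indistinguishable (p q : Pspace R X) (B : set (Pspace R X)) :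
  measurable B -> (forall A, measurable A -> as_probability p A = as_probability q A) ->
  B p -> B q.
Proof.
move=> mB pq.
pose G := [set B : set (Pspace R X) | B p <-> B q].
suff : @measurable _ (Pspace R X) `<=` G by move=> /(_ B mB)[].
apply: smallest_sub.
  split => //; first by move=> C [h1 h2]; split=> -[_ h]; split => //; auto.
  move=> F hF; split => -[n _ h]; exists n => //; by have [] := hF n; auto.
move=> _ [U oU <-].
rewrite /G /= (_ : integral_against (R := R) (T := X) q = integral_against p)//.
apply/funext => f; rewrite /integral_against /Rintegral; congr fine.
by apply: (@eq_measure_integral _ (borel X) R setT (as_probability p) (as_probability q)) => A mA _; exact: esym (pq A mA).
Qed.

End weak_topology.

(** * Stick-breaking sums *)

Section weights.
Context (T : Type) (R : realType) (v : T -> R).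

Definition weight (i : nat) (z : nat -> T) : R :=
  (v (z i) * \prod_(j < i) (1 - v (z j)))%R.

Lemma weightS i z :
  weight i.+1 z = ((1 - v (z 0%N)) * weight i (fun k => z k.+1))%R.
Proof. by rewrite /weight big_ord_recl mulrCA. Qed.

Lemma sum_weight n z :
  (\sum_(i < n) weight i z = 1 - \prod_(i < n) (1 - v (z i)))%R.
Proof.
elim: n => [|n IH]; first by rewrite !big_ord0 subrr.
by rewrite !big_ord_recr/= IH /weight; ring.
Qed.

Hypothesis v01 : forall t, (0 <= v t <= 1)%R.

Lemma weight_ge0 i z : (0 <= weight i z)%R.
Proof.
rewrite mulr_ge0//; first by case/andP: (v01 (z i)).
by apply: prodr_ge0 => j _; rewrite subr_ge0; case/andP: (v01 (z j)).
Qed.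

Lemma sum_weight_le1 n z : (\sum_(i < n) weight i z <= 1)%R.
Proof.
rewrite sum_weight gerBl; apply: prodr_ge0 => j _.
by rewrite subr_ge0; case/andP: (v01 (z j)).
Qed.

(** The integral of [f] against the random measure with weights [weight i z]
    and atoms [z i]. *)
Definition stick_sum (f : T -> \bar R) (z : nat -> T) : \bar R :=
  \sum_(0 <= i <oo) (weight i z)%:E * f (z i).

Lemma stick_sum_ge0 f z : (forall t, 0 <= f t) -> 0 <= stick_sum f z.
Proof.
by move=> f0; apply: nneseries_ge0 => i _ _; rewrite mule_ge0// lee_fin weight_ge0.
Qed.

Lemma stick_sum_uncons f z : (forall t, 0 <= f t) ->
  stick_sum f z = (v (z 0%N))%:E * f (z 0%N) +
                  (1 - v (z 0%N))%:E * stick_sum f (fun k => z k.+1).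
Proof.
move=> f0; rewrite /stick_sum nneseries_recl//; last first.
  by move=> k _; rewrite mule_ge0// lee_fin weight_ge0.
congr (_ + _); first by rewrite /weight big_ord0 mulr1.
rewrite -nneseries_addn; last by move=> i; rewrite mule_ge0// lee_fin weight_ge0.
rewrite -nneseriesZl; last by move=> i _; rewrite mule_ge0// lee_fin weight_ge0.
by apply: eq_eseriesr => i _; rewrite addn1 weightS EFinM muleA.
Qed.

Lemma le_stick_sum f g z : (forall t, 0 <= f t) -> (forall t, f t <= g t) ->
  stick_sum f z <= stick_sum g z.
Proof.
move=> f0 fg; apply: lee_nneseries => [i _ _|i _].
  by rewrite mule_ge0// lee_fin weight_ge0.
by rewrite lee_wpmul2l// lee_fin weight_ge0.
Qed.

Lemma stick_sumZ (c : R) f z : (0 <= c)%R -> (forall t, 0 <= f t) ->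
  stick_sum (fun t => c%:E * f t) z = c%:E * stick_sum f z.
Proof.
move=> c0 f0; rewrite /stick_sum -nneseriesZl; last first.
  by move=> i _; rewrite mule_ge0// lee_fin weight_ge0.
by apply: eq_eseriesr => i _; rewrite muleCA.
Qed.

Definition mass (z : nat -> T) : \bar R := stick_sum (fun=> 1) z.

Lemma mass_le1 z : mass z <= 1.
Proof.
apply: lime_le.
  apply: is_cvg_nneseries => i _ _.
  by rewrite mule_ge0// lee_fin weight_ge0.
apply: nearW => n; under eq_bigr do rewrite mule1.
by rewrite sumEFin lee_fin big_mkord sum_weight_le1.
Qed.

Lemma stick_sum_le (M : R) f z : (0 <= M)%R -> (forall t, 0 <= f t <= M%:E) ->
  stick_sum f z <= M%:E.
Proof.
move=> M0 fM; have f0 t : 0 <= f t by case/andP: (fM t).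
apply: (@le_trans _ _ (stick_sum (fun=> M%:E * 1) z)).
  by apply: le_stick_sum => // t; rewrite mule1; case/andP: (fM t).
by rewrite stick_sumZ// -[leRHS]mule1 lee_wpmul2l ?lee_fin// mass_le1.
Qed.

End weights.

Section measurable_weights.
Context d (T : measurableType d) (R : realType) (v : T -> R).
Hypothesis mv : measurable_fun setT v.
Hypothesis v01 : forall t, (0 <= v t <= 1)%R.

Lemma measurable_weight i : measurable_fun setT (weight v i : seqspace T -> R).
Proof.
have mz j : measurable_fun setT (fun z : seqspace T => v (z j)).
  by apply: measurableT_comp => //; exact: measurable_coord.
apply: measurable_funM => //; apply: measurable_prod => j _.
exact: measurable_funB.
Qed.

Lemma measurable_stick_sum (f : T -> \bar R) :
  (forall t, 0 <= f t) -> measurable_fun setT f ->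
  measurable_fun setT (stick_sum v f : seqspace T -> \bar R).
Proof.
move=> f0 mf; apply: ge0_emeasurable_sum => [i z _ _|i _].
  by rewrite mule_ge0// lee_fin weight_ge0.
apply: emeasurable_funM; first by apply/measurable_EFinP; exact: measurable_weight.
by apply: measurableT_comp => //; exact: measurable_coord.
Qed.

Variables (mu : probability (seqspace T) R) (nu : probability T R).
Hypothesis munu : iid_law mu nu.

Let mv' : measurable_fun setT (fun t => (v t)%:E).
Proof. exact/measurable_EFinP. Qed.
Let v'0 t : 0 <= (v t)%:E. Proof. by rewrite lee_fin; case/andP: (v01 t). Qed.
Let mw' : measurable_fun setT (fun t => (1 - v t)%:E).
Proof. by apply/measurable_EFinP; exact: measurable_funB. Qed.
Let w'0 t : 0 <= (1 - v t)%:E. Proof. by rewrite lee_fin subr_ge0; case/andP: (v01 t). Qed.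

Lemma integral_stick_sum_uncons (f : T -> \bar R) :
  (forall t, 0 <= f t) -> measurable_fun setT f ->
  \int[mu]_z stick_sum v f z =
  \int[nu]_t ((v t)%:E * f t) +
  (\int[nu]_t (1 - v t)%:E) * \int[mu]_z stick_sum v f z.
Proof.
move=> f0 mf.
have ms := measurable_stick_sum f0 mf.
have s0 z : 0 <= stick_sum v f z by exact: stick_sum_ge0.
pose h (x : T * seqspace T) :=
  (v x.1)%:E * f x.1 + (1 - v x.1)%:E * stick_sum v f x.2.
transitivity (\int[nu]_t \int[mu]_z h (t, z)).
  rewrite -(iid_law_integral_uncons munu).
  - by apply: eq_integral => z _; rewrite stick_sum_uncons.
  - by move=> x; rewrite adde_ge0// mule_ge0.
  - apply: emeasurable_funD; apply: emeasurable_funM.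
    + exact: (measurableT_comp mv').
    + exact: (measurableT_comp mf).
    + exact: (measurableT_comp mw').
    + exact: (measurableT_comp ms).
rewrite /h.
transitivity (\int[nu]_t ((v t)%:E * f t + (1 - v t)%:E * \int[mu]_z stick_sum v f z)).
  apply: eq_integral => t _ /=; rewrite ge0_integralD//=.
  - by rewrite probability_integral_cst ge0_integralZl.
  - by move=> z _; rewrite mule_ge0.
  - by move=> z _; rewrite mule_ge0.
  - exact: emeasurable_funM.
rewrite ge0_integralD//=.
- by rewrite ge0_integralZr// integral_ge0.
- by move=> t _; rewrite mule_ge0.
- exact: emeasurable_funM.
- by move=> t _; rewrite mule_ge0// integral_ge0.
- exact: emeasurable_funM.
Qed.

(** The mean measure of a stick-breaking random measure is the law of its
    atoms: its expectation [e] solves [e = a * m + (1 - a) * e], where [a] is the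
    mean of the first weight and [m] that of [f]. *)
Lemma integral_stick_sum (M a : R) (f : T -> \bar R) :
  (0 <= M)%R -> (forall t, 0 <= f t <= M%:E) -> measurable_fun setT f ->
  (0 < a)%R -> \int[nu]_t (v t)%:E = a%:E ->
  \int[nu]_t ((v t)%:E * f t) = a%:E * \int[nu]_t f t ->
  \int[mu]_z stick_sum v f z = \int[nu]_t f t.
Proof.
move=> M0 fM mf a0 va vfa.
have f0 t : 0 <= f t by case/andP: (fM t).
have eM (P : probability (seqspace T) R) : \int[P]_z stick_sum v f z \is a fin_num.
  rewrite ge0_fin_numE; last by apply: integral_ge0 => z _; exact: stick_sum_ge0.
  apply: (@le_lt_trans _ _ (\int[P]_z M%:E)).
    apply: ge0_le_lower_integral => z; first exact: stick_sum_ge0.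
    exact: stick_sum_le.
  by rewrite probability_integral_cst ltry.
have fM' : \int[nu]_t f t \is a fin_num.
  rewrite ge0_fin_numE; last exact: integral_ge0.
  apply: (@le_lt_trans _ _ (\int[nu]_z M%:E)).
    by apply: ge0_le_lower_integral => // t; case/andP: (fM t).
  by rewrite probability_integral_cst ltry.
have wa : \int[nu]_t (1 - v t)%:E = (1 - a)%:E.
  have : \int[nu]_t ((1 - v t)%:E + (v t)%:E) = 1.
    by under eq_integral do rewrite -EFinD subrK; rewrite probability_integral_cst.
  rewrite ge0_integralD// va; case: (\int[nu]_t (1 - v t)%:E) => // r.
  by rewrite -EFinD => -[<-]; rewrite addrK.
have := integral_stick_sum_uncons f0 mf; rewrite vfa wa.
have := eM mu; move: fM'; case: (\int[nu]_t f t) => // m _.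
case: (\int[mu]_z stick_sum v f z) => // e _.
rewrite -!EFinM -EFinD => -[eE]; congr EFin.
have : (a * (e - m) = 0)%R by move: eE; set x := (_ * m)%R; set y := ((1 - a) * e)%R; rewrite /x /y => eE; lra.
by move=> /eqP; rewrite mulf_eq0 (gt_eqF a0)/= subr_eq0 => /eqP.
Qed.

(** The mass is at most [1] and, by [integral_stick_sum], its mean is [1]. *)
Lemma mass_ae_eq1 (a : R) : (0 < a)%R -> \int[nu]_t (v t)%:E = a%:E ->
  {ae mu, forall z, mass v z = 1}.
Proof.
move=> a0 va.
have mm : measurable_fun setT (mass v : seqspace T -> \bar R).
  by apply: measurable_stick_sum.
have m0 z : 0 <= mass v z by exact: stick_sum_ge0.
have Em : \int[mu]_z mass v z = 1.
  rewrite (@integral_stick_sum 1%R a)//.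
  - by rewrite probability_integral_cst.
  - by move=> t; rewrite lee01 lexx.
  - by under eq_integral do rewrite mule1; rewrite va probability_integral_cst mule1.
have mE z : (1 - mass v z) + mass v z = 1.
  by rewrite subeK// ge0_fin_numE// (le_lt_trans (mass_le1 v01 z))// ltry.
have d0 z : 0 <= 1 - mass v z by rewrite sube_ge0 ?mass_le1// ge0_fin_numE// (le_lt_trans (mass_le1 v01 z))// ltry.
have md : measurable_fun setT (fun z : seqspace T => 1 - mass v z).
  exact: emeasurable_funB.
have Ed : \int[mu]_z `|1 - mass v z| = 0.
  under eq_integral do rewrite gee0_abs//.
  have : \int[mu]_z ((1 - mass v z) + mass v z) = 1.
    by under eq_integral do rewrite mE; rewrite probability_integral_cst.
  rewrite ge0_integralD// Em.
  case: (\int[mu]_z (1 - mass v z)) => // r.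
  by rewrite -EFinD => -[r1]; congr EFin; move: r1; set x := (r + 1)%R => r1; rewrite -(addrK 1%R r) -/x r1 subrr.
have := (ae_eq_integral_abs mu measurableT md).1 Ed.
apply: filterS => z /(_ Logic.I) h.
by rewrite -[LHS]add0e -[X in X + _]h mE.
Qed.

End measurable_weights.

(** * Stick-breaking random measures *)

Lemma mnormalize_mass1 d (T : measurableType d) (R : realType)
    (m : {measure set T -> \bar R}) (P : probability T R) A :
  m setT = 1 -> mnormalize m P A = m A.
Proof. by move=> m1; rewrite /mnormalize m1 onee_eq0/= invr1 mule1. Qed.

Section stick_prob.
Context (T : Type) (R : realType) (v : T -> R).
Context d (Y : measurableType d).

Definition stick_measure (y : T -> Y) (z : nat -> T) : {measure set Y -> \bar R} :=
  mseries (fun i => mscale (NngNum (normr_ge0 (weight v i z))) (dirac (y (z i)))) 0.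

(** The total mass is [1] for almost every [z] only; elsewhere [stick_prob] is a
    fixed Dirac mass. *)
Definition stick_prob (y : T -> Y) (z : nat -> T) : probability Y R :=
  mnormalize (if mass v z == 1 then stick_measure y z else dirac point) (dirac point).

Hypothesis v01 : forall t, (0 <= v t <= 1)%R.

Lemma stick_measureE y z A :
  stick_measure y z A = stick_sum v (fun t => \d_(y t) A) z.
Proof.
rewrite /stick_measure /= /mseries; apply: eq_eseriesr => i _.
by congr (_%:E * _); rewrite [LHS]ger0_norm// weight_ge0.
Qed.

Lemma stick_measureT y z : stick_measure y z setT = mass v z.
Proof.
rewrite stick_measureE /mass; congr (stick_sum _ _ _).
by apply/funext => t; rewrite diracT.
Qed.

Lemma stick_prob_case y z A : stick_prob y z A =
  if mass v z == 1 then stick_measure y z A else dirac (point : Y) A.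
Proof.
apply: (etrans (mnormalize_mass1 _ _ _)); last by case: ifP.
by case: ifPn => [/eqP z1|_]; [rewrite stick_measureT|exact: diracT].
Qed.

Lemma stick_probE' y z : mass v z = 1 ->
  (stick_prob y z : set Y -> \bar R) = stick_measure y z.
Proof. by move=> z1; apply/funext => A; rewrite stick_prob_case z1 eqxx. Qed.

Lemma stick_probE y z A : mass v z = 1 ->
  stick_prob y z A = stick_sum v (fun t => \d_(y t) A) z.
Proof. by move=> z1; rewrite stick_probE'// stick_measureE. Qed.

Lemma integral_stick_prob y z (f : Y -> \bar R) : mass v z = 1 ->
  (forall x, 0 <= f x) -> measurable_fun setT f ->
  \int[stick_prob y z]_x f x = stick_sum v (f \o y) z.
Proof.
move=> z1 f0 mf; rewrite stick_probE'// /stick_measure.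
rewrite ge0_integral_measure_series//; apply: eq_eseriesr => i _.
rewrite ge0_integral_mscale// integral_dirac// diracT mul1e.
by congr (_%:E * _); rewrite [LHS]ger0_norm// weight_ge0.
Qed.

End stick_prob.

Section measurable_stick_prob.
Context d d' (T : measurableType d) (Y : measurableType d') (R : realType).
Variables (v : T -> R) (y : T -> Y).
Hypothesis mv : measurable_fun setT v.
Hypothesis v01 : forall t, (0 <= v t <= 1)%R.
Hypothesis my : measurable_fun setT y.

Lemma measurable_stick_measure A : measurable A ->
  measurable_fun setT (fun z : seqspace T => stick_measure v y z A).
Proof.
move=> mA.
rewrite (_ : (fun z : seqspace T => stick_measure v y z A) =
  stick_sum v (fun t => \d_(y t) A)); last first.
  by apply/funext => z; rewrite stick_measureE.
apply: measurable_stick_sum => //.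
rewrite (_ : (fun t => _) = EFin \o (fun t => \1_A (y t))); last first.
  by apply/funext => t /=; rewrite diracE indicE.
by apply/measurable_EFinP; apply: measurableT_comp => //; exact: measurable_indic.
Qed.

Lemma measurable_stick_prob A : measurable A ->
  measurable_fun setT (fun z : seqspace T => stick_prob v y z A).
Proof.
move=> mA.
rewrite (_ : (fun z : seqspace T => stick_prob v y z A) = (fun z : seqspace T =>
  if mass v z == 1 then stick_measure v y z A else dirac (point : Y) A)); last first.
  by apply/funext => z; rewrite stick_prob_case.
apply: measurable_fun_ifT; last exact: measurable_cst.
  have mm : measurable_fun setT (mass v : seqspace T -> \bar R).
    exact: measurable_stick_sum.
  apply: (measurable_fun_bool true); rewrite setTI.
  rewrite (_ : _ @^-1` _ = (mass v : seqspace T -> \bar R) @^-1` [set 1]).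
    by rewrite -[X in measurable X]setTI; exact: mm.
  by apply/seteqP; split => z /= /eqP.
exact: measurable_stick_measure.
Qed.

End measurable_stick_prob.

Section stick_Wasserstein.
Context (R : realType) (X : completeMetricType R).
Hypothesis X_separable : separable_space X.

Lemma Wasserstein_ge0 (P Q : probability (borel X) R) : 0 <= Wasserstein P Q.
Proof.
apply: le_ereal_inf_tmp => _ [g _ <-].
by apply: integral_ge0 => z _; rewrite lee_fin mdist_ge0.
Qed.

(** Transporting atom to atom, with unchanged weights. *)
Lemma Wasserstein_stick_prob d (T : measurableType d) (v : T -> R)
    (x y : T -> borel X) (z : nat -> T) :
  (forall t, (0 <= v t <= 1)%R) -> mass v z = 1 ->
  Wasserstein (stick_prob v x z) (stick_prob v y z) <=
  stick_sum v (fun t => (mdist (x t : X) (y t : X))%:E) z.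
Proof.
move=> v01 z1.
pose g := stick_prob v (fun t => (x t, y t)) z.
have mc : measurable_fun setT
    (fun p : borel X * borel X => (mdist (p.1 : X) (p.2 : X))%:E).
  by apply/measurable_EFinP; exact: measurable_mdist.
have c0 (p : borel X * borel X) : 0 <= (mdist (p.1 : X) (p.2 : X))%:E.
  by rewrite lee_fin mdist_ge0.
apply: ereal_inf_lbound; exists g.
  by split=> A mA; rewrite !stick_probE.
by rewrite /g integral_stick_prob.
Qed.

End stick_Wasserstein.

(** * The law Beta(1, alpha) *)

Section powR_integral.
Context (R : realType).
Local Notation leb := (@lebesgue_measure R).

Lemma derivable_powR1 (c x : R) : (0 < x)%R -> derivable (fun y => y `^ c)%R x 1.
Proof. by move=> x0; apply: derivable_powR; rewrite in_itv/= x0. Qed.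

Lemma continuous_powR (c x : R) : (0 < x)%R -> {for x, continuous (fun y => y `^ c)%R}.
Proof.
move=> x0; apply/differentiable_continuous/derivable1_diffP.
exact: derivable_powR1.
Qed.

Lemma integral_powR (c p : R) : (0 < p)%R -> (0 < c <= 1)%R ->
  \int[leb]_(x in `[c, 1%R]) (x `^ (p - 1))%:E = (p^-1 * (1 - c `^ p))%:E.
Proof.
move=> p0 /andP[c0]; rewrite le_eqVlt => /predU1P[->|c1].
  by rewrite set_itv1 integral_set1 powR1 subrr mulr0.
have cgt x : x \in `]c, 1%R[ -> (0 < x)%R.
  by rewrite in_itv/= => /andP[cx _]; exact: lt_trans cx.
rewrite (@continuous_FTC2 _ _ (fun x => p^-1 * x `^ p)%R)//.
- by rewrite powR1 -EFinB mulr1 mulrBr mulr1.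
- apply: continuous_in_subspaceT => x; rewrite inE/= in_itv/= => /andP[cx _].
  by apply: continuous_powR; exact: lt_le_trans cx.
- split.
  + move=> x /cgt x0; apply: derivableM => //.
    exact: derivable_powR1.
  + apply: cvg_at_right_filter; apply: cvgMr.
    exact: continuous_powR.
  + apply: cvg_at_left_filter; apply: cvgMr.
    exact: continuous_powR.
- move=> x /cgt x0; rewrite derive1E deriveM//; last exact: derivable_powR1.
  have := is_derive1_powR p x0 => pE.
  by rewrite derive_cst scaler0 addr0 derive_val /GRing.scale/= mulrA mulVf ?gt_eqF// mul1r.
Qed.

Lemma integral_onem_powR (q p : R) : (0 < p)%R -> (0 <= q < 1)%R ->
  \int[leb]_(x in `[0%R, q]) ((1 - x) `^ (p - 1))%:E = (p^-1 * (1 - (1 - q) `^ p))%:E.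
Proof.
move=> p0 /andP[q0 q1].
rewrite (integration_by_substitution_onem (G := fun x => (1 - x) `^ (p - 1))%R)//.
- under eq_integral do rewrite /unstable.onem subKr.
  by rewrite /unstable.onem integral_powR// subr_gt0 q1/= gerBl.
- by rewrite q0 ltW.
- apply: continuous_in_subspaceT => x; rewrite inE/= in_itv/= => /andP[_ xq].
  have x1 : (0 < 1 - x)%R by rewrite subr_gt0; exact: le_lt_trans q1.
  apply: (@continuous_comp R R R (fun x : R => 1 - x)%R (fun y : R => y `^ (p - 1))%R x).
    by apply: continuousB; [exact: cvg_cst|exact: cvg_id].
  exact: continuous_powR.
Qed.

Lemma integral_powR01 (p : R) : (0 <= p)%R ->
  \int[leb]_(x in `[0%R, 1%R]) (1 - x `^ p)%:E = (p / (p + 1))%:E.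
Proof.
move=> p0; have p1 : (0 < p + 1)%R by rewrite ltr_wpDl.
have [->|pn0] := eqVneq p 0%R.
  by under eq_integral do rewrite powRr0 subrr; rewrite integral0 mul0r.
have {pn0}p0' : (0 < p)%R by rewrite lt0r pn0.
have pgt x : x \in `]0%R, 1%R[ -> (0 < x :> R)%R.
  by rewrite in_itv/= => /andP[].
have F0 (r : R) : (0 < r)%R -> (fun x => x `^ r)%R x @[x --> 0%R^'+] --> 0%R.
  exact: powR_cvg0.
rewrite (@continuous_FTC2 _ _ (fun x => x - (p + 1)^-1 * x `^ (p + 1))%R)//.
- rewrite powR1 powR0 ?gt_eqF// mulr0 subrr mulr1 -EFinB subr0; congr EFin.
  by field; rewrite gt_eqF.
- apply/(continuous_within_itvP _ ltr01); split.
  + move=> x /pgt x0; apply: (@cvgB R R^o _ (nbhs x)); first exact: cvg_cst.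
    exact: continuous_powR.
  + rewrite powR0 ?gt_eqF// subr0; rewrite -[X in _ --> X]subr0.
    by apply: cvgB; [exact: cvg_cst|exact: F0].
  + apply: cvg_at_left_filter; apply: cvgB; first exact: cvg_cst.
    exact: continuous_powR.
- split.
  + move=> x /pgt x0; apply: derivableB => //; apply: derivableM => //.
    exact: derivable_powR1.
  + rewrite powR0 ?gt_eqF//; apply: cvgB.
      by apply: cvg_at_right_filter; exact: cvg_id.
    by apply: cvgMr; exact: F0.
  + apply: cvg_at_left_filter; apply: cvgB; first exact: cvg_id.
    by apply: cvgMr; exact: continuous_powR.
- move=> x /pgt x0; rewrite derive1E deriveB//; last first.
    by apply: derivableM => //; exact: derivable_powR1.
  rewrite derive_id deriveM//; last exact: derivable_powR1.
  have := is_derive1_powR (p + 1)%R x0 => pE.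
  rewrite derive_cst scaler0 addr0 derive_val /GRing.scale/= addrK.
  by rewrite mulrA mulVf ?gt_eqF// mul1r.
Qed.

End powR_integral.

Lemma powR_le1 (R : realType) (x a : R) : (0 <= x <= 1)%R -> (0 <= a)%R -> (x `^ a <= 1)%R.
Proof.
move=> /andP[x0 x1] a0; have := @ge0_ler_powR R a a0 x 1%R.
by rewrite !nnegrE powR1 ler01 => /(_ x0 isT x1).
Qed.

Section beta_law.
Context (R : realType) (alpha : R) (b : probability R R).
Hypothesis alpha_gt0 : (0 < alpha)%R.
Hypothesis bE : forall A, measurable A -> b A = beta_law 1 alpha A.
Local Notation leb := (@lebesgue_measure R).

Let K : R := \int[leb]_(y in `]0%R, 1%R[) beta_kernel 1 alpha y.

Let K_ge0 : (0 <= K)%R.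
Proof.
apply: fine_ge0; apply: integral_ge0 => x _.
by rewrite lee_fin mulr_ge0// powR_ge0.
Qed.

Let m_onem : measurable_fun setT (fun x : R => (1 - x) `^ (alpha - 1))%R.
Proof.
apply: (measurableT_comp (@measurable_powR R _)).
exact: measurable_funB.
Qed.

Let bK A : measurable A ->
  b A = \int[leb]_(x in A `&` `]0%R, 1%R[) (((1 - x) `^ (alpha - 1))%:E * K^-1%:E).
Proof.
move=> mA; rewrite bE// /beta_law -/K; apply: eq_integral => x.
by rewrite /beta_kernel subrr powRr0 mul1r EFinM.
Qed.

Let b01 : b `]0%R, 1%R[%classic = 1.
Proof.
rewrite -(probability_setT b) !bK//; congr (integral _ _ _).
by rewrite setIid setTI.
Qed.

Let b_itv q : (0 <= q < 1)%R ->
  b `]-oo, q]%classic = ((alpha * K)^-1 * (1 - (1 - q) `^ alpha))%:E.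
Proof.
move=> /andP[q0 q1]; rewrite bK//.
rewrite (_ : _ `&` _ = `]0%R, q]%classic); last first.
  apply/seteqP; split => x /=; rewrite !in_itv/=; first by move=> [-> /andP[->]].
  by move=> /andP[-> xq]; rewrite xq (le_lt_trans xq).
rewrite ge0_integralZr//; last 3 first.
- exact/measurable_EFinP/measurable_funTS.
- by move=> x _; rewrite lee_fin powR_ge0.
- by rewrite lee_fin invr_ge0.
rewrite integral_itv_obnd_cbnd; last exact/measurable_EFinP/measurable_funTS.
rewrite integral_onem_powR ?q0// -EFinM; congr EFin.
by rewrite invfM; ring.
Qed.

Let K1 : ((alpha * K)^-1 = 1)%R.
Proof.
set c := (_^-1)%R.
pose q (n : nat) : R := (1 - (n.+1%:R^-1) `^ alpha^-1)%R.
have n1 (n : nat) : (0 < (n.+1%:R^-1 : R) <= 1)%R.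
  by rewrite invr_gt0 ltr0n/= invf_le1// ler1n.
have q01 n : (0 <= q n < 1)%R.
  have /andP[n0 n1'] := n1 n.
  rewrite subr_ge0 ltrBlDr ltrDl powR_gt0// andbT.
  by rewrite powR_le1// ?invr_ge0 ltW.
have bq n : b `]-oo, (q n)]%classic = (c * (1 - n.+1%:R^-1))%:E.
  rewrite b_itv// -/c subKr -powRrM mulVf ?gt_eqF// powRr1//.
have qnd n m : (n <= m)%N -> (q n <= q m)%R.
  move=> nm; rewrite lerD2l lerN2 ge0_ler_powR ?invr_ge0 ?nnegrE ?invr_ge0 ?ler0n//.
    exact: ltW.
  by rewrite lef_pV2 ?posrE// ler_nat.
have U : \bigcup_n `]-oo, (q n)]%classic = `]-oo, 1%R[%classic.
  apply/seteqP; split => x /=.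
    move=> [n _ /=]; rewrite !in_itv/= => /le_lt_trans; apply.
    by case/andP: (q01 n).
  rewrite in_itv/= => x1; have x1' : (0 < (1 - x) `^ alpha)%R by rewrite powR_gt0// subr_gt0.
  exists (Num.bound ((1 - x) `^ alpha)^-1) => //=; rewrite in_itv/= lerBrDr -lerBrDl.
  set n := Num.bound _.
  rewrite [leRHS](_ : _ = (((1 - x) `^ alpha) `^ alpha^-1)%R); last first.
    by rewrite -powRrM divff ?gt_eqF// powRr1// subr_ge0 ltW.
  rewrite ge0_ler_powR ?invr_ge0 ?nnegrE ?powR_ge0 ?ler0n//.
    exact: ltW.
  rewrite invf_ple ?posrE//.
  apply: ltW; apply: (@lt_trans _ _ n%:R); last by rewrite ltr_nat.
  by apply: archi_boundP; rewrite invr_ge0 ltW.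
have cv : b `]-oo, (q n)]%classic @[n --> \oo] --> b `]-oo, 1%R[%classic.
  rewrite -U; apply: nondecreasing_cvg_mu => //.
    exact: bigcup_measurable.
  move=> n m nm; apply/subsetPset => x /=; rewrite !in_itv/= => /le_trans; apply.
  exact: qnd.
have b1 : b `]-oo, 1%R[%classic = 1.
  apply/eqP; rewrite eq_le probability_le1//= -b01 le_measure ?inE//.
  by move=> x /=; rewrite !in_itv/= => /andP[].
have cv2 : (c * (1 - n.+1%:R^-1))%:E @[n --> \oo] --> c%:E.
  apply: cvg_EFin; first exact: nearW.
  rewrite -[X in _ --> X]mulr1; apply: cvgMr.
  rewrite -[X in _ --> X]subr0; apply: cvgB; first exact: cvg_cst.
  exact: cvg_harmonic.
have : c%:E = 1 :> \bar R.
  move: cv; rewrite (funext bq) b1 => cv; exact: (cvg_unique _ cv2 cv).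
by case.
Qed.

Lemma beta_cdf q : (0 <= q < 1)%R -> b `]-oo, q]%classic = (1 - (1 - q) `^ alpha)%:E.
Proof. by move=> q01; rewrite b_itv// K1 mul1r. Qed.

Lemma beta_support : b `]0%R, 1%R[%classic = 1.
Proof. exact: b01. Qed.

Lemma beta_set1 q : b [set q] = 0.
Proof.
rewrite bK//; apply/eqP; rewrite eq_le; apply/andP; split; last first.
  by apply: integral_ge0 => x _; rewrite mule_ge0// lee_fin ?powR_ge0// invr_ge0.
have mf : measurable_fun setT (fun x : R => ((1 - x) `^ (alpha - 1))%:E * K^-1%:E).
  by apply: emeasurable_funM => //; exact/measurable_EFinP.
rewrite -(@integral_set1 R (fun x => ((1 - x) `^ (alpha - 1))%:E * K^-1%:E) q).
apply: ge0_subset_integral => //.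
- exact: measurableI.
- exact: measurable_funTS.
- by move=> x _; rewrite mule_ge0// lee_fin ?powR_ge0// invr_ge0.
Qed.

Lemma beta_ltE q : (0 <= q <= 1)%R -> b `]-oo, q[%classic = (1 - (1 - q) `^ alpha)%:E.
Proof.
move=> /andP[q0]; rewrite le_eqVlt => /predU1P[->|q1].
  rewrite subrr powR0 ?gt_eqF// subr0.
  apply/eqP; rewrite eq_le probability_le1//= -b01 le_measure ?inE//.
  by move=> x /=; rewrite !in_itv/= => /andP[].
rewrite -beta_cdf ?q0// -(@setUitv1 _ _ -oo%O q true)//= measureU//.
- apply: esym; apply: (etrans (congr1 (fun z => b `]-oo, q[%classic + z) (beta_set1 q))).
  exact: adde0.
- by apply/seteqP; split => x //= []; rewrite in_itv/= => + xq; rewrite xq ltxx.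
Qed.

(** [1 - V] is a power of a uniform variable. *)
Lemma beta_uniform s : (0 <= s <= 1)%R ->
  b [set v | v < 1 /\ (1 - v) `^ alpha <= s]%R = s%:E.
Proof.
move=> /andP[s0 s1].
have s1' : (0 <= s `^ alpha^-1 <= 1)%R.
  by rewrite powR_ge0/= powR_le1 ?s0// invr_ge0 ltW.
have -> : [set v | v < 1 /\ (1 - v) `^ alpha <= s]%R =
    ~` `]-oo, (1 - s `^ alpha^-1)%R[%classic `\` `[1%R, +oo[%classic.
  apply/seteqP; split => v /=; rewrite !in_itv/= andbT.
    move=> [v1 vs]; split; apply/negP; rewrite -?leNgt -?ltNge//.
    rewrite lerBlDr -lerBlDl.
    rewrite [leLHS](_ : _ = (((1 - v) `^ alpha) `^ alpha^-1)%R); last first.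
      by rewrite -powRrM divff ?gt_eqF// powRr1// subr_ge0 ltW.
    rewrite ge0_ler_powR ?nnegrE ?powR_ge0 ?invr_ge0//.
    exact: ltW.
  move=> [/negP + /negP]; rewrite -leNgt -ltNge => h v1; split => //.
  rewrite [leRHS](_ : _ = ((s `^ alpha^-1) `^ alpha)%R); last first.
    by rewrite -powRrM mulVf ?gt_eqF// powRr1.
  by rewrite ge0_ler_powR ?nnegrE ?powR_ge0 ?subr_ge0//; first [exact: ltW|lra].
have b1 : b `[1%R, +oo[%classic = 0.
  apply/eqP; rewrite eq_le measure_ge0 andbT.
  rewrite -[leRHS](_ : b (~` `]0%R, 1%R[) = 0); last first.
    by rewrite probability_setC// b01 subee.
  apply: le_measure; rewrite ?inE//; first exact: measurableC.
  by move=> x /=; rewrite !in_itv/= andbT => x1 /andP[_]; rewrite ltNge x1.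
rewrite measureD//; last 2 first.
- exact: measurableC.
- by rewrite (le_lt_trans (probability_le1 _ _)) ?ltry//; exact: measurableC.
rewrite [X in _ - X](_ : _ = 0); last first.
  apply/eqP; rewrite eq_le measure_ge0 andbT -[leRHS]b1.
  apply: le_measure; rewrite ?inE//.
  by apply: measurableI => //; exact: measurableC.
rewrite sube0; apply: (etrans (probability_setC b (measurable_itv _))).
rewrite beta_ltE; last first.
  by case/andP: s1' => ? ?; apply/andP; split; lra.
rewrite subKr -powRrM mulVf ?gt_eqF// powRr1//.
by rewrite -EFinB subKr.
Qed.

End beta_law.

(** A stick lies in ]0, 1[ almost surely; clipping makes the weights nonnegative
    everywhere. *)
Definition clip {R : realType} (v : R) : R := Num.max 0%R (Num.min v 1%R).

Lemma clip01 (R : realType) (v : R) : (0 <= clip v <= 1)%R.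
Proof. by rewrite /clip le_max lexx/= ge_max ler01 ge_min lexx orbT. Qed.

Lemma clip_id (R : realType) (v : R) : (0 < v < 1)%R -> clip v = v.
Proof.
by move=> /andP[v0 v1]; rewrite /clip min_l ?ltW// max_r// ltW.
Qed.

Lemma measurable_clip (R : realType) : measurable_fun setT (@clip R).
Proof.
apply: measurable_maxr; first exact: measurable_cst.
apply: measurable_minr; first exact: measurable_id.
exact: measurable_cst.
Qed.

Section beta_moments.
Context (R : realType) (alpha : R) (b : probability R R).
Hypothesis alpha_gt0 : (0 < alpha)%R.
Hypothesis bE : forall A, measurable A -> b A = beta_law 1 alpha A.
Local Notation leb := (@lebesgue_measure R).

Lemma measurable_onem_clip_powR (p : R) :
  measurable_fun setT (fun v : R => (1 - clip v) `^ p)%R.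
Proof.
apply: (measurableT_comp (@measurable_powR R _)).
by apply: measurable_funB => //; exact: measurable_clip.
Qed.

(** By integration of the tail: [(1 - V) `^ p] exceeds [r] with probability
    [1 - r `^ (alpha / p)]. *)
Lemma beta_onem_moment (p : R) : (0 < p)%R ->
  \int[b]_v ((1 - clip v) `^ p)%:E = (alpha / (alpha + p))%:E.
Proof.
move=> p0.
have mX := measurable_onem_clip_powR p.
transitivity (expectation b (to_mfun mX)); first by rewrite unlock.
rewrite (@ge0_expectation_ccdf _ _ _ b (to_mfun mX)); last first.
  by move=> v; exact: powR_ge0.
transitivity (\int[leb]_(r in `[0%R, 1%R]) (1 - r `^ (alpha / p))%:E); last first.
  rewrite integral_powR01; last by rewrite divr_ge0// ltW.
  by congr EFin; field; rewrite !gt_eqF// ?addr_gt0.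
rewrite integral_mkcond [RHS]integral_mkcond; apply: eq_integral => r _.
rewrite !patchE; case: ifPn => r0; last first.
  rewrite ifF//; apply/negbTE; apply: contra r0; rewrite !inE/= !in_itv/=.
  by move=> /andP[->].
rewrite inE/= in_itv/= andbT in r0.
have [r1|r1] := leP 1%R r.
  rewrite (_ : (if _ then _ else _) = 0); last first.
    case: ifPn => //; rewrite inE/= in_itv/= => /andP[_ r1'].
    by rewrite (@le_anti _ _ r 1%R) ?r1 ?r1'// powR1 subrr.
  apply/eqP; rewrite eq_le measure_ge0 andbT.
  rewrite (_ : ccdf _ _ = 0)// -(measure0 b) /ccdf /distribution /pushforward.
  congr (b _).
  rewrite -subset0 => v /=; rewrite in_itv/= andbT ltNge => /negP; apply.
  apply: (le_trans _ r1); apply: powR_le1 (ltW p0).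
  by have := clip01 v => /andP[? ?]; apply/andP; split; lra.
rewrite ifT; last by rewrite inE/= in_itv/= r0 ltW.
have rp : (0 <= r `^ p^-1 < 1)%R.
  rewrite powR_ge0/=; have := @gt0_ltr_powR R p^-1 _ r 1%R.
  by rewrite powR1 !nnegrE invr_gt0; apply.
have rE : r = ((r `^ p^-1) `^ p)%R by rewrite -powRrM mulVf ?gt_eqF// powRr1.
transitivity (b `]-oo, (1 - r `^ p^-1)%R[%classic); last first.
  rewrite (beta_ltE alpha_gt0 bE); last by case/andP: rp => ? ?; apply/andP; split; lra.
  by rewrite subKr -powRrM mulrC.
rewrite /ccdf /distribution /pushforward; congr (b _).
apply/seteqP; split => v /=; rewrite !in_itv/= ?andbT.
  rewrite [in X in X -> _]rE => h.
  have {}h : (r `^ p^-1 < 1 - clip v)%R.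
    rewrite ltNge; apply/negP => h'; move: h; rewrite ltNge => /negP; apply.
    rewrite ge0_ler_powR// ?nnegrE ?powR_ge0 ?(ltW p0)//.
    by rewrite subr_ge0; case/andP: (clip01 v).
  have : (clip v < 1)%R by case/andP: rp => ? ?; lra.
  rewrite /clip gt_max ltr01/= gt_min ltxx orbF => v1.
  move: h; rewrite /clip [Num.min v _]min_l ?ltW// => h.
  have : (v <= Num.max 0 v)%R by rewrite le_max lexx orbT.
  by lra.
move=> h; rewrite [ltLHS]rE gt0_ltr_powR// ?nnegrE ?powR_ge0//.
  by rewrite subr_ge0; case/andP: (clip01 v).
case/andP: rp => rp0 rp1.
have v1 : (v < 1)%R by lra.
have cv : (clip v < 1 - r `^ p^-1)%R.
  by rewrite /clip min_l ?ltW// gt_max h andbT; lra.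
by lra.
Qed.

Lemma beta_mean_onem : \int[b]_v (1 - clip v)%:E = (alpha / (alpha + 1))%:E.
Proof.
rewrite -(beta_onem_moment ltr01); apply: eq_integral => v _.
by rewrite powRr1// subr_ge0; case/andP: (clip01 v).
Qed.

Lemma beta_mean : \int[b]_v (clip v)%:E = (1 / (alpha + 1))%:E.
Proof.
have mc : measurable_fun setT (fun v : R => (clip v)%:E).
  by apply/measurable_EFinP; exact: measurable_clip.
have : \int[b]_v ((1 - clip v)%:E + (clip v)%:E) = 1.
  by under eq_integral do rewrite -EFinD subrK; rewrite probability_integral_cst.
rewrite ge0_integralD//; last 3 first.
- by move=> v _; rewrite lee_fin subr_ge0; case/andP: (clip01 v).
- by apply/measurable_EFinP; apply: measurable_funB => //; exact: measurable_clip.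
- by move=> v _; rewrite lee_fin; case/andP: (clip01 v).
rewrite beta_mean_onem; case: (\int[b]_v (clip v)%:E) => // r.
rewrite -EFinD => -[h]; congr EFin.
have -> : (r = 1 - alpha / (alpha + 1))%R by move: h; set x := (alpha / _)%R => h; lra.
by field; rewrite gt_eqF// addr_gt0.
Qed.

Lemma beta_mean_onem2 :
  \int[b]_v ((1 - clip v) ^+ 2)%:E = (alpha / (alpha + 2))%:E.
Proof.
rewrite -(@beta_onem_moment 2%R)//; apply: eq_integral => v _.
by rewrite powR_mulrn// subr_ge0; case/andP: (clip01 v).
Qed.

Lemma beta_mean_mul_onem :
  \int[b]_v (clip v * (1 - clip v))%:E = (alpha / (alpha + 1) - alpha / (alpha + 2))%:E.
Proof.
have mc : measurable_fun setT (@clip R) := @measurable_clip R.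
have m1 : measurable_fun setT (fun v : R => 1 - clip v)%R by exact: measurable_funB.
have c0 (v : R) : (0 <= 1 - clip v)%R.
  by rewrite subr_ge0; case/andP: (clip01 v).
have : \int[b]_v ((clip v * (1 - clip v))%:E + ((1 - clip v) ^+ 2)%:E) =
    (alpha / (alpha + 1))%:E.
  rewrite -beta_mean_onem; apply: eq_integral => v _.
  by rewrite -EFinD; congr EFin; ring.
rewrite ge0_integralD//; last 4 first.
- by move=> v _; rewrite lee_fin mulr_ge0//; case/andP: (clip01 v).
- by apply/measurable_EFinP; exact: measurable_funM.
- by move=> v _; rewrite lee_fin exprn_ge0.
- by apply/measurable_EFinP; exact: measurable_funX.
rewrite beta_mean_onem2; case: (\int[b]_v (clip v * (1 - clip v))%:E) => // r.
by rewrite -EFinD => -[<-]; rewrite addrK.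
Qed.

End beta_moments.

(** * The law of a Dirichlet process *)

Lemma ae_eq_measure d (Omega : measurableType d) (R : realType)
    (P : {measure set Omega -> \bar R}) (E F : set Omega) :
  measurable E -> measurable F -> {ae P, forall w, E w <-> F w} -> P E = P F.
Proof.
move=> mE mF EF.
rewrite -(setIT E) -(setIT F) -!integral_indic//.
apply: ge0_ae_eq_integral => //.
- by apply/measurable_EFinP; exact: measurable_indic.
- by apply/measurable_EFinP; exact: measurable_indic.
apply: filterS EF => w EF _; congr EFin; rewrite !indicE.
have [wE|wE] := boolP (w \in E).
  by rewrite mem_set//; apply/EF; exact: set_mem.
by rewrite memNset// => /EF Ew; move: wE; rewrite mem_set.
Qed.

Section dirichlet_law.
Context (R : realType) (X : completeMetricType R).
Hypothesis X_separable : separable_space X.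
Variable alpha : R.
Hypothesis alpha_gt0 : (0 < alpha)%R.

Local Notation T := (borel X * R)%type.

Definition stick_of (t : T) : R := clip t.2.

Lemma stick_of01 t : (0 <= stick_of t <= 1)%R.
Proof. exact: clip01. Qed.

Lemma measurable_stick_of : measurable_fun setT stick_of.
Proof. by apply: (measurableT_comp (@measurable_clip R)). Qed.

Lemma measurable_stick_prob_Pspace d (T' : measurableType d) (v : T' -> R)
    (y : T' -> borel X) : (forall t, (0 <= v t <= 1)%R) ->
  measurable_fun setT v -> measurable_fun setT y ->
  measurable_fun setT (fun z : seqspace T' => stick_prob v y z : Pspace R X).
Proof.
move=> v01 mv my; apply: measurable_Pspace => // A mA.
exact: (measurable_stick_prob mv v01 my mA).
Qed.

Lemma beta_law_unique (b b' : probability R R) :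
  (forall A, measurable A -> b A = beta_law 1 alpha A) ->
  (forall A, measurable A -> b' A = beta_law 1 alpha A) ->
  forall A, measurable A -> b A = b' A.
Proof. by move=> bE b'E A mA; rewrite bE// b'E. Qed.

Lemma stick_breaking_ae d (Omega : measurableType d) (Pr : probability Omega R)
    (P0 : probability (borel X) R)
    (X_ : nat -> {RV Pr >-> borel X}) (V_ : nat -> {RV Pr >-> R}) :
  stick_breaking_variables alpha P0 X_ V_ ->
  {ae Pr, forall w, forall i,
    weight stick_of i (fun k => atom_stick X_ V_ k w) = stick_weight V_ i w}.
Proof.
move=> [_ _ Vb].
have bE A : measurable A -> distribution Pr (V_ 0%N) A = beta_law 1 alpha A.
  by move=> mA; rewrite (Vb 0%N).
have : {ae Pr, forall w, forall i, (0 < V_ i w < 1)%R}.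
  apply: ae_foralln => i.
  exists (V_ i @^-1` (~` `]0%R, 1%R[%classic)); split.
  - by rewrite -[X in measurable X]setTI; apply: measurable_funP => //; exact: measurableC.
  - rewrite -[LHS]/(distribution Pr (V_ i) (~` `]0%R, 1%R[%classic)).
    apply: (etrans (probability_setC (distribution Pr (V_ i)) (measurable_itv _))).
    rewrite [X in _ - X](_ : _ = 1) ?subee//.
    have mI : measurable (`]0%R, 1%R[%classic : set R) by [].
    apply: (etrans (Vb i _ mI)); apply: (etrans (esym (bE _ mI))).
    exact: (beta_support bE).
  - by move=> w /= h; rewrite in_itv.
apply: filterS => w V01 i.
rewrite /weight /stick_weight /stick_of /= clip_id//; congr (_ * _)%R.
by apply: eq_bigr => j _; rewrite clip_id.
Qed.

(** The representation is transported to the space of sequences, on which the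
    random probability becomes a fixed measurable function of its atoms and sticks. *)
Lemma dirichlet_process_data (P0 : probability (borel X) R) Q :
  dirichlet_process alpha P0 Q ->
  exists (b : probability R R) (mu : probability (seqspace T) R),
  [/\ forall A, measurable A -> b A = beta_law 1 alpha A,
      iid_law mu (P0 \x b) &
      forall B, measurable B -> Q B = mu [set z | B (stick_prob stick_of fst z)]].
Proof.
move=> [d [W [Pr [X_ [V_ [S [sbv SE SQ]]]]]]].
have [_ _ Vb] := sbv.
pose b : probability R R := distribution Pr (V_ 0%N).
have bE A : measurable A -> b A = beta_law 1 alpha A by move=> mA; exact: Vb.
pose zw (w : W) : seqspace T := fun k => atom_stick X_ V_ k w.
pose mu : probability (seqspace T) R :=
  distribution Pr (to_mfun (measurable_sequence (measurable_atom_stick X_ V_))).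
have ml : iid_law mu (P0 \x b) := stick_breaking_iid_law sbv bE.
exists b, mu; split => // B mB.
have msp := measurable_stick_prob_Pspace stick_of01 measurable_stick_of
  (@measurable_fst _ _ (borel X) R).
have mass1 : {ae Pr, forall w, mass stick_of (fun k => atom_stick X_ V_ k w) = 1}.
  have h1 := stick_breaking_ae sbv.
  apply: filterS2 h1 SE => w h1 h2.
  have := h2 setT measurableT; rewrite probability_setT => ->.
  by apply: eq_eseriesr => i _; rewrite h1 diracT.
rewrite -SQ//.
apply: (@ae_eq_measure _ _ _ Pr (S @^-1` B) [set w | B (stick_prob stick_of fst (zw w))]).
- by rewrite -[X in measurable X]setTI; exact: measurable_funP.
- rewrite -[X in measurable X]setTI.
  apply: (measurableT_comp msp (measurable_sequence (measurable_atom_stick X_ V_)) measurableT).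
  exact: mB.
have h1 := stick_breaking_ae sbv.
apply: filterS3 h1 SE mass1 => w h1 h2 h3.
have SP A : measurable A -> as_probability (S w) A =
    as_probability (stick_prob stick_of fst (fun k => atom_stick X_ V_ k w) : Pspace R X) A.
  move=> mA; rewrite h2// [RHS](stick_probE stick_of01)//.
  by apply: eq_eseriesr => i _; rewrite h1.
split.
  exact: (Pspace_indistinguishable mB SP).
apply: (Pspace_indistinguishable mB) => A mA.
exact: esym (SP A mA).
Qed.

(** The law of a Dirichlet process is determined by [alpha] and [P0], and can
    be read on any i.i.d. sequence producing the right atoms and sticks. *)
Lemma dirichlet_process_law (P0 : probability (borel X) R) Q
    d (T' : measurableType d) (y : T' -> borel X) (s : T' -> R)
    (mu : probability (seqspace T') R) (nu : probability T' R) (b : probability R R) :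
  dirichlet_process alpha P0 Q ->
  measurable_fun setT y -> measurable_fun setT s ->
  (forall A, measurable A -> b A = beta_law 1 alpha A) ->
  iid_law mu nu ->
  (forall A B, measurable A -> measurable B ->
    nu [set t | A (y t) /\ B (s t)] = P0 A * b B) ->
  forall B, measurable B -> Q B = mu [set z | B (stick_prob (clip \o s) y z)].
Proof.
move=> /dirichlet_process_data[b' [mu' [b'E mu'iid QE]]] my ms bE muiid nuE B mB.
rewrite QE//.
pose g (t : T') : T := (y t, s t).
have mg : measurable_fun setT g by exact: measurable_fun_pair.
have msp := measurable_stick_prob_Pspace stick_of01 measurable_stick_of
  (@measurable_fst _ _ (borel X) R).
have nug A : measurable A -> nu (g @^-1` A) = (P0 \x b') A.
  move=> mA; apply: (@rectangle_measure_unique _ _ _ _ R (distribution nu (to_mfun mg)) (P0 \x b')) => //.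
    by rewrite [X in X < _](@probability_setT _ _ _ (distribution nu (to_mfun mg))) ltry.
  move=> A' B' mA' mB'.
  apply: (etrans _ (esym (product_measure1E P0 b' mA' mB'))).
  apply: (etrans (nuE _ _ mA' mB')); congr (_ * _).
  exact: (beta_law_unique bE b'E).
have h := iid_law_map mg muiid nug.
rewrite (iid_law_unique mu'iid h)//.
by rewrite -[X in measurable X]setTI; exact: msp.
Qed.

End dirichlet_law.

(** * Upper bounds by explicit couplings *)

Lemma ge0_le_lower_integral_ae d (T : measurableType d) (R : realType)
    (mu : {measure set T -> \bar R}) (f g : T -> \bar R) :
  (forall x, 0 <= f x) -> (forall x, 0 <= g x) -> measurable_fun setT g ->
  {ae mu, forall x, f x <= g x} ->
  \int[mu]_x f x <= \int[mu]_x g x.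
Proof.
move=> f0 g0 mg [N [mN N0 fgN]].
pose h x := if x \in N then +oo else g x.
have h0 x : 0 <= h x by rewrite /h; case: ifP.
have mh : measurable_fun setT h.
  apply: measurable_fun_ifT => //.
  by apply: (measurable_fun_bool true); rewrite setTI preimage_mem_true.
rewrite (@ge0_ae_eq_integral _ _ _ mu setT g h)//; last first.
  exists N; split => // x /= hx; apply: contrapT => xN; apply: hx => _.
  by rewrite /h memNset.
apply: ge0_le_lower_integral => // x; rewrite /h.
case: ifPn => [_|/negP xN]; first exact: leey.
apply: contrapT => fgx; apply: xN; rewrite inE; exact: fgN.
Qed.

Lemma integral_prodM d1 d2 (T1 : measurableType d1) (T2 : measurableType d2)
    (R : realType) (m1 : probability T1 R) (m2 : probability T2 R)
    (f : T1 -> \bar R) (g : T2 -> \bar R) :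
  measurable_fun setT f -> (forall x, 0 <= f x) ->
  measurable_fun setT g -> (forall x, 0 <= g x) ->
  \int[m1 \x m2]_z (f z.1 * g z.2) = (\int[m1]_x f x) * (\int[m2]_y g y).
Proof.
move=> mf f0 mg g0; rewrite fubini_tonelli1//=.
- transitivity (\int[m1]_x (f x * \int[m2]_y g y)).
    by apply: eq_integral => x _; rewrite /fubini_F /= ge0_integralZl.
  by rewrite ge0_integralZr// integral_ge0.
- apply: emeasurable_funM; first exact: (measurableT_comp mf).
  exact: (measurableT_comp mg).
- by move=> z; rewrite mule_ge0.
Qed.

Section WoW_upper_bound.
Context (R : realType) (X : completeMetricType R).
Context d (Omega : measurableType d) (Pr : probability Omega R).
Variables (S S' : Omega -> Pspace R X) (Q Q' : probability (Pspace R X) R).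
Hypothesis mS : measurable_fun setT S.
Hypothesis mS' : measurable_fun setT S'.
Hypothesis SQ : forall B, measurable B -> Q B = Pr [set w | B (S w)].
Hypothesis SQ' : forall B, measurable B -> Q' B = Pr [set w | B (S' w)].

(** Two random probabilities on a common space couple their laws. *)
Lemma WoW_le_integral :
  WoW Q Q' <= \int[Pr]_w Wasserstein (as_probability (S w)) (as_probability (S' w)).
Proof.
have mSS' : measurable_fun setT (fun w => (S w, S' w)) by exact: measurable_fun_pair.
pose g : probability (Pspace R X * Pspace R X)%type R := distribution Pr (to_mfun mSS').
apply: (@le_trans _ _ (\int[g]_z Wasserstein (as_probability z.1) (as_probability z.2))).
  apply: ereal_inf_lbound; exists g => //; split => A mA.
    by rewrite SQ.
  by rewrite SQ'.
apply: (ge0_le_lower_integral_pushforward Pr (to_mfun mSS')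
  (f := fun z => Wasserstein (as_probability z.1) (as_probability z.2))) => z.
exact: Wasserstein_ge0.
Qed.

Lemma WoW_le (c : Omega -> \bar R) :
  (forall w, 0 <= c w) -> measurable_fun setT c ->
  {ae Pr, forall w, Wasserstein (as_probability (S w)) (as_probability (S' w)) <= c w} ->
  WoW Q Q' <= \int[Pr]_w c w.
Proof.
move=> c0 mc Wc; apply: (le_trans WoW_le_integral).
by apply: ge0_le_lower_integral_ae => // w; exact: Wasserstein_ge0.
Qed.

End WoW_upper_bound.

(** * Truncation of the stick-breaking sum *)

Section truncated.
Context (R : realType) (X : completeMetricType R).
Hypothesis X_separable : separable_space X.
Hypothesis X_bounded : finite_diameter X.
Variable alpha : R.
Hypothesis alpha_gt0 : (0 < alpha)%R.

Local Notation T := (borel X * R)%type.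

Lemma diameter_ge0 : exists2 M : R, (0 <= M)%R & forall x y : X, (mdist x y <= M)%R.
Proof.
have [M hM] := X_bounded; exists M => //.
by rewrite (le_trans _ (hM point point))// mdist_ge0.
Qed.

Section mean.
Variables (P0 : probability (borel X) R) (b : probability R R).
Hypothesis bE : forall A, measurable A -> b A = beta_law 1 alpha A.
Variable mu : probability (seqspace T) R.
Hypothesis mu_iid : iid_law mu (P0 \x b).

Let mclip : measurable_fun setT (fun v : R => (clip v)%:E).
Proof. by apply/measurable_EFinP; exact: measurable_clip. Qed.

Let clip0 (v : R) : 0 <= (clip v)%:E.
Proof. by rewrite lee_fin; case/andP: (clip01 v). Qed.

Lemma integral_stick_of : \int[P0 \x b]_t (stick_of t)%:E = (1 / (alpha + 1))%:E.
Proof.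
rewrite -[RHS](beta_mean alpha_gt0 bE) -[RHS]mul1e.
rewrite -{1}(probability_integral_cst P0 1).
rewrite -(@integral_prodM _ _ _ _ _ P0 b (fun=> 1) (fun v => (clip v)%:E))//.
by apply: eq_integral => t _; rewrite mul1e.
Qed.

Lemma stick_mean_gt0 : (0 < 1 / (alpha + 1))%R.
Proof. by rewrite divr_gt0// addr_gt0. Qed.

Lemma integral_stick_sum_atoms (M : R) (f : borel X -> \bar R) : (0 <= M)%R ->
  (forall x, 0 <= f x <= M%:E) -> measurable_fun setT f ->
  \int[mu]_z stick_sum (@stick_of _ _) (fun t => f t.1) z = \int[P0]_x f x.
Proof.
move=> M0 fM mf; have f0 x : 0 <= f x by case/andP: (fM x).
have fE : \int[P0 \x b]_t f t.1 = \int[P0]_x f x.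
  rewrite -[RHS]mule1 -(probability_integral_cst b 1).
  rewrite -(@integral_prodM _ _ _ _ _ P0 b f (fun=> 1))//.
  by apply: eq_integral => t _; rewrite mule1.
rewrite -fE.
apply: (@integral_stick_sum _ _ _ (@stick_of R X) (@measurable_stick_of R X)
  (@stick_of01 R X) mu (P0 \x b) mu_iid M (1 / (alpha + 1))) => //.
- exact: (measurableT_comp mf).
- exact: stick_mean_gt0.
- exact: integral_stick_of.
- rewrite fE muleC -[X in _ * X](beta_mean alpha_gt0 bE) -integral_prodM//.
  by apply: eq_integral => t _; rewrite muleC.
Qed.

Lemma mass_ae : {ae mu, forall z, mass (@stick_of R X) z = 1}.
Proof.
apply: (mass_ae_eq1 (@measurable_stick_of R X) (@stick_of01 R X) mu_iid stick_mean_gt0).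
exact: integral_stick_of.
Qed.

(** The transport cost of moving all atoms of index at least [M] to the [M]-th. *)
Definition trunc_cost (M : nat) (z : seqspace T) : \bar R :=
  \sum_(0 <= i <oo) (weight (@stick_of R X) i z)%:E *
    (mdist ((z i).1 : X) ((z (minn i M)).1 : X))%:E.

Let c0 M (z : seqspace T) i : 0 <= (weight (@stick_of R X) i z)%:E *
    (mdist ((z i).1 : X) ((z (minn i M)).1 : X))%:E.
Proof.
by rewrite mule_ge0// lee_fin ?weight_ge0 ?mdist_ge0// => t; exact: stick_of01.
Qed.

Lemma trunc_cost_ge0 M z : 0 <= trunc_cost M z.
Proof. by apply: nneseries_ge0 => i _ _; exact: c0. Qed.

Lemma measurable_trunc_cost M : measurable_fun setT (trunc_cost M).
Proof.
apply: ge0_emeasurable_sum => [i z _ _|i _]; first exact: c0.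
apply: emeasurable_funM; apply/measurable_EFinP.
  by apply: measurable_weight; exact: measurable_stick_of.
apply: measurable_fun_mdist => //; apply: (measurableT_comp measurable_fst);
exact: measurable_coord.
Qed.

Lemma trunc_cost0 z : trunc_cost 0 z = (1 - stick_of (z 0%N))%:E *
  stick_sum (@stick_of R X) (fun t => (mdist (t.1 : X) ((z 0%N).1 : X))%:E) (shift z).
Proof.
rewrite /trunc_cost nneseries_recl//.
rewrite mdistxx mule0 add0e.
rewrite -nneseries_addn; last by move=> i; exact: c0.
rewrite /stick_sum -nneseriesZl; last first.
  move=> i _; rewrite mule_ge0// lee_fin ?mdist_ge0// weight_ge0// => t.
  exact: stick_of01.
apply: eq_eseriesr => i _; rewrite addn1 weightS EFinM muleA minn0.
by [].
Qed.

Lemma trunc_costS M z :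
  trunc_cost M.+1 z = (1 - stick_of (z 0%N))%:E * trunc_cost M (shift z).
Proof.
rewrite /trunc_cost nneseries_recl//.
rewrite mdistxx mule0 add0e.
rewrite -nneseries_addn; last by move=> i; exact: c0.
rewrite -nneseriesZl; last by move=> i _; exact: c0.
apply: eq_eseriesr => i _; rewrite addn1 weightS EFinM muleA minnSS.
by [].
Qed.

Lemma measurable_onem_stick : measurable_fun setT (fun t : T => (1 - stick_of t)%:E).
Proof.
by apply/measurable_EFinP; apply: measurable_funB => //; exact: measurable_stick_of.
Qed.

Lemma onem_stick_ge0 (t : T) : 0 <= (1 - stick_of t)%:E.
Proof. by rewrite lee_fin subr_ge0; case/andP: (stick_of01 t). Qed.

Let m1 : measurable_fun setT (fun v : R => (1 - clip v)%:E).
Proof. by apply/measurable_EFinP; apply: measurable_funB => //; exact: measurable_clip. Qed.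

Let m10 (v : R) : 0 <= (1 - clip v)%:E.
Proof. by rewrite lee_fin subr_ge0; case/andP: (clip01 v). Qed.

(** Each of the first [M] sticks contributes an independent factor [1 - V], of mean
    [alpha / (alpha + 1)]. What remains is a stick-breaking measure transported to
    its own first atom: this atom does not move, which gives one more factor, and
    the following ones are independent of it. *)
Lemma integral_trunc_cost M : \int[mu]_z trunc_cost M z =
  ((alpha / (alpha + 1)) ^+ M.+1)%:E *
  \int[P0]_x \int[P0]_y (mdist (y : X) (x : X))%:E.
Proof.
have [K K0 hK] := diameter_ge0.
have md : measurable_fun setT (fun z : borel X * borel X => (mdist (z.2 : X) (z.1 : X))%:E).
  by apply/measurable_EFinP; exact: measurable_fun_mdist.
have d0 (x y : X) : 0 <= (mdist x y)%:E by rewrite lee_fin mdist_ge0.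
elim: M => [|M IH].
  pose h (x : T * seqspace T) := (1 - stick_of x.1)%:E *
    stick_sum (@stick_of R X) (fun t => (mdist (t.1 : X) (x.1.1 : X))%:E) x.2.
  have mh : measurable_fun setT h.
    apply: emeasurable_funM; first exact: (measurableT_comp measurable_onem_stick).
    apply: ge0_emeasurable_sum => [i x _ _|i _].
      by rewrite mule_ge0// lee_fin weight_ge0// => t; exact: stick_of01.
    apply: emeasurable_funM; apply/measurable_EFinP.
      by apply: (measurableT_comp (measurable_weight (@measurable_stick_of R X) i)).
    apply: measurable_fun_mdist => //; apply: (measurableT_comp measurable_fst) => //.
    by apply: (measurableT_comp (@measurable_coord _ T i)).
  have h0 x : 0 <= h x.
    rewrite mule_ge0 ?onem_stick_ge0//; apply: stick_sum_ge0 => // t.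
    exact: stick_of01.
  transitivity (\int[mu]_z h (z 0%N, shift z)).
    by apply: eq_integral => z _; rewrite trunc_cost0.
  rewrite (iid_law_integral_uncons mu_iid)//.
  transitivity (\int[P0 \x b]_t
      ((\int[P0]_y (mdist (y : X) (t.1 : X))%:E) * (1 - clip t.2)%:E)).
    apply: eq_integral => t _; rewrite /h/= ge0_integralZl//; last 3 first.
    - apply: measurable_stick_sum => //.
      + exact: measurable_stick_of.
      + by move=> t'; exact: stick_of01.
      + by apply: (measurableT_comp md (measurable_fun_pair _ _)).
    - by move=> z _; apply: stick_sum_ge0 => // t'; exact: stick_of01.
    - exact: onem_stick_ge0.
    rewrite muleC; congr (_ * _).
    rewrite (@integral_stick_sum_atoms K (fun y => (mdist (y : X) (t.1 : X))%:E))//.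
      by move=> y; rewrite d0 lee_fin hK.
    by apply: (measurableT_comp md (measurable_fun_pair _ _)).
  rewrite (@integral_prodM _ _ _ _ _ P0 b (fun x => \int[P0]_y (mdist (y : X) (x : X))%:E)
    (fun v => (1 - clip v)%:E))//.
  - by rewrite (beta_mean_onem alpha_gt0 bE) muleC expr1.
  - by apply: (@measurable_fun_fubini_tonelli_F _ _ _ _ R P0 _ md).
  - by move=> x; apply: integral_ge0.
pose h (x : T * seqspace T) := (1 - stick_of x.1)%:E * trunc_cost M x.2.
transitivity (\int[mu]_z h (z 0%N, shift z)).
  by apply: eq_integral => z _; rewrite trunc_costS.
rewrite (iid_law_integral_uncons mu_iid); last 2 first.
- by move=> x; rewrite mule_ge0 ?onem_stick_ge0 ?trunc_cost_ge0.
- apply: emeasurable_funM; first exact: (measurableT_comp measurable_onem_stick).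
  exact: (measurableT_comp (measurable_trunc_cost M)).
rewrite /h/=.
under eq_integral.
  move=> t _; rewrite ge0_integralZl//; last 3 first.
  - exact: measurable_trunc_cost.
  - by move=> z _; exact: trunc_cost_ge0.
  - exact: onem_stick_ge0.
  over.
rewrite ge0_integralZr//; last 3 first.
- exact: measurable_onem_stick.
- by move=> t _; exact: onem_stick_ge0.
- by apply: integral_ge0 => z _; exact: trunc_cost_ge0.
have -> : \int[P0 \x b]_t (1 - stick_of t)%:E = (alpha / (alpha + 1))%:E.
  rewrite -(beta_mean_onem alpha_gt0 bE) -[RHS]mul1e -{1}(probability_integral_cst P0 1).
  rewrite -(@integral_prodM _ _ _ _ _ P0 b (fun=> 1) (fun v => (1 - clip v)%:E))//.
  by apply: eq_integral => t _; rewrite mul1e.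
by rewrite IH muleA -EFinM -exprS.
Qed.

End mean.
End truncated.

Section truncated_law.
Context (R : realType) (X : completeMetricType R).
Hypothesis X_separable : separable_space X.
Hypothesis X_bounded : finite_diameter X.
Variable alpha : R.
Hypothesis alpha_gt0 : (0 < alpha)%R.

Local Notation T := (borel X * R)%type.

(** Truncation keeps the sticks and merges the atoms from the [M]-th on, so that
    the truncated process is a stick-breaking measure with the same weights. *)
Definition trunc_seq (M : nat) (z : seqspace T) : seqspace T :=
  fun i => ((z (minn i M)).1, (z i).2).

Lemma measurable_trunc_seq M : measurable_fun setT (trunc_seq M).
Proof.
apply: measurable_seqspaceP => i; apply: measurable_fun_pair.
  by apply: (measurableT_comp measurable_fst); exact: measurable_coord.
by apply: (measurableT_comp measurable_snd); exact: measurable_coord.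
Qed.

Lemma Wasserstein_trunc_seq M z : mass (@stick_of R X) z = 1 ->
  Wasserstein (stick_prob (@stick_of R X) fst z)
              (stick_prob (@stick_of R X) fst (trunc_seq M z)) <= trunc_cost M z.
Proof.
move=> z1; pose zz i := (z i, trunc_seq M z i).
apply: (@Wasserstein_stick_prob R X X_separable _ (T * T)%type
  (fun t => stick_of t.1) (fun t => t.1.1) (fun t => t.2.1) zz) => // t.
exact: stick_of01.
Qed.

Lemma stick_prob_trunc_seq M z A : mass (@stick_of R X) z = 1 ->
  stick_prob (@stick_of R X) fst (trunc_seq M z) A =
  \sum_(i < M) (weight (@stick_of R X) i z)%:E * \d_((z i).1) A +
  (1 - \sum_(i < M) weight (@stick_of R X) i z)%:E * \d_((z M).1) A.
Proof.
move=> z1; rewrite stick_probE//; last exact: stick_of01.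
have w0 i : 0 <= (weight (@stick_of R X) i z)%:E.
  by rewrite lee_fin weight_ge0// => t; exact: stick_of01.
have d0 (x : borel X) : 0 <= (\d_x A : \bar R) by rewrite measure_ge0.
have wt i : weight (@stick_of R X) i (trunc_seq M z) = weight (@stick_of R X) i z by [].
have c0 i : 0 <= (weight (@stick_of R X) i (trunc_seq M z))%:E *
    (\d_((trunc_seq M z i).1) A : \bar R).
  by rewrite mule_ge0 ?wt.
rewrite /stick_sum (nneseries_split 0 M)//.
rewrite add0n big_mkord; congr (_ + _).
  apply: eq_bigr => i _; congr (_ * _); rewrite /trunc_seq/=.
  by rewrite (minn_idPl (ltnW (ltn_ord i))).
rewrite -nneseries_addn//.
transitivity (\sum_(0 <= i <oo) ((\1_A (z M).1)%:E * (weight (@stick_of R X) (i + M) z)%:E)).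
  apply: eq_eseriesr => i _; rewrite muleC wt diracE indicE /trunc_seq/=.
  by rewrite (minn_idPr (leq_addl _ _)).
rewrite nneseriesZl// muleC diracE indicE; congr (_ * _).
have z1' : \sum_(0 <= i <oo) (weight (@stick_of R X) i z)%:E = 1.
  by rewrite -z1; apply: eq_eseriesr => i _; rewrite mule1.
rewrite (nneseries_split 0 M)// add0n big_mkord -nneseries_addn// sumEFin in z1'.
move: z1'.
have : 0 <= \sum_(0 <= i <oo) (weight (@stick_of R X) (i + M) z)%:E.
  by apply: nneseries_ge0.
case: (\sum_(0 <= i <oo) _) => // r _.
by rewrite -EFinD => -[<-]; rewrite addrC addKr.
Qed.

Lemma truncated_stick_breaking_law (P0 : probability (borel X) R) (N : nat) Q
    (b : probability R R) (mu : probability (seqspace T) R) :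
  truncated_stick_breaking alpha P0 N Q ->
  (forall A, measurable A -> b A = beta_law 1 alpha A) ->
  iid_law mu (P0 \x b) ->
  forall B, measurable B -> Q B =
    mu [set z | B (stick_prob (@stick_of R X) fst (trunc_seq N.-1 z))].
Proof.
move=> [d [W [Pr [X_ [V_ [S [sbv SE SQ]]]]]]] bE mu_iid B mB.
have ml := stick_breaking_iid_law sbv bE.
pose zw (w : W) : seqspace T := fun k => atom_stick X_ V_ k w.
have mz : measurable_fun setT zw := measurable_sequence (measurable_atom_stick X_ V_).
have msp := measurable_stick_prob_Pspace X_separable (@stick_of01 R X)
  (@measurable_stick_of R X) (@measurable_fst _ _ (borel X) R).
have mst : measurable_fun setT
    (fun z : seqspace T => stick_prob (@stick_of R X) fst (trunc_seq N.-1 z) : Pspace R X).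
  exact: (measurableT_comp msp (measurable_trunc_seq N.-1)).
have mE : measurable [set z : seqspace T | B (stick_prob (@stick_of R X) fst (trunc_seq N.-1 z))].
  by rewrite -[X in measurable X]setTI; exact: mst.
rewrite (iid_law_unique mu_iid ml mE) -SQ//.
have mass1 : {ae Pr, forall w, mass (@stick_of R X) (zw w) = 1}.
  have [N0 [mN0 N00 sN0]] := mass_ae alpha_gt0 bE ml.
  exists (zw @^-1` N0); split.
  - by rewrite -[X in measurable X]setTI; exact: mz.
  - exact: N00.
  - by move=> w /= h; apply: sN0.
apply: (@ae_eq_measure _ _ _ Pr (S @^-1` B)
  [set w | B (stick_prob (@stick_of R X) fst (trunc_seq N.-1 (zw w)))]).
- by rewrite -[X in measurable X]setTI; exact: measurable_funP.
- by rewrite -[X in measurable X]setTI; exact: (measurableT_comp mst mz).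
have h1 := stick_breaking_ae sbv.
apply: filterS3 h1 SE mass1 => w h1 h2 h3.
have SP A : measurable A -> as_probability (S w) A =
    as_probability (stick_prob (@stick_of R X) fst (trunc_seq N.-1 (zw w)) : Pspace R X) A.
  move=> mA; rewrite h2// [RHS]stick_prob_trunc_seq//.
  congr (_ + _ %:E * _); first by apply: eq_bigr => i _; rewrite h1.
  by congr (_ - _)%R; apply: eq_bigr => i _; rewrite h1.
split; first exact: (Pspace_indistinguishable mB SP).
apply: (Pspace_indistinguishable mB) => A mA.
exact: esym (SP A mA).
Qed.

Theorem WoW_truncated (P0 : probability (borel X) R) (N : nat)
    (Q Q' : probability (Pspace R X) R) : (0 < N)%N ->
  dirichlet_process alpha P0 Q -> truncated_stick_breaking alpha P0 N Q' ->
  WoW Q Q' <= ((alpha / (alpha + 1)) ^+ N)%:E *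
    \int[P0]_x \int[P0]_y (mdist (y : X) (x : X))%:E.
Proof.
move=> N0 /(dirichlet_process_data X_separable)[b [mu [bE mu_iid QE]]] Q'E.
rewrite -[X in (_ ^+ X)%R](prednK N0).
rewrite -(integral_trunc_cost X_separable X_bounded alpha_gt0 bE mu_iid).
have msp := measurable_stick_prob_Pspace X_separable (@stick_of01 R X)
  (@measurable_stick_of R X) (@measurable_fst _ _ (borel X) R).
apply: (@WoW_le R X _ (seqspace T) mu
  (fun z => stick_prob (@stick_of R X) fst z : Pspace R X)
  (fun z => stick_prob (@stick_of R X) fst (trunc_seq N.-1 z) : Pspace R X) Q Q'
  _ _ _ _ (trunc_cost N.-1)).
- exact: msp.
- exact: (measurableT_comp msp (measurable_trunc_seq N.-1)).
- exact: QE.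
- exact: (truncated_stick_breaking_law Q'E bE mu_iid).
- by move=> z; exact: trunc_cost_ge0.
- exact: measurable_trunc_cost.
- have [N1 [mN1 N10 sN1]] := mass_ae alpha_gt0 bE mu_iid.
  exists N1; split => // z h; apply: sN1 => z1; apply: h.
  exact: Wasserstein_trunc_seq.
Qed.

End truncated_law.

(** * Hierarchical empirical measures *)

Lemma emeasurable_prod d (T : measurableType d) (R : realType) (I : Type)
    (s : seq I) (f : I -> T -> \bar R) :
  (forall i, measurable_fun setT (f i)) ->
  measurable_fun setT (fun x => \prod_(i <- s) f i x).
Proof.
move=> mf; elim: s => [|i s IH].
  by under eq_fun do rewrite big_nil; exact: measurable_cst.
by under eq_fun do rewrite big_cons; exact: emeasurable_funM.
Qed.

Section hierarchical.
Context (R : realType) (X : completeMetricType R).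
Hypothesis X_separable : separable_space X.

Local Notation T := (borel X * R)%type.

Lemma dirichlet_process_unique (alpha : R) (P0 : probability (borel X) R) Q Q' :
  (0 < alpha)%R -> dirichlet_process alpha P0 Q -> dirichlet_process alpha P0 Q' ->
  forall B, measurable B -> Q B = Q' B.
Proof.
move=> alpha_gt0 /(dirichlet_process_data X_separable)[b [mu [bE mu_iid QE]]] Q'E B mB.
rewrite QE//; apply: esym.
apply: (@dirichlet_process_law R X X_separable alpha P0 Q' _ T fst snd mu _ b Q'E) => //.
  exact: mu_iid.
by move=> A C mA mC; apply: (product_measure1E P0 b mA mC).
Qed.

Lemma measurable_empirical (N : nat) : (0 < N)%N ->
  measurable_fun setT (fun t : N.-tuple (borel X) => empirical R t : Pspace R X).
Proof.
move=> N0; apply: measurable_Pspace => // A mA.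
rewrite (_ : (fun t => _) = (fun t : N.-tuple (borel X) =>
    (N%:R^-1)%:E * \sum_(i < N) (\1_A (tnth t i))%:E)); last first.
  by apply/funext => t; rewrite /as_probability empiricalE.
apply: emeasurable_funM; first exact: measurable_cst.
apply: emeasurable_sum => i; apply/measurable_EFinP.
by apply: (measurableT_comp (@measurable_indic _ _ R setT A mA)); exact: measurable_tnth.
Qed.

Section tuple_of_rvs.
Context d (Omega : measurableType d) (Pr : probability Omega R) (N : nat).
Context d' (E : measurableType d').
Variable Y_ : 'I_N -> {RV Pr >-> E}.

Definition rv_tuple (w : Omega) : N.-tuple E := [tuple Y_ i w | i < N].

Lemma measurable_rv_tuple : measurable_fun setT rv_tuple.
Proof.
apply/measurable_fun_tnthP => i.
rewrite (_ : _ \o _ = Y_ i); first exact: measurable_funP.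
by apply/funext => w; rewrite /= tnth_mktuple.
Qed.

Lemma rv_tuple_rectangle B : rv_tuple @^-1` (rectangle B) = \bigcap_i (Y_ i @^-1` B i).
Proof.
apply/seteqP; split => w /=; first by move=> h i _; have := h i; rewrite tnth_mktuple.
by move=> h i; rewrite tnth_mktuple; exact: h.
Qed.

End tuple_of_rvs.

Lemma measurable_prod_evaluation (N : nat) (B : 'I_N -> set (borel X)) :
  (forall i, measurable (B i)) ->
  measurable_fun setT (fun p : Pspace R X => \prod_(i < N) as_probability p (B i)).
Proof.
by move=> mB; apply: emeasurable_prod => i; exact: measurable_evaluation.
Qed.

(** On rectangles, the law of a sample is the mean of a product of evaluations of
    the random probability. *)
Lemma conditionally_iid_law d (Omega : measurableType d) (Pr : probability Omega R)
    d' (Omega' : measurableType d') (Pr' : probability Omega' R) (N : nat)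
    (Pt : {RV Pr >-> Pspace R X}) (Y_ : 'I_N -> {RV Pr >-> borel X})
    (Pt' : {RV Pr' >-> Pspace R X}) (Y'_ : 'I_N -> {RV Pr' >-> borel X}) :
  conditionally_iid Pt Y_ -> conditionally_iid Pt' Y'_ ->
  (forall B, measurable B -> distribution Pr Pt B = distribution Pr' Pt' B) ->
  forall C, measurable C -> Pr (rv_tuple Y_ @^-1` C) = Pr' (rv_tuple Y'_ @^-1` C).
Proof.
move=> hY hY' PtPt' C mC.
pose m1 : probability (N.-tuple (borel X)) R :=
  distribution Pr (to_mfun (measurable_rv_tuple Y_)).
pose m2 : probability (N.-tuple (borel X)) R :=
  distribution Pr' (to_mfun (measurable_rv_tuple Y'_)).
apply: (@tuple_measure_unique _ (borel X) N R m1 m2) => // B mB.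
rewrite -[LHS]/(Pr (rv_tuple Y_ @^-1` (rectangle B))) rv_tuple_rectangle.
rewrite -[RHS]/(Pr' (rv_tuple Y'_ @^-1` (rectangle B))) rv_tuple_rectangle.
have h1 := hY _ _ (@measurableT _ (Pspace R X)) mB.
have h2 := hY' _ _ (@measurableT _ (Pspace R X)) mB.
rewrite !preimage_setT !setTI in h1 h2.
rewrite h1 h2.
have mp := measurable_prod_evaluation mB.
have p0 (p : Pspace R X) : 0 <= \prod_(i < N) as_probability p (B i) by rewrite prode_ge0.
rewrite -(@ge0_integral_distribution _ _ _ _ _ Pr Pt _ mp p0).
rewrite -(@ge0_integral_distribution _ _ _ _ _ Pr' Pt' _ mp p0).
by apply: eq_measure_integral => A mA _; exact: PtPt'.
Qed.

(** The random probability [Pt] and the empirical measure of its sample [Y_] live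
    on the same space, and the second one has the law [Q]. *)
Theorem WoW_hierarchical (alpha : R) (P0 : probability (borel X) R) (N : nat)
    d (Omega : measurableType d) (Pr : probability Omega R)
    (Pt : {RV Pr >-> Pspace R X}) (Y_ : 'I_N -> {RV Pr >-> borel X})
    (Q : probability (Pspace R X) R) :
  (0 < alpha)%R -> (0 < N)%N ->
  dirichlet_process alpha P0 (distribution Pr Pt) -> conditionally_iid Pt Y_ ->
  hierarchical_empirical alpha P0 N Q ->
  WoW (distribution Pr Pt) Q <=
    \int[Pr]_w Wasserstein (as_probability (Pt w)) (empirical R [tuple Y_ i w | i < N]).
Proof.
move=> alpha_gt0 N0 hPt hY [d' [W [Pr' [Pt' [Y'_ [S [hPt' hY' SE SQ]]]]]]].
have me := measurableT_comp (measurable_empirical N0) (measurable_rv_tuple Y_).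
apply: (@WoW_le_integral R X _ Omega Pr Pt
  (fun w => empirical R (rv_tuple Y_ w) : Pspace R X)) => //.
- move=> B mB; rewrite -SQ//.
  rewrite -[RHS]/(Pr (rv_tuple Y_ @^-1` ((fun t => empirical R t : Pspace R X) @^-1` B))).
  rewrite (conditionally_iid_law hY hY'); last 2 first.
  + exact: (dirichlet_process_unique alpha_gt0 hPt hPt').
  + by rewrite -[X in measurable X]setTI; exact: measurable_empirical.
  congr (Pr' _); apply/seteqP; split => w /=.
    by apply: (Pspace_indistinguishable mB) => A mA; exact: SE.
  by apply: (Pspace_indistinguishable mB) => A mA; exact: esym (SE w A mA).
Qed.

End hierarchical.


(** * Randomised choice of an index *)

Section choice_index.
Context (R : realType) (n : nat) (c : nat -> R) (u : R).

Let choice_index_subproof : exists k, (n <= k)%N || (u <= c k)%R.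
Proof. by exists n; rewrite leqnn. Qed.

(** The generalised inverse of a nondecreasing [c] at [u], cut at [n]. *)
Definition choice_index : nat := ex_minn choice_index_subproof.

Lemma choice_index_le k : {homo c : i j / (i <= j)%N >-> (i <= j)%R} ->
  (choice_index <= k)%N = ((n <= k)%N || (u <= c k)%R).
Proof.
move=> c_nd; rewrite /choice_index; case: ex_minnP => m Pm m_min.
apply/idP/idP => [mk|]; last exact: m_min.
case/orP: Pm => [nm|um]; first by rewrite (leq_trans nm mk).
by rewrite (le_trans um (c_nd _ _ mk)) orbT.
Qed.

End choice_index.

Section randomized_choice.
Context d (T : measurableType d) (R : realType) (P0 : probability T R)
  (b : probability R R) (U : R -> R) (n : nat) (q : 'I_n.+1 -> T -> R).
Hypothesis mU : measurable_fun setT U.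
Hypothesis U_uniform : forall s : R, (0 <= s <= 1)%R ->
  b [set v | U v <= s]%R = s%:E.
Hypothesis mq : forall i, measurable_fun setT (q i).
Hypothesis q_ge0 : forall i y, (0 <= q i y)%R.
Hypothesis sum_q : forall y, (\sum_i q i y = 1)%R.

Let cum (y : T) (k : nat) : R := \sum_(j < n.+1 | (j <= k)%N) q j y.

Let cum_nd y : {homo cum y : i j / (i <= j)%N >-> (i <= j)%R}.
Proof.
move=> i j ij; rewrite /cum [leRHS](bigID (fun k : 'I_n.+1 => (k <= i)%N))/=.
rewrite (eq_bigl (fun k : 'I_n.+1 => (k <= j)%N && (k <= i)%N)); last first.
  by move=> k; case: (leqP k i) => ki; rewrite ?andbF// (leq_trans ki ij).
by rewrite lerDl sumr_ge0.
Qed.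

Let cum01 y k : (0 <= cum y k <= 1)%R.
Proof.
rewrite /cum sumr_ge0//= -(sum_q y) [leRHS](bigID (fun j : 'I_n.+1 => (j <= k)%N))/=.
by rewrite lerDl sumr_ge0.
Qed.

Let cum_max y k : (n <= k)%N -> cum y k = 1%R.
Proof.
move=> nk; rewrite /cum -(sum_q y); apply: eq_bigl => j.
by rewrite (leq_trans _ nk)// -ltnS.
Qed.

Let index (t : T * R) : nat := choice_index n (cum t.1) (U t.2).

Let index_lt t : (index t < n.+1)%N.
Proof. by rewrite ltnS /index (choice_index_le n _ _ (cum_nd _)) leqnn. Qed.

(** Inverse transform sampling: [U t.2] is a uniform variable, compared with the
    cumulative sums of the probabilities [q i t.1]. *)
Definition random_index (t : T * R) : 'I_n.+1 := Ordinal (index_lt t).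

Let level (k : nat) := [set t | (index t <= k)%N].

Let measurable_level k : measurable (level k).
Proof.
have -> : level k = [set t | (n <= k)%N || (U t.2 <= cum t.1 k)%R].
  by apply/funext => t /=; rewrite /level/= /index choice_index_le//; exact: cum_nd.
case: (n <= k)%N => /=.
  by rewrite (_ : mkset _ = setT)//; apply/seteqP; split.
rewrite -[X in measurable X]setTI; apply: measurable_fun_le => //.
  exact: measurableT_comp.
rewrite (_ : (fun t => _) = (fun t : T * R =>
    \sum_(j < n.+1) (if (j <= k)%N then q j t.1 else 0))%R); last first.
  by apply/funext => t; rewrite /cum big_mkcond.
apply: measurable_sum => j; case: (j <= k)%N; last exact: measurable_cst.
exact: measurableT_comp (mq j) measurable_fst.
Qed.

Let random_index_eq (i : 'I_n.+1) : random_index @^-1` [set i] =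
  level i `\` (if i is @Ordinal _ k.+1 _ then level k else set0).
Proof.
apply/seteqP; split => t /=.
  move=> <-; rewrite /random_index/level/=; split=> //.
  by case E : (index t) => [|k]//=; rewrite E ltnn.
case: i => -[|k] ik [/=] ti tk; apply/val_inj => /=.
  by apply/eqP; rewrite -leqn0.
apply/eqP; rewrite eqn_leq; apply/andP; split; first exact: ti.
by rewrite ltnNge; apply/negP.
Qed.

Lemma measurable_random_index i : measurable (random_index @^-1` [set i]).
Proof.
rewrite random_index_eq; apply: measurableD => //.
by case: i => -[|k] ik //; exact: measurable_level.
Qed.

Let b_level y k : b [set v | (index (y, v) <= k)%N] = (cum y k)%:E.
Proof.
rewrite (_ : mkset _ = [set v | (n <= k)%N || (U v <= cum y k)%R]); last first.
  by apply/funext => v /=; rewrite /index choice_index_le//; exact: cum_nd.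
case: (boolP (n <= k)%N) => /= nk; last exact: U_uniform.
rewrite cum_max// (_ : mkset _ = setT); first exact: probability_setT.
by apply/seteqP; split.
Qed.

Let measurable_section y k : measurable [set v | (index (y, v) <= k)%N].
Proof.
have := measurable_xsection y (measurable_level k).
by congr measurable; apply/funext => v; rewrite /xsection/= inE.
Qed.

Lemma random_index_section i y : b [set v | random_index (y, v) = i] = (q i y)%:E.
Proof.
rewrite (_ : mkset _ = [set v | (index (y, v) <= i)%N] `\`
    (if i is @Ordinal _ k.+1 _ then [set v | (index (y, v) <= k)%N] else set0)); last first.
  transitivity ((fun v => (y, v)) @^-1` (random_index @^-1` [set i])) => //.
  by rewrite random_index_eq; case: i => -[].
case: i => -[|k] ik.
  rewrite setD0; apply: (etrans (b_level _ _)); congr EFin.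
  rewrite /cum/= (bigD1 (Ordinal ik))//=.
  rewrite big1 ?addr0// => j /andP[]; rewrite leqn0 => /eqP j0 /eqP[].
  exact: val_inj.
rewrite measureD//; last by rewrite (le_lt_trans (probability_le1 _ _))// ltry.
rewrite setIidr; last by move=> v /= /leq_trans; apply; exact: leqnSn.
rewrite [X in X - _](b_level _ _) [X in _ - X](b_level _ _) -EFinB; congr EFin.
rewrite /cum/= (bigD1 (Ordinal ik))//= addrC; apply/eqP; rewrite subr_eq addrC; apply/eqP.
congr (_ + _)%R; apply: eq_bigl => j.
rewrite -(inj_eq val_inj)/= leq_eqVlt ltnS.
by case: eqP => [->|_]/=; [rewrite ltnn|rewrite andbT].
Qed.

(** Integrating out the second coordinate, which is used to draw the index [i]
    with probability [q i y]. *)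
Lemma integral_random_index (h : 'I_n.+1 -> T -> \bar R) :
  (forall i, measurable_fun setT (h i)) -> (forall i y, 0 <= h i y) ->
  \int[P0 \x b]_t h (random_index t) t.1 = \sum_i \int[P0]_y (h i y * (q i y)%:E).
Proof.
move=> mh h0.
pose g i (t : T * R) : \bar R := h i t.1 * (\1_(random_index @^-1` [set i]) t)%:E.
have mg i : measurable_fun setT (g i).
  apply: emeasurable_funM; first exact: measurableT_comp (mh i) measurable_fst.
  by apply/measurable_EFinP/measurable_indic; exact: measurable_random_index.
have g0 i t : 0 <= g i t by rewrite mule_ge0// lee_fin.
rewrite (_ : (fun t => h _ _) = (fun t => \sum_i g i t)); last first.
  apply/funext => t; rewrite (bigD1 (random_index t))//= big1.
    by rewrite /g indicE mem_set//= mule1 adde0.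
  by move=> i ti; rewrite /g indicE memNset ?mule0//= => ti'; rewrite ti' eqxx in ti.
rewrite ge0_integral_sum//; apply: eq_bigr => i _.
rewrite fubini_tonelli1//=; apply: eq_integral => y _.
pose D := [set v | random_index (y, v) = i].
have mD : measurable D.
  have := measurable_xsection y (measurable_random_index i).
  by congr measurable; apply/funext => v; rewrite /xsection/= inE.
transitivity (\int[b]_v (h i y * (\1_D v)%:E)).
  apply: eq_integral => v _; rewrite /g/= !indicE; congr (_ * (_%:R)%:E).
rewrite ge0_integralZl//; last exact/measurable_EFinP/measurable_indic.
by rewrite integral_indic// setIT; congr (_ * _); exact: random_index_section.
Qed.

End randomized_choice.


(** * Densities attached to a coupling with an empirical measure *)

Lemma epatch_indic (T : Type) (R : realType) (f : T -> \bar R) D :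
  f \_ D = fun x => f x * (\1_D x)%:E.
Proof.
by apply/funext => x; rewrite patchE indicE; case: ifP; rewrite ?mule1 ?mule0.
Qed.

(** [r] is the density, given by the theorem of Radon and Nikodym, of the measure
    [A |-> g (fst @^-1` A `&` D)] with respect to the first marginal of [g]; it is
    the conditional probability of [D] given the first coordinate. *)
Lemma conditional_density d d' (T : measurableType d) (E : measurableType d')
    (R : realType) (P0 : probability T R) (g : probability (T * E)%type R) D :
  (forall A, measurable A -> g (fst @^-1` A) = P0 A) -> measurable D ->
  exists r : T -> R, [/\ measurable_fun setT r, forall y, (0 <= r y)%R &
    forall h : T -> \bar R, measurable_fun setT h -> (forall y, 0 <= h y) ->
      \int[P0]_y (h y * (r y)%:E) = \int[g]_(z in D) h z.1].
Proof.
move=> gP0 mD.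
have mhD (h : T -> \bar R) : measurable_fun setT h -> measurable_fun setT (fun z : T * E => h z.1).
  by move=> mh; exact: measurableT_comp mh measurable_fst.
have gDle : g D < +oo by rewrite (le_lt_trans (probability_le1 _ _))// ltry.
have gDfin : g D \is a fin_num by rewrite ge0_fin_numE.
have [gD0|gD0] := eqVneq (g D) 0.
  exists (fun=> 0%R); split => // h mh h0.
  under eq_integral do rewrite mule0.
  rewrite integral0; apply: esym; apply: null_set_integral => //.
  exact: measurable_funTS (mhD _ mh).
pose m : {measure set (T * E)%type -> \bar R} := mrestr g mD.
have mT : m setT = g D by rewrite -[LHS]/(g (setT `&` D)) setTI.
pose p := fine (g D).
have p0 : (0 < p)%R by rewrite fine_gt0// gDle andbT lt0e gD0 measure_ge0.
have pV0 : (0 <= p^-1)%R by rewrite invr_ge0 ltW.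
have normE A : mnormalize m g A = mscale (NngNum pV0) m A.
  by rewrite -[LHS]/(mnormalize m g A) /mnormalize mT (negbTE gD0)/= (lt_eqF gDle)/= muleC.
pose nu : probability T R := distribution (mnormalize m g) (to_mfun measurable_fst).
have nuE A : nu A = (p^-1)%:E * g (fst @^-1` A `&` D) by exact: normE.
have nuP0 : nu `<< P0.
  apply/null_content_dominatesP => A mA A0; rewrite nuE.
  suff -> : g (fst @^-1` A `&` D) = 0 by rewrite mule0.
  apply/eqP; rewrite -measure_le0.
  have mfA : measurable (fst @^-1` A : set (T * E)).
    by rewrite -[X in measurable X]setTI; exact: measurable_fst.
  have <- : g (fst @^-1` A) = 0 by exact: etrans (gP0 _ mA) A0.
  by rewrite le_measure// ?inE//; exact: measurableI.
pose f := Radon_Nikodym_SigmaFinite.f nu P0.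
have f0 y : 0 <= f y by exact: Radon_Nikodym_SigmaFinite.f_ge0.
have ffin y : f y \is a fin_num by exact: Radon_Nikodym_SigmaFinite.f_fin_num.
have mf : measurable_fun setT f := measurable_int _ (Radon_Nikodym_SigmaFinite.f_integrable nuP0).
exists (fun y => p * fine (f y))%R; split.
- by apply: measurable_funM => //; exact: measurableT_comp.
- by move=> y; rewrite mulr_ge0 ?(ltW p0)// fine_ge0.
move=> h mh h0.
under eq_integral => y _ do rewrite EFinM (fineK (ffin y)) muleCA.
rewrite ge0_integralZl//; last 3 first.
- exact: emeasurable_funM.
- by move=> y _; rewrite mule_ge0// f0.
- by rewrite lee_fin ltW.
have -> : \int[P0]_y (h y * f y) = \int[nu]_y h y.
  exact: Radon_Nikodym_SigmaFinite.change_of_variables.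
rewrite /nu ge0_integral_distribution//.
rewrite (@eq_measure_integral _ _ _ setT (mscale (NngNum pV0) m)); last by move=> A *; exact: normE.
rewrite ge0_integral_mscale//=; [|exact: mhD].
rewrite muleA -EFinM divff ?gt_eqF// mul1e.
rewrite (ge0_ae_eq_integral (g := (fun z => h z.1) \_ D))//; last first.
- exists (~` D); split; first exact: measurableC.
    by rewrite -[LHS]/(g (~` D `&` D)) setICl measure0.
  by move=> z /= hz Dz; apply: hz => _; rewrite patchE mem_set.
- by move=> z _; rewrite patchE; case: ifP.
- by rewrite epatch_indic; apply: emeasurable_funM; [exact: mhD|exact/measurable_EFinP/measurable_indic].
- exact: mhD.
rewrite -integral_mkcond; apply: eq_measure_integral => A mA AD.
by rewrite -[LHS]/(g (A `&` D)) setIidl.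
Qed.

Section coupling_density.
Context d d' (T : measurableType d) (E : measurableType d') (R : realType)
  (P0 : probability T R) (n : nat) (x : n.+1.-tuple E)
  (g : probability (T * E)%type R).
Hypothesis E_set1 : forall a : E, measurable [set a].
Hypothesis gP0x : coupling P0 (empirical R x) g.

Let D i : set (T * E) := snd @^-1` [set tnth x i].

Let mult (a : E) : R := \sum_(j < n.+1) \1_[set tnth x j] a.

Let mD i : measurable (D i).
Proof. by rewrite -[X in measurable X]setTI; exact: measurable_snd. Qed.

Let mult_gt0 i : (0 < mult (tnth x i))%R.
Proof.
rewrite /mult (bigD1 i)//= indicE mem_set//=; apply: ltr_pwDl; first exact: ltr01.
by apply: sumr_ge0 => j _; rewrite indicE.
Qed.

Let gD i : g (D i) = (mult (tnth x i) / n.+1%:R)%:E.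
Proof.
have [_ gx] := gP0x; rewrite gx// empiricalE// sumEFin -EFinM mulrC; congr (_ / _)%:E.
apply: eq_bigr => j _; rewrite !indicE; congr (nat_of_bool _)%:R.
by apply/idP/idP; rewrite !inE => ->.
Qed.

Let e i (z : T * E) : R := (\1_(D i) z / mult (tnth x i))%R.

Let e_ge0 i z : (0 <= e i z)%R.
Proof. by rewrite divr_ge0// ltW. Qed.

Let me i : measurable_fun setT (e i).
Proof. by apply: measurable_funM => //; exact: measurable_indic. Qed.

Let sum_e : {ae g, forall z, (\sum_i e i z = 1)%R}.
Proof.
exists (~` \bigcup_(i in [set: 'I_n.+1]) D i); split.
- by apply: measurableC; exact: countable_bigcup_measurable.
- rewrite (_ : ~` _ = snd @^-1` (~` [set` (x : seq E)])); last first.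
    apply/seteqP; split => z /= hz; apply: contra_not hz.
      by move=> /tnthP[i zi]; exists i.
    by case=> i _ /= ->; exact: mem_tnth.
  have [_ ->] := gP0x.
    rewrite empiricalE// big1 ?mule0// => i _.
    by rewrite diracE memNset//= => /(_ (mem_tnth _ _)).
  apply: measurableC.
  rewrite (_ : [set` _] = \bigcup_(i in [set: 'I_n.+1]) [set tnth x i]).
    by apply: countable_bigcup_measurable.
  apply/seteqP; split => a /=; first by case/tnthP => i ->; exists i.
  by case=> i _ ->; exact: mem_tnth.
- apply: subsetC => z [i _ zi] /=.
  have m0 : (mult z.2 != 0)%R by rewrite zi gt_eqF.
  rewrite (eq_bigr (fun j => \1_[set tnth x j] z.2 / mult z.2))%R => [|j _].
    by rewrite -mulr_suml divff.
  case: (pselect (z.2 = tnth x j)) => zj.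
    by rewrite /e [in RHS]zj; congr (_ / _)%R; rewrite !indicE !mem_set.
  by rewrite /e !indicE !memNset//= !mul0r.
Qed.

(** The conditional probability [q i y] that the second coordinate of [g] is the
    atom of index [i], given that the first coordinate is [y]; an atom that is
    repeated in [x] shares its probability equally between its indices. *)
Lemma coupling_density : exists q : 'I_n.+1 -> T -> R,
  [/\ forall i, measurable_fun setT (q i), forall i y, (0 <= q i y)%R,
      forall y, (\sum_i q i y = 1)%R,
      forall i, \int[P0]_y (q i y)%:E = (n.+1%:R^-1)%:E &
      forall c : T -> E -> \bar R, measurable_fun setT (fun z => c z.1 z.2) ->
        (forall y a, 0 <= c y a) ->
        \sum_i \int[P0]_y (c y (tnth x i) * (q i y)%:E) = \int[g]_z c z.1 z.2].
Proof.
have [gP0 _] := gP0x.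
have /choice[r /all_and3[mr r0 rE]] i := conditional_density gP0 (mD i).
pose q' i y := (r i y / mult (tnth x i))%R.
have q'0 i y : (0 <= q' i y)%R by rewrite divr_ge0// ltW.
have mq' i : measurable_fun setT (q' i) by exact: measurable_funM.
have q'E i (h : T -> \bar R) : measurable_fun setT h -> (forall y, 0 <= h y) ->
    \int[P0]_y (h y * (q' i y)%:E) = \int[g]_z (h z.1 * (e i z)%:E).
  move=> mh h0; have mi : (0 <= (mult (tnth x i))^-1)%R by rewrite invr_ge0 ltW.
  under eq_integral do rewrite /q' EFinM muleA.
  rewrite ge0_integralZr//; last 2 first.
  - by apply: emeasurable_funM => //; exact/measurable_EFinP.
  - by move=> y _; rewrite mule_ge0// lee_fin.
  rewrite rE// integral_mkcond -ge0_integralZr//; last 2 first.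
  - rewrite epatch_indic; apply: emeasurable_funM.
      exact: measurableT_comp mh measurable_fst.
    by apply/measurable_EFinP; exact: measurable_indic.
  - by move=> z _; rewrite patchE; case: ifP.
  apply: eq_integral => z _; rewrite patchE /e indicE.
  by case: ifP => _; rewrite ?mul1r// ?mul0r ?mule0 ?mul0e.
have c_q' (c : T -> E -> \bar R) : measurable_fun setT (fun z => c z.1 z.2) ->
    (forall y a, 0 <= c y a) ->
    \sum_i \int[P0]_y (c y (tnth x i) * (q' i y)%:E) = \int[g]_z c z.1 z.2.
  move=> mc c0.
  transitivity (\sum_i \int[g]_z (c z.1 z.2 * (e i z)%:E)).
    apply: eq_bigr => i _; rewrite q'E//; last first.
      exact: (measurableT_comp mc (pair2_measurable (tnth x i))).
    apply: eq_integral => z _; rewrite /e indicE.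
    case: (boolP (z \in D i)) => [|_]; first by rewrite inE => <-.
    by rewrite mul0r !mule0.
  rewrite -ge0_integral_sum//; last 2 first.
  - by move=> i; apply: emeasurable_funM => //; exact/measurable_EFinP.
  - by move=> i z _; rewrite mule_ge0// lee_fin.
  apply: ge0_ae_eq_integral => //.
  - by apply: emeasurable_sum => i; apply: emeasurable_funM => //; exact/measurable_EFinP.
  - by move=> z _; apply: sume_ge0 => i _; rewrite mule_ge0// lee_fin.
  have [M [mM M0 sM]] := sum_e; exists M; split => // z hz; apply: sM => /= ez.
  apply: hz => _; rewrite -ge0_sume_distrr; last by move=> i _; rewrite lee_fin.
  by rewrite sumEFin ez mule1.
have q'1 : {ae P0, forall y, (\sum_i q' i y = 1)%R}.
  have := @integral_ae_eq _ _ _ P0 setT measurableT (fun y => (\sum_i q' i y)%:E) (cst 1).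
  case.
  - exact: finite_measure_integrable_cst.
  - by apply/measurable_EFinP; exact: measurable_sum.
  - move=> A _ mA; rewrite integral_cst// mul1e.
    have mA1 : measurable_fun setT (fun z : T * E => (\1_A z.1)%:E : \bar R).
      apply/measurable_EFinP; apply: (measurableT_comp (@measurable_indic _ _ R setT A mA)).
      exact: measurable_fst.
    have := c_q' (fun y _ => (\1_A y)%:E) mA1.
    rewrite -ge0_integral_sum//; last 2 first.
    + by move=> i; apply: emeasurable_funM; apply/measurable_EFinP => //; exact: measurable_indic.
    + by move=> i y _; rewrite mule_ge0// lee_fin.
    move=> cA; apply: (etrans (y := \int[P0]_y \sum_i ((\1_A y)%:E * (q' i y)%:E))).
      rewrite cA => [|y a]; last by rewrite lee_fin.
      rewrite (_ : (fun z : T * E => _) = (fun z => (\1_(fst @^-1` A) z)%:E)).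
        rewrite integral_indic// ?setIT.
          by apply: esym; exact: gP0.
        by rewrite -[X in measurable X]setTI; exact: measurable_fst.
      by apply/funext => z; rewrite !indicE.
    rewrite [RHS]integral_mkcond epatch_indic; apply: eq_integral => y _.
    rewrite -ge0_sume_distrr => [|i _]; last by rewrite lee_fin.
    by rewrite sumEFin muleC.
  move=> M [mM M0 sM]; exists M; split => // y hy; apply: sM => /= hy'.
  by apply: hy; have [] := hy' I.
pose q i y := (if \sum_j q' j y == 1 then q' i y else (i == ord0)%:R)%R.
have qq' i : {ae P0, forall y, q i y = q' i y}.
  have [M [mM M0 sM]] := q'1; exists M; split => // y hy; apply: sM => /= hy'.
  by apply: hy; rewrite /= /q hy' eqxx.
have q0 i y : (0 <= q i y)%R by rewrite /q; case: ifP => //; case: (i == ord0).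
have mq i : measurable_fun setT (q i).
  apply: measurable_fun_ifT => //.
  by apply: measurable_fun_eqr => //; exact: measurable_sum.
have qE i (h : T -> \bar R) : measurable_fun setT h -> (forall y, 0 <= h y) ->
    \int[P0]_y (h y * (q i y)%:E) = \int[P0]_y (h y * (q' i y)%:E).
  move=> mh h0; apply: ge0_ae_eq_integral => //.
  - by apply: emeasurable_funM => //; exact/measurable_EFinP.
  - by apply: emeasurable_funM => //; exact/measurable_EFinP.
  - by move=> y _; rewrite mule_ge0// lee_fin.
  - by move=> y _; rewrite mule_ge0// lee_fin.
  have [M [mM M0 sM]] := qq' i; exists M; split => // y hy; apply: sM => /= qy.
  by apply: hy => _; rewrite qy.
exists q; split => //.
- move=> y; rewrite /q; case: (eqVneq (\sum_j q' j y)%R 1%R) => [//|_].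
  by rewrite (bigD1 ord0)//= big1 ?addr0// => i /negbTE ->.
- move=> i; under eq_integral do rewrite -[(q i _)%:E]mul1e.
  rewrite (qE i (cst 1))// (q'E i (cst 1))//.
  under eq_integral do rewrite mul1e /e EFinM.
  rewrite ge0_integralZr//; last 2 first.
  + by apply/measurable_EFinP; exact: measurable_indic.
  + by rewrite lee_fin invr_ge0 ltW.
  rewrite integral_indic// setIT [X in X * _](_ : _ = (mult (tnth x i) / n.+1%:R)%:E); last exact: gD.
  rewrite -EFinM; congr EFin.
  by rewrite mulrAC divff ?mul1r// gt_eqF.
- move=> c mc c0; rewrite -c_q'//; apply: eq_bigr => i _; apply: qE => //.
  exact: (measurableT_comp mc (pair2_measurable (tnth x i))).
Qed.

End coupling_density.


(** * Measurable selection of nearly optimal couplings *)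

Lemma measurable_fun_choose d1 d2 (T1 : measurableType d1) (T2 : measurableType d2)
    (I : countType) (F : I -> T1 -> T2) (n : T1 -> I) :
  (forall k, measurable_fun setT (F k)) ->
  (forall k, measurable (n @^-1` [set k])) ->
  measurable_fun setT (fun x => F (n x) x).
Proof.
move=> mF mn _ B mB; rewrite setTI.
rewrite (_ : _ @^-1` B = \bigcup_(k in setT) (n @^-1` [set k] `&` F k @^-1` B)).
  apply: countable_bigcup_measurable => k _; apply: measurableI => //.
  by rewrite -[X in measurable X]setTI; exact: mF.
apply/seteqP; split => x /=; first by exists (n x).
by case=> k _ /= [<-].
Qed.

Section selector.
Context (R : realType) (X : completeMetricType R).
Hypothesis X_separable : separable_space X.
Hypothesis X_bounded : finite_diameter X.
Context (P0 : probability (borel X) R) (b : probability R R) (U : R -> R) (n : nat).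
Hypothesis mU : measurable_fun setT U.
Hypothesis U_uniform : forall s : R, (0 <= s <= 1)%R ->
  b [set v | U v <= s]%R = s%:E.

Local Notation T := (borel X * R)%type.
Local Notation nu := (P0 \x b).

Definition selector (f : T -> 'I_n.+1) :=
  (forall i, measurable (f @^-1` [set i])) /\
  (forall i, nu (f @^-1` [set i]) = (n.+1%:R^-1)%:E).

Definition selection_cost (f : T -> 'I_n.+1) (x : n.+1.-tuple (borel X)) : \bar R :=
  \int[nu]_t (mdist (t.1 : X) (tnth x (f t) : X))%:E.

(** A coupling of [P0] with an empirical measure is realised by choosing an index
    from the first coordinate and an independent uniform variable. *)
Lemma coupling_selector x g : coupling P0 (empirical R x) g ->
  exists2 f, selector f & selection_cost f x = \int[g]_z (mdist (z.1 : X) (z.2 : X))%:E.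
Proof.
move=> gP0x.
have set1 (a : borel X) : measurable [set a] by exact: measurable_borel_set1.
have [q [mq q0 q1 qN cq]] := coupling_density set1 gP0x.
pose f := random_index U q0.
have mf i := measurable_random_index mU mq q0 i.
exists f; first split => // i.
  have := @integral_random_index _ _ _ P0 b U n q mU U_uniform mq q0 q1
    (fun j _ => (j == i)%:R%:E) (fun=> measurable_cst _).
  rewrite (_ : (fun t => _) = (fun t => (\1_(f @^-1` [set i]) t)%:E)); last first.
    apply/funext => t; rewrite indicE; congr (nat_of_bool _)%:R%:E.
    by apply/idP/idP; rewrite !inE => /eqP.
  rewrite integral_indic ?setIT// => -> => [|j y]; last by rewrite lee_fin.
  rewrite (bigD1 i)//= eqxx big1 ?adde0 => [|j /negbTE ->]; last first.
    by under eq_integral do rewrite mul0e; rewrite integral0.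
  by under eq_integral do rewrite mul1e; exact: qN.
rewrite -(cq (fun y a => (mdist (y : X) (a : X))%:E)); last 2 first.
- by apply/measurable_EFinP; exact: measurable_mdist.
- by move=> y a; rewrite lee_fin mdist_ge0.
apply: (@integral_random_index _ _ _ P0 b U n q mU U_uniform mq q0 q1
    (fun i y => (mdist (y : X) (tnth x i : X))%:E)) => [i|i y].
  by apply/measurable_EFinP; apply: measurable_fun_mdist.
by rewrite lee_fin mdist_ge0.
Qed.

Lemma measurable_selection_cost f (x : n.+1.-tuple (borel X)) : selector f ->
  measurable_fun setT (fun t : T => (mdist (t.1 : X) (tnth x (f t) : X))%:E : \bar R).
Proof.
move=> [mf _]; apply/measurable_EFinP.
apply: (measurable_fun_choose (F := fun i (t : T) => mdist (t.1 : X) (tnth x i : X))) => // i.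
by apply: measurable_fun_mdist.
Qed.

Lemma selection_cost_ge0 f x : 0 <= selection_cost f x.
Proof. by apply: integral_ge0 => t _; rewrite lee_fin mdist_ge0. Qed.

Lemma selection_cost_lipschitz f (x x' : n.+1.-tuple (borel X)) (e : R) : selector f ->
  (forall i, (mdist (tnth x i : X) (tnth x' i : X) <= e)%R) ->
  selection_cost f x' <= selection_cost f x + e%:E.
Proof.
move=> hf xx'.
have e0 : (0 <= e)%R by rewrite (le_trans _ (xx' ord0))// mdist_ge0.
rewrite -(probability_integral_cst nu e%:E) -ge0_integralD//; last 2 first.
- by move=> t _; rewrite lee_fin mdist_ge0.
- exact: measurable_selection_cost.
apply: ge0_le_integral => //.
- by move=> t _; rewrite lee_fin mdist_ge0.
- exact: measurable_selection_cost.
- by apply: emeasurable_funD; [exact: measurable_selection_cost|exact: measurable_cst].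
move=> t _; rewrite -EFinD lee_fin; apply: (le_trans (metric_triangle _ (tnth x (f t) : X) _)).
by rewrite lerD2l.
Qed.

Let best x : \bar R := ereal_inf [set selection_cost f x | f in selector].

Let best_fin x : best x \is a fin_num.
Proof.
rewrite ge0_fin_numE; last by apply: le_ereal_inf_tmp => _ [f _ <-]; exact: selection_cost_ge0.
have [M M0 hM] := diameter_ge0 X_bounded.
have gP : coupling P0 (empirical R x) (P0 \x empirical R x).
  split => A mA.
    rewrite (_ : fst @^-1` A = A `*` setT); last first.
      by apply/seteqP; split => -[z1 z2]; [split|case].
    apply: (etrans (product_measure1E _ _ mA measurableT)).
    by rewrite [X in _ * X]probability_setT mule1.
  rewrite (_ : snd @^-1` A = setT `*` A); last first.
    by apply/seteqP; split => -[z1 z2]; [split|case].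
  apply: (etrans (product_measure1E _ _ measurableT mA)).
  by rewrite [X in X * _]probability_setT mul1e.
have [f hf _] := coupling_selector gP.
apply: (@le_lt_trans _ _ M%:E); last exact: ltry.
apply: (@le_trans _ _ (selection_cost f x)).
  by apply: ereal_inf_lbound; exists f.
rewrite -(probability_integral_cst nu M%:E); apply: ge0_le_integral => //.
- by move=> t _; rewrite lee_fin mdist_ge0.
- exact: measurable_selection_cost.
- by move=> t _; rewrite lee_fin.
Qed.

Let best_le x : best x <= Wasserstein P0 (empirical R x).
Proof.
apply: le_ereal_inf_tmp => _ [g gP <-].
by have [f hf <-] := coupling_selector gP; apply: ereal_inf_lbound; exists f.
Qed.

(** Nearly optimal couplings are chosen only for the countably many tuples with
    entries in a dense sequence, and each tuple [x] borrows the selector of a tuple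
    close to it, the cost being Lipschitz in [x]; this makes the dependence on [x]
    measurable. *)
Lemma measurable_selection (e : R) : (0 < e)%R ->
  exists sel : n.+1.-tuple (borel X) -> T -> 'I_n.+1,
  [/\ forall x, selector (sel x),
      forall i, measurable [set p | sel p.1 p.2 = i] &
      forall x, selection_cost (sel x) x <= Wasserstein P0 (empirical R x) + e%:E].
Proof.
move=> e0; have [u u_dense] := dense_sequence X_separable.
have e30 : (0 < e / 3)%R by rewrite divr_gt0.
pose us (s : n.+1.-tuple nat) : n.+1.-tuple (borel X) := [tuple u (tnth s i) | i < n.+1].
have /choice[F Fs] s : exists f, selector f /\ selection_cost f (us s) <= best (us s) + (e / 3)%:E.
  have [_ [f hf <-] lef] := lb_ereal_inf_adherent e30 (best_fin (us s)).
  by exists f; split => //; exact: ltW.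
pose near k (y : X) := (mdist y (u k) < e / 3)%R.
have near_ex y : exists k, near k y by exact: u_dense.
pose k_ y := ex_minn (near_ex y).
pose s_ (x : n.+1.-tuple (borel X)) : n.+1.-tuple nat := [tuple k_ (tnth x i) | i < n.+1].
have us_near x i : (mdist (tnth x i : X) (tnth (us (s_ x)) i : X) < e / 3)%R.
  by rewrite !tnth_mktuple /k_; case: ex_minnP.
have mk k : measurable ([set y | k_ y = k] : set (borel X)).
  rewrite (_ : [set _ | _] = [set y | near k y] `&`
      \bigcap_(j in [set j | (j < k)%N]) ~` [set y | near j y]).
    have mnear j : measurable ([set y | near j y] : set (borel X)).
      have m1 : measurable_fun setT (fun y : borel X => mdist (y : X) (u j)).
        exact: measurable_fun_mdist.
      have := measurable_fun_ltr m1 (measurable_cst (e / 3)%R) measurableT (Y := [set true]) I.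
      by rewrite setTI.
    apply: measurableI => //; apply: bigcap_measurableType => j _.
    exact: measurableC.
  apply/seteqP; split => y /=.
    rewrite /k_; case: ex_minnP => m hm mmin <-; split => // j /= jm nj.
    by have := mmin _ nj; rewrite leqNgt jm.
  move=> [nk hk]; rewrite /k_; case: ex_minnP => m hm mmin.
  apply/eqP; rewrite eqn_leq mmin//= leqNgt; apply/negP => mk.
  exact: hk mk hm.
have ms s : measurable [set x | s_ x = s].
  rewrite (_ : [set _ | _] = \bigcap_(i in [set: 'I_n.+1])
      ((fun x : n.+1.-tuple (borel X) => tnth x i) @^-1` [set y | k_ y = tnth s i])).
    apply: fin_bigcap_measurable => // i _.
    by rewrite -[X in measurable X]setTI; exact: measurable_tnth.
  apply/seteqP; split => x /=.
    by move=> <- i _ /=; rewrite tnth_mktuple.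
  by move=> h; apply: eq_from_tnth => i; rewrite tnth_mktuple; exact: h.
exists (fun x => F (s_ x)); split => [x|i|x]; first by have [] := Fs (s_ x).
- rewrite (_ : [set p | _] = \bigcup_(s in [set: n.+1.-tuple nat])
      ([set x | s_ x = s] `*` (F s @^-1` [set i]))).
    apply: countable_bigcup_measurable => s _; apply: measurableX => //.
    by have [[mF _] _] := Fs s; exact: mF.
  apply/seteqP; split => -[x t] /=; first by exists (s_ x).
  by case=> s _ [/= <-].
- have [hF leF] := Fs (s_ x).
  have step1 : selection_cost (F (s_ x)) x <= selection_cost (F (s_ x)) (us (s_ x)) + (e / 3)%:E.
    by apply: selection_cost_lipschitz => // i; rewrite metric_sym; exact/ltW/us_near.
  have step2 : best (us (s_ x)) <= best x + (e / 3)%:E.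
    rewrite -leeBlDr//; apply: le_ereal_inf_tmp => _ [f hf <-].
    rewrite leeBlDr//; apply: (@le_trans _ _ (selection_cost f (us (s_ x)))).
      by apply: ereal_inf_lbound; exists f.
    by apply: selection_cost_lipschitz => // i; exact/ltW/us_near.
  apply: (le_trans step1); rewrite (_ : e%:E = (e / 3)%:E + (e / 3)%:E + (e / 3)%:E).
    rewrite !addeA; apply: leeD => //; apply: (le_trans leF); apply: leeD => //.
    by apply: (le_trans step2); apply: leeD.
  by rewrite -!EFinD; congr EFin; field.
Qed.

End selector.


(** * The Dirichlet multinomial process *)

(** The positive part of [c - e] is a measurable function below [f]. *)
Lemma lower_integral_le_add d (T : measurableType d) (R : realType)
    (P : probability T R) (c f : T -> \bar R) (e : R) :
  (forall x, 0 <= c x) -> measurable_fun setT c -> (forall x, 0 <= f x) ->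
  (0 <= e)%R -> (forall x, c x <= f x + e%:E) ->
  \int[P]_x c x <= \int[P]_x f x + e%:E.
Proof.
move=> c0 mc f0 e0 cf; pose h x := maxe (c x - e%:E) 0.
have h0 x : 0 <= h x by rewrite le_max lexx orbT.
have mh : measurable_fun setT h.
  by apply: measurable_maxe => //; apply: emeasurable_funB.
apply: (@le_trans _ _ (\int[P]_x (h x + e%:E))).
  apply: ge0_le_lower_integral => // x.
  by rewrite -leeBlDr// le_max lexx.
rewrite ge0_integralD// probability_integral_cst leeD2r//.
by apply: ge0_le_lower_integral => // x; rewrite /h ge_max f0 leeBlDr// cf.
Qed.

Lemma iid_rectangle d (Omega : measurableType d) (R : realType)
    (Pr : probability Omega R) d' (E : measurableType d') (I : choiceType)
    (Z : I -> {RV Pr >-> E}) (mu : probability E R) (N : nat) (idx : 'I_N -> I)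
    (B : 'I_N -> set E) :
  injective idx -> iid Z mu -> (forall i, measurable (B i)) ->
  Pr (rv_tuple (fun i => Z (idx i)) @^-1` rectangle B) = \prod_(i < N) mu (B i).
Proof.
move=> idx_inj [ind law] mB.
pose A k := \bigcap_(i in [set i | idx i = k]) (Z k @^-1` B i).
have Aidx i : A (idx i) = Z (idx i) @^-1` B i.
  rewrite /A (_ : [set _ | _] = [set i]) ?bigcap_set1//.
  by apply/seteqP; split => j /=; [exact: idx_inj|move->].
have us : uniq [seq idx i | i <- enum 'I_N] by rewrite map_inj_uniq ?enum_uniq.
have := mutually_independent_seq (A := A) ind us.
rewrite big_map big_enum/= => h.
transitivity (\prod_(i < N) Pr (A (idx i))); last first.
  by apply: eq_bigr => i _; rewrite Aidx; exact: law.
rewrite -h => [|_ /mapP[i _ ->]]; last first.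
  rewrite Aidx; exists (B i) => //; by rewrite setTI.
congr (Pr _); rewrite rv_tuple_rectangle; apply/seteqP; split => w /=.
  by move=> hw _ /mapP[i _ ->]; rewrite Aidx; exact: hw.
by move=> hw i _; have := hw (idx i) (map_f _ (mem_enum _ i)); rewrite Aidx.
Qed.

(** Under two independent copies of [(y, v)], the pair formed by the first [y] and
    the second [v] is independent of the first [v]. *)
Lemma integral_cross d1 d2 (T1 : measurableType d1) (T2 : measurableType d2)
    (R : realType) (m1 : probability T1 R) (m2 : probability T2 R)
    (g : T1 * T2 -> \bar R) (k : T2 -> \bar R) :
  measurable_fun setT g -> (forall t, 0 <= g t) ->
  measurable_fun setT k -> (forall v, 0 <= k v) ->
  let nu : probability (T1 * T2)%type R := m1 \x m2 in
  \int[nu \x nu]_t (g (t.1.1, t.2.2) * k t.1.2) =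
  (\int[nu]_t g t) * (\int[m2]_v k v).
Proof.
move=> + + + + nu.
move=> mg g0 mk k0.
pose G y := \int[m2]_v g (y, v).
have mG : measurable_fun setT G by exact: measurable_fun_fubini_tonelli_F.
have G0 y : 0 <= G y by exact: integral_ge0.
have mgy y : measurable_fun setT (fun v => g (y, v)).
  exact: (measurableT_comp mg (pair1_measurable y)).
have snd_int (h : T2 -> \bar R) : measurable_fun setT h -> (forall v, 0 <= h v) ->
    \int[nu]_t h t.2 = \int[m2]_v h v.
  move=> mh h0; rewrite -[RHS]mul1e -{1}(probability_integral_cst m1 1).
  rewrite -integral_prodM//; by apply: eq_integral => t _; rewrite mul1e.
have mgk : measurable_fun setT
    (fun t : (T1 * T2) * (T1 * T2) => g (t.1.1, t.2.2) * k t.1.2).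
  apply: emeasurable_funM.
    apply: (measurableT_comp mg); apply: measurable_fun_pair.
      exact: (measurableT_comp measurable_fst measurable_fst).
    exact: (measurableT_comp measurable_snd measurable_snd).
  apply: (measurableT_comp mk).
  exact: (measurableT_comp measurable_snd measurable_fst).
have mgk0 (t : (T1 * T2) * (T1 * T2)) : 0 <= g (t.1.1, t.2.2) * k t.1.2.
  by rewrite mule_ge0.
apply: (etrans (@fubini_tonelli1 _ _ _ _ R nu nu _ mgk mgk0)).
transitivity (\int[nu]_s (G s.1 * k s.2)).
  apply: eq_integral => s _.
  transitivity (\int[nu]_t (g (s.1, t.2) * k s.2)) => //.
  rewrite ge0_integralZr//; last first.
    exact: (measurableT_comp (mgy s.1) measurable_snd).
  by rewrite (snd_int (fun v => g (s.1, v))).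
by rewrite integral_prodM// [in RHS]fubini_tonelli1.
Qed.


Lemma measure_integral_indic d (T : measurableType d) (R : realType)
    (m : {measure set T -> \bar R}) A :
  measurable A -> \int[m]_x (\1_A x)%:E = m A.
Proof. by move=> mA; rewrite integral_indic// setIT. Qed.

Section dirichlet_multinomial.
Context (R : realType) (X : completeMetricType R).
Hypothesis X_separable : separable_space X.
Hypothesis X_bounded : finite_diameter X.
Variables (alpha : R) (P0 : probability (borel X) R) (n : nat).
Hypothesis alpha_gt0 : (0 < alpha)%R.

Local Notation T := (borel X * R)%type.
Local Notation atoms := (n.+1.-tuple (borel X)).

Section coupled_processes.
Variables (b : probability R R) (mu2 : probability (seqspace (T * T)%type) R).
Let nu : probability T R := P0 \x b.
Hypothesis bE : forall A, measurable A -> b A = beta_law 1 alpha A.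
Hypothesis mu2_iid : iid_law mu2 (nu \x nu).
Variable sel : atoms -> T -> 'I_n.+1.
Hypothesis sel_selector : forall x, selector P0 b (sel x).
Hypothesis msel : forall i, measurable [set p | sel p.1 p.2 = i].
Variable nuN : probability atoms R.

Let Om := (atoms * seqspace (T * T)%type)%type.
Let Pr : probability Om R := nuN \x mu2.

(* A pair [t : T * T] carries the atom [t.1.1] and the stick variable [t.1.2]
   of the Dirichlet process, and in [t.2.2] the variable that randomises the
   choice of one of the atoms [x] given [t.1.1]. *)
Let stick (t : T * T) : R := clip t.1.2.
Let atom (t : T * T) : borel X := t.1.1.
Let chosen (x : atoms) (t : T * T) : borel X := tnth x (sel x (t.1.1, t.2.2)).

(* Measures whose atoms depend on [x] are stick-breaking measures of the sequence
   of the [(x, z i)]; this gives their joint measurability in [x] and [z]. *)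
Let TX := (atoms * (T * T))%type.
Let join (w : Om) : seqspace TX := fun i => (w.1, w.2 i).

Let measurable_join : measurable_fun setT join.
Proof.
apply: measurable_seqspaceP => i; apply: measurable_fun_pair.
  exact: measurable_fst.
exact: (measurableT_comp (measurable_coord i) measurable_snd).
Qed.

Let stickX (p : TX) : R := stick p.2.
Let atomX (p : TX) : borel X := atom p.2.
Let chosenX (p : TX) : borel X := chosen p.1 p.2.

Let stick01 t : (0 <= stick t <= 1)%R.
Proof. exact: clip01. Qed.

Let stickX01 p : (0 <= stickX p <= 1)%R.
Proof. exact: clip01. Qed.

Let mstick : measurable_fun setT stick.
Proof.
apply: (measurableT_comp (@measurable_clip R)).
exact: (measurableT_comp measurable_snd measurable_fst).
Qed.

Let matom : measurable_fun setT atom.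
Proof. exact: (measurableT_comp measurable_fst measurable_fst). Qed.

Let mstickX : measurable_fun setT stickX.
Proof. exact: (measurableT_comp mstick measurable_snd). Qed.

Let matomX : measurable_fun setT atomX.
Proof. exact: (measurableT_comp matom measurable_snd). Qed.

Let mchosenX : measurable_fun setT chosenX.
Proof.
apply: (measurable_fun_choose (F := fun i (p : TX) => tnth p.1 i)
  (n := fun p : TX => sel p.1 (p.2.1.1, p.2.2.2))) => i.
  exact: (measurableT_comp (measurable_tnth i) measurable_fst).
rewrite (_ : _ @^-1` _ = (fun p : TX => (p.1, (p.2.1.1, p.2.2.2))) @^-1`
  [set p | sel p.1 p.2 = i])//.
rewrite -[X in measurable X]setTI.
suff mh : measurable_fun setT (fun p : TX => (p.1, (p.2.1.1, p.2.2.2))) by exact: mh.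
apply: measurable_fun_pair; first exact: measurable_fst.
apply: measurable_fun_pair; first exact: matomX.
apply: (measurableT_comp measurable_snd).
exact: (measurableT_comp measurable_snd measurable_snd).
Qed.

Let mchosen x : measurable_fun setT (chosen x).
Proof. exact: (measurableT_comp mchosenX (pair1_measurable x)). Qed.

Let S (w : Om) : Pspace R X := stick_prob stickX atomX (join w).
Let S' (w : Om) : Pspace R X := stick_prob stickX chosenX (join w).

Let mS : measurable_fun setT S.
Proof.
exact: (measurableT_comp (measurable_stick_prob_Pspace X_separable stickX01 mstickX matomX)
  measurable_join).
Qed.

Let mS' : measurable_fun setT S'.
Proof.
exact: (measurableT_comp (measurable_stick_prob_Pspace X_separable stickX01 mstickX mchosenX)
  measurable_join).
Qed.

Let law_S Q : dirichlet_process alpha P0 Q ->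
  forall B, measurable B -> Q B = Pr [set w | B (S w)].
Proof.
move=> hQ B mB.
rewrite (@dirichlet_process_law R X X_separable alpha P0 Q _ _ atom (fun t => t.1.2)
  mu2 (nu \x nu) b hQ matom _ bE mu2_iid _ B mB); last 2 first.
- exact: (measurableT_comp measurable_snd measurable_fst).
- move=> A C mA mC.
  rewrite (_ : [set t | _] = (A `*` C) `*` setT); last first.
    by apply/seteqP; split => -[t1 t2] /= [].
  apply: (etrans (product_measure1E nu nu (measurableX mA mC) measurableT)).
  rewrite [X in _ * X](_ : _ = 1); last exact: probability_setT.
  by rewrite mule1; exact: (product_measure1E P0 b mA mC).
rewrite (_ : [set w | B (S w)] =
    setT `*` [set z | B (stick_prob (clip \o (fun t => t.1.2)) atom z)]); last first.
  by apply/seteqP; split => -[x z] //= [].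
rewrite [RHS](_ : _ = nuN setT * mu2 [set z | B (stick_prob (clip \o (fun t => t.1.2)) atom z)]).
  by rewrite [X in X * _](_ : _ = 1) ?mul1e//; exact: probability_setT.
apply: (product_measure1E nuN mu2 measurableT).
rewrite -[X in measurable X]setTI.
have := measurable_stick_prob_Pspace X_separable stick01 mstick matom.
by move=> /(_ measurableT _ mB).
Qed.

Let integral_chosen x (h : borel X -> \bar R) (k : R -> \bar R) :
  measurable_fun setT h -> (forall y, 0 <= h y) ->
  measurable_fun setT k -> (forall v, 0 <= k v) ->
  \int[nu \x nu]_t (h (chosen x t) * k t.1.2) =
  (\int[nu]_t h (tnth x (sel x t))) * \int[b]_v k v.
Proof.
move=> mh h0 mk k0.
apply: (@integral_cross _ _ _ _ R P0 b (fun t => h (tnth x (sel x t))) k) => //.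
apply: (measurableT_comp mh).
apply: (measurable_fun_choose (F := fun i (_ : T) => tnth x i)) => i.
  exact: measurable_cst.
by have [+ _] := sel_selector x; exact.
Qed.

Let selector_mean x (h : borel X -> \bar R) : (forall y, 0 <= h y) ->
  \int[nu]_t h (tnth x (sel x t)) = (n.+1%:R^-1)%:E * \sum_(i < n.+1) h (tnth x i).
Proof.
move=> h0; have [ms Ps] := sel_selector x.
rewrite (_ : (fun t => _) = (fun t => \sum_(i < n.+1) h (tnth x i) *
    (\1_(sel x @^-1` [set i]) t)%:E)); last first.
  apply/funext => t; rewrite (bigD1 (sel x t))//= big1.
    by rewrite indicE mem_set//= mule1 adde0.
  by move=> i ti; rewrite indicE memNset ?mule0//= => ti'; rewrite ti' eqxx in ti.
rewrite ge0_integral_sum//; last 2 first.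
- by move=> i; apply: emeasurable_funM => //; apply/measurable_EFinP; exact: measurable_indic.
- by move=> i t _; rewrite mule_ge0// lee_fin.
rewrite ge0_sume_distrr//; apply: eq_bigr => i _.
rewrite ge0_integralZl//; last by apply/measurable_EFinP; exact: measurable_indic.
rewrite muleC integral_indic// setIT; congr (_ * _); exact: Ps.
Qed.

Let law_chosen x A C : measurable A -> measurable C ->
  (nu \x nu) [set t | A (chosen x t) /\ C t.1.2] = empirical R x A * b C.
Proof.
move=> mA mC.
have A0 y : 0 <= (\1_A y)%:E :> \bar R by rewrite lee_fin.
have mA1 : measurable_fun setT (fun y => (\1_A y)%:E : \bar R).
  by apply/measurable_EFinP; exact: measurable_indic.
have mC1 : measurable_fun setT (fun v => (\1_C v)%:E : \bar R).
  by apply/measurable_EFinP; exact: measurable_indic.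
have bC : b C = \int[b]_v (\1_C v)%:E by rewrite integral_indic// setIT.
have xA : empirical R x A = \int[nu]_t (\1_A (tnth x (sel x t)))%:E.
  by rewrite empiricalE// (selector_mean x A0).
have C0 v : 0 <= (\1_C v)%:E :> \bar R by rewrite lee_fin.
rewrite bC xA -(integral_chosen x mA1 A0 mC1 C0).
have mAC : measurable [set t | A (chosen x t) /\ C t.1.2].
  apply: measurableI.
    by rewrite -[X in measurable X]setTI; exact: mchosen.
  rewrite -[X in measurable X]setTI.
  suff ms : measurable_fun setT (fun t : T * T => t.1.2) by exact: ms.
  exact: (measurableT_comp measurable_snd measurable_fst).
transitivity (\int[nu \x nu]_t (\1_[set t | A (chosen x t) /\ C t.1.2] t)%:E).
  exact: (esym (measure_integral_indic (nu \x nu) mAC)).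
apply: eq_integral => t _; rewrite !indicE -EFinM -natrM mulnb.
congr (nat_of_bool _)%:R%:E; by apply/idP/andP; rewrite !inE.
Qed.

Let law_S' (K : atoms -> set (Pspace R X) -> \bar R) :
  (forall x, dirichlet_process alpha (empirical R x) (K x)) ->
  forall B, measurable B -> \int[nuN]_x K x B = Pr [set w | B (S' w)].
Proof.
move=> hK B mB.
transitivity (\int[nuN]_x mu2 (xsection [set w | B (S' w)] x)) => //.
apply: eq_integral => x _.
rewrite (@dirichlet_process_law R X X_separable alpha _ _ _ _ (chosen x) (fun t => t.1.2)
  mu2 (nu \x nu) b (hK x) (mchosen x) _ bE mu2_iid _ B mB).
- by congr (mu2 _); apply/seteqP; split => z; rewrite /xsection/= inE.
- exact: (measurableT_comp measurable_snd measurable_fst).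
- by move=> A C mA mC; exact: law_chosen.
Qed.

Let stick_pos : (0 < 1 / (alpha + 1))%R.
Proof. by rewrite divr_gt0// addr_gt0. Qed.

Let integral_stick : \int[nu \x nu]_t (stick t)%:E = (1 / (alpha + 1))%:E.
Proof.
have := @integral_cross _ _ _ _ R P0 b (cst 1) (fun v => (clip v)%:E).
move=> /(_ (measurable_cst _) (fun=> lee01)) h.
rewrite -(beta_mean alpha_gt0 bE) -[RHS]mul1e -{1}(probability_integral_cst nu 1).
rewrite -h; last 2 first.
- by apply/measurable_EFinP; exact: measurable_clip.
- by move=> v; rewrite lee_fin; case/andP: (clip01 v).
by apply: eq_integral => t _; rewrite mul1e.
Qed.

Let mass_stick : {ae Pr, forall w, mass stickX (join w) = 1}.
Proof.
have [N [mN N0 sN]] := mass_ae_eq1 mstick stick01 mu2_iid stick_pos integral_stick.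
exists (setT `*` N); split.
- exact: measurableX.
- by apply: (etrans (product_measure1E nuN mu2 measurableT mN)); rewrite [X in _ * X](_ : _ = 0) ?mule0.
- by move=> [x z] /= h; split => //; apply: sN.
Qed.

Let f (p : TX) : \bar R := (mdist (atomX p : X) (chosenX p : X))%:E.

Let f0 p : 0 <= f p.
Proof. by rewrite lee_fin mdist_ge0. Qed.

Let mf : measurable_fun setT f.
Proof. by apply/measurable_EFinP; exact: measurable_fun_mdist. Qed.

Let c (w : Om) : \bar R := stick_sum stickX f (join w).

Let c0 w : 0 <= c w.
Proof. exact: stick_sum_ge0. Qed.

Let mc : measurable_fun setT c.
Proof. exact: (measurableT_comp (measurable_stick_sum mstickX stickX01 f0 mf) measurable_join). Qed.

Let integral_c x : \int[mu2]_z c (x, z) = selection_cost P0 b (sel x) x.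
Proof.
have [M M0 hM] := diameter_ge0 X_bounded.
pose fx (t : T * T) : \bar R := f (x, t).
have mfx : measurable_fun setT fx := measurableT_comp mf (pair1_measurable x).
pose g (t : T) : \bar R := (mdist (t.1 : X) (tnth x (sel x t) : X))%:E.
have mg : measurable_fun setT g by exact: measurable_selection_cost.
have g0 t : 0 <= g t by rewrite lee_fin mdist_ge0.
have h (k : R -> \bar R) : measurable_fun setT k -> (forall v, 0 <= k v) ->
    \int[nu \x nu]_t (g (t.1.1, t.2.2) * k t.1.2) = (\int[nu]_t g t) * \int[b]_v k v.
  by move=> mk k0; exact: (@integral_cross _ _ _ _ R P0 b g k mg g0 mk k0).
have fxE : \int[nu \x nu]_t fx t = \int[nu]_t g t.
  have := h (cst 1) (measurable_cst _) (fun=> lee01).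
  rewrite (probability_integral_cst b 1) mule1 => <-.
  by apply: eq_integral => t _; rewrite mule1.
rewrite -[RHS]/(\int[nu]_t g t) -fxE.
rewrite (_ : (fun z => c (x, z)) = stick_sum stick fx)//.
apply: (integral_stick_sum mstick stick01 mu2_iid M0 _ mfx stick_pos integral_stick).
  by move=> t; rewrite f0 lee_fin hM.
rewrite fxE muleC -(beta_mean alpha_gt0 bE) -(h (fun v => (clip v)%:E)).
- by apply: eq_integral => t _; rewrite muleC.
- by apply/measurable_EFinP; exact: measurable_clip.
- by move=> v; rewrite lee_fin; case/andP: (clip01 v).
Qed.

(** Both processes use the same sticks, and each atom of the second one is chosen
    from [x] by the selected coupling. For fixed [x] the chosen atoms are i.i.d.
    with law the empirical measure of [x], so that the second process is a
    Dirichlet process given [x]; the expected cost of transporting each atom to the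
    chosen one is the cost of the selection. *)
Lemma WoW_selection (e : R) (Q Q' : probability (Pspace R X) R)
    (K : atoms -> set (Pspace R X) -> \bar R) : (0 < e)%R ->
  (forall x, selection_cost P0 b (sel x) x <= Wasserstein P0 (empirical R x) + e%:E) ->
  dirichlet_process alpha P0 Q ->
  (forall x, dirichlet_process alpha (empirical R x) (K x)) ->
  (forall B, measurable B -> Q' B = \int[nuN]_x K x B) ->
  WoW Q Q' <= \int[nuN]_x Wasserstein P0 (empirical R x) + e%:E.
Proof.
move=> e0 sel_e hQ hK Q'E.
apply: (@le_trans _ _ (\int[Pr]_w c w)).
  apply: (@WoW_le R X _ Om Pr S S' Q Q') => //.
  - exact: law_S.
  - by move=> B mB; rewrite Q'E//; exact: law_S'.
  - have [N [mN N0 sN]] := mass_stick; exists N; split => // w h.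
    by apply: sN => /= w1; apply: h; exact: Wasserstein_stick_prob.
have -> : \int[Pr]_w c w = \int[nuN]_x selection_cost P0 b (sel x) x.
  apply: (etrans (@fubini_tonelli1 _ _ _ _ R nuN mu2 _ mc c0)).
  by apply: eq_integral => x _; exact: integral_c.
apply: lower_integral_le_add => //.
- by move=> x; exact: selection_cost_ge0.
- rewrite (_ : (fun x => _) = (fun x => \int[mu2]_z c (x, z))); last first.
    by apply/funext => x; rewrite integral_c.
  exact: measurable_fun_fubini_tonelli_F.
- by move=> x; exact: Wasserstein_ge0.
- exact: ltW.
Qed.

End coupled_processes.
End dirichlet_multinomial.


Lemma iid_rv_tuple_law (R : realType) d (E : measurableType d) (mu : probability E R)
    (N : nat) d1 (Om1 : measurableType d1) (Pr1 : probability Om1 R)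
    (Z1 : 'I_N -> {RV Pr1 >-> E})
    d2 (Om2 : measurableType d2) (Pr2 : probability Om2 R)
    (Z2 : 'I_N -> {RV Pr2 >-> E}) :
  (forall B, (forall i, measurable (B i)) ->
    Pr1 (rv_tuple Z1 @^-1` rectangle B) = \prod_(i < N) mu (B i)) ->
  (forall B, (forall i, measurable (B i)) ->
    Pr2 (rv_tuple Z2 @^-1` rectangle B) = \prod_(i < N) mu (B i)) ->
  forall C, measurable C ->
    distribution Pr1 (to_mfun (measurable_rv_tuple Z1)) C =
    distribution Pr2 (to_mfun (measurable_rv_tuple Z2)) C.
Proof.
move=> h1 h2; apply: tuple_measure_unique => B mB.
exact: etrans (h1 B mB) (esym (h2 B mB)).
Qed.

Lemma beta_uniform_variable (R : realType) (alpha : R) (b : probability R R) :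
  (0 < alpha)%R -> (forall A, measurable A -> b A = beta_law 1 alpha A) ->
  exists2 U : R -> R, measurable_fun setT U &
    forall s : R, (0 <= s <= 1)%R -> b [set v | U v <= s]%R = s%:E.
Proof.
move=> alpha_gt0 bE.
(* The value [2] puts the null event [1 <= v] above all levels [s <= 1]. *)
pose U (v : R) : R := (if v < 1 then (1 - v) `^ alpha else 2)%R.
exists U.
  apply: measurable_fun_ifT; [exact: measurable_fun_ltr| |exact: measurable_cst].
  apply: (measurableT_comp (@measurable_powR R alpha)).
  exact: measurable_funB.
move=> s s01; rewrite -(beta_uniform alpha_gt0 bE s01); congr (b _).
apply/seteqP; split => v; rewrite /= /U; case: ltP => v1 //; last 2 first.
- by case.
- by case.
move=> s2; case/andP: s01 => _ s1.
by have := le_trans s2 s1; rewrite leNgt ltr1n.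
Qed.

(** In the pairs of consecutive terms of an i.i.d. sequence of atoms and sticks, the
    first term builds the processes and the stick of the second one randomises the
    selection. *)
Theorem WoW_multinomial (R : realType) (X : completeMetricType R)
    (X_separable : separable_space X) (X_bounded : finite_diameter X)
    (alpha : R) (P0 : probability (borel X) R) (N : nat)
    (Q Q' : probability (Pspace R X) R)
    d (Omega : measurableType d) (Pr : probability Omega R)
    (X_ : 'I_N -> {RV Pr >-> borel X}) :
  (0 < alpha)%R -> (0 < N)%N ->
  dirichlet_process alpha P0 Q -> dirichlet_multinomial alpha P0 N Q' ->
  (forall B, (forall i, measurable (B i)) ->
    Pr (rv_tuple X_ @^-1` rectangle B) = \prod_(i < N) P0 (B i)) ->
  WoW Q Q' <= \int[Pr]_w Wasserstein P0 (empirical R [tuple X_ i w | i < N]).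
Proof.
case: N X_ => [//|n] X_ alpha_gt0 _ hQ [d' [W [Pr' [X'_ [S [kappa]]]]]].
move=> [X'iid hkappa Skappa SQ'] Xrect.
have [b [mu [bE mu_iid _]]] := dirichlet_process_data X_separable hQ.
have [U mU U_uniform] := beta_uniform_variable alpha_gt0 bE.
have mu2_iid := pair_up_iid_law mu_iid.
set mu2 := distribution _ _ in mu2_iid.
pose nuN : probability (n.+1.-tuple (borel X)) R :=
  distribution Pr (to_mfun (measurable_rv_tuple X_)).
have nuNE C : measurable C ->
    nuN C = distribution Pr' (to_mfun (measurable_rv_tuple X'_)) C.
  move=> mC; apply: (iid_rv_tuple_law Xrect _ mC) => B mB.
  by apply: (iid_rectangle (idx := id)).
apply/lee_addgt0Pr => e e0.
have [sel [hsel msel sel_e]] :=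
  @measurable_selection R X X_separable X_bounded P0 b U n mU U_uniform e e0.
apply: (@le_trans _ _ (\int[nuN]_x Wasserstein P0 (empirical R x) + e%:E)).
  have WS := (@WoW_selection R X X_separable X_bounded alpha P0 n alpha_gt0 b mu2 bE mu2_iid
    sel hsel msel nuN e Q Q' (fun x => kappa x) e0 sel_e hQ hkappa); apply: WS.
  move=> B mB; rewrite -SQ'//.
  have := Skappa setT B measurableT mB.
  rewrite !preimage_setT setTI => SB.
  transitivity (Pr' (S @^-1` B)) => //; rewrite SB.
  have mk : measurable_fun setT (kappa ^~ B) by exact: measurable_kernel.
  rewrite (@ge0_integral_comp _ _ _ _ R Pr' (rv_tuple X'_) (measurable_rv_tuple X'_)
    (kappa ^~ B))//.
  by apply: eq_measure_integral => C mC _; apply: esym; exact: nuNE.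
rewrite leeD2r//.
exact: (ge0_le_lower_integral_pushforward Pr (to_mfun (measurable_rv_tuple X_))
  (fun x => Wasserstein_ge0 P0 (empirical R x))).
Qed.


(** * Distances and distribution functions on the real line *)

Lemma integral_layers (R : realType) (a b : R) :
  \int[@lebesgue_measure R]_t ((\1_`[a, b[ t)%:E + (\1_`[b, a[ t)%:E) = `|a - b|%:E.
Proof.
rewrite ge0_integralD//; try by apply/measurable_EFinP; exact: measurable_indic.
have li (x y : R) : \int[@lebesgue_measure R]_t (\1_`[x, y[ t)%:E =
    (if (x < y)%R then (y - x)%:E else 0).
  rewrite integral_indic// setIT; apply: (etrans (lebesgue_measure_itv _)).
  by rewrite /= lte_fin -EFinB.
rewrite !li.
case: (ltgtP a b) => [ab|ba|->]; rewrite ?adde0 ?add0e.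
- by rewrite ler0_norm ?opprB// subr_le0 ltW.
- by rewrite ger0_norm// subr_ge0 ltW.
- by rewrite subrr normr0.
Qed.

(** Tonelli's theorem for the layers [f x <= t < g x], whose lengths in [t] are
    given by [integral_layers]. *)
Lemma integral_dist_layers d (T : measurableType d) (R : realType)
    (Q : probability T R) (f g : T -> R) :
  measurable_fun setT f -> measurable_fun setT g ->
  \int[Q]_x `|f x - g x|%:E =
  \int[@lebesgue_measure R]_t
    (Q [set x | f x <= t < g x]%R + Q [set x | g x <= t < f x]%R).
Proof.
move=> mf mg.
pose D (f g : T -> R) := [set p : T * R | f p.1 <= p.2 < g p.1]%R.
have mD (h k : T -> R) : measurable_fun setT h -> measurable_fun setT k -> measurable (D h k).
  move=> mh mk; rewrite (_ : D h k =
      [set p | h p.1 <= p.2]%R `&` [set p | p.2 < k p.1]%R); last first.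
    by apply/seteqP; split => p /=; [move/andP|move=> h'; apply/andP].
  apply: measurableI; rewrite -[X in measurable X]setTI.
    by apply: measurable_fun_le => //; exact: (measurableT_comp mh measurable_fst).
  have := measurable_fun_ltr (@measurable_snd _ _ T R)
    (measurableT_comp mk measurable_fst) measurableT (Y := [set true]) I.
  by [].
have mDt (h k : T -> R) (t : R) : measurable_fun setT h -> measurable_fun setT k ->
    measurable [set x | h x <= t < k x]%R.
  move=> mh mk; have := measurable_ysection t (mD h k mh mk).
  by congr measurable; apply/funext => x; rewrite /ysection/= inE.
pose F (p : T * R) : \bar R := (\1_(D f g) p)%:E + (\1_(D g f) p)%:E.
have F0 p : 0 <= F p by rewrite adde_ge0// lee_fin.
have mF : measurable_fun setT F.
  by apply: emeasurable_funD; apply/measurable_EFinP/measurable_indic; exact: mD.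
transitivity (\int[Q]_x \int[@lebesgue_measure R]_t F (x, t)).
  apply: eq_integral => x _; rewrite -integral_layers; apply: eq_integral => t _.
  by rewrite /F !indicE; congr ((nat_of_bool _)%:R%:E + (nat_of_bool _)%:R%:E);
    apply/idP/idP; rewrite !inE /= ?in_itv.
apply: (etrans (@fubini_tonelli _ _ _ _ R Q (@lebesgue_measure R) F mF F0)).
apply: eq_integral => t _.
have indic_section (h k : T -> R) (mh : measurable_fun setT h) (mk : measurable_fun setT k) :
    \int[Q]_x (\1_(D h k) (x, t))%:E = Q [set x | h x <= t < k x]%R.
  rewrite -measure_integral_indic; last exact: mDt.
  by apply: eq_integral => x _; rewrite !indicE; congr (nat_of_bool _)%:R%:E;
    apply/idP/idP; rewrite !inE.
have m1 (h k : T -> R) (mh : measurable_fun setT h) (mk : measurable_fun setT k) :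
    measurable_fun setT (fun x => (\1_(D h k) (x, t))%:E : \bar R).
  apply/measurable_EFinP.
  exact: (measurableT_comp (measurable_indic (mD h k mh mk)) (pair2_measurable t)).
rewrite /F ge0_integralD//; [|exact: m1|exact: m1].
by rewrite !indic_section.
Qed.


(** * Quantiles and the monotone coupling *)

Section uniform_law.
Context (R : realType) (lambda : probability R R).
Hypothesis lambda_uniform : forall s : R, (0 <= s <= 1)%R ->
  lambda [set u | u <= s]%R = s%:E.

Lemma uniform_itv (a b : R) : (0 <= a)%R -> (a <= b)%R -> (b <= 1)%R ->
  lambda [set u | a < u <= b]%R = (b - a)%:E.
Proof.
move=> a0 ab b1.
have mray (s : R) : measurable ([set u | u <= s]%R : set R).
  by rewrite -[X in measurable X]setTI; exact: measurable_fun_le.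
rewrite (_ : [set u | _] = [set u | u <= b]%R `\` [set u | u <= a]%R); last first.
  apply/seteqP; split => u /=; first by case/andP => au ub; split=> //; apply/negP; rewrite -ltNge.
  by case=> ub /negP; rewrite -ltNge => au; apply/andP.
rewrite measureD//; last by rewrite (le_lt_trans (probability_le1 _ _))// ltry.
rewrite setIidr; last by move=> u /= /le_trans; exact.
rewrite [X in X - _]lambda_uniform ?b1 ?(le_trans a0)//.
by rewrite [X in _ - X]lambda_uniform ?a0 ?(le_trans ab).
Qed.

Lemma uniform_support : {ae lambda, forall u, 0 < u <= 1}%R.
Proof.
have mI : measurable ([set u | 0 < u <= 1]%R : set R).
  have := measurable_itv `]0%R, 1%R] : measurable (_ : set R).
  by congr measurable; apply/seteqP; split => u /=; rewrite in_itv.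
exists (~` [set u | 0 < u <= 1]%R); split => //; first exact: measurableC.
apply: (etrans (probability_setC lambda mI)).
by rewrite [X in 1 - X](uniform_itv (lexx 0)%R ler01 (lexx 1)%R) subr0 -EFinB subrr.
Qed.

End uniform_law.

Section isometry.
Context (R : realType) (X : completeMetricType R).
Hypothesis X_bounded : finite_diameter X.
Variable iota : X -> R.
Hypothesis iotaP : real_isometry iota.

Lemma isometry_continuous : continuous iota.
Proof.
move=> x; apply/cvgrPdist_lt => e e0.
by apply/nbhs_ballP; exists e => // y; rewrite ballEmdist /= iotaP.
Qed.

Lemma measurable_isometry : measurable_fun setT (iota : borel X -> R).
Proof. by apply: continuous_borel_measurable; exact: isometry_continuous. Qed.

Let measurable_ray t : measurable (iota @^-1` `]-oo, t] : set (borel X)).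
Proof. by rewrite -[X in measurable X]setTI; exact: measurable_isometry. Qed.

Local Notation cdf := (cdf_along iota).
Implicit Types P : probability (borel X) R.

Lemma cdf_alongE P t : (cdf P t)%:E = P (iota @^-1` `]-oo, t]).
Proof. by rewrite /cdf_along fineK// fin_num_measure. Qed.

Lemma cdf_along01 P t : (0 <= cdf P t <= 1)%R.
Proof. by rewrite -!lee_fin cdf_alongE measure_ge0 probability_le1. Qed.

Lemma cdf_along_nd P : {homo cdf P : s t / (s <= t)%R}.
Proof.
move=> s t st; rewrite -lee_fin !cdf_alongE le_measure// ?inE//.
by move=> x /=; rewrite !in_itv/= => /le_trans; exact.
Qed.

Lemma cdf_along_right P t s : (cdf P t < s)%R ->
  exists2 t', (t < t')%R & (cdf P t' < s)%R.
Proof.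
pose I : {RV P >-> R} := to_mfun measurable_isometry.
have IE r : random_variable.cdf I r = (cdf P r)%:E.
  by rewrite cdf_alongE.
move=> ts.
have h : cdf P x @[x --> t^'+] --> cdf P t.
  have := @cdf_right_continuous _ _ R P I t; rewrite IE => hI.
  exact: fine_cvg hI.
have h' : \forall x \near t^'+, (cdf P x < s)%R by exact: cvgr_lt h _ ts.
near t^'+ => x; exists x; last by near: x.
near: x; exact: nbhs_right_gt.
Unshelve. all: by end_near. Qed.

(** By right continuity, [cdf P t < s] amounts to [cdf P q < s] for some rational
    [q] greater than [t]. *)
Lemma measurable_cdf_along_joint d (U : measurableType d) (S : U -> Pspace R X) :
  separable_space X -> measurable_fun setT S ->
  measurable_fun setT (fun p : U * R => cdf (as_probability (S p.1)) p.2).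
Proof.
move=> X_separable mS.
have mr (r s : R) : measurable [set w | cdf (as_probability (S w)) r < s]%R.
  have mc : measurable_fun setT (fun w => cdf (as_probability (S w)) r).
    apply: (measurableT_comp (f := fine)); first exact: fine_measurable.
    exact: (measurableT_comp (measurable_evaluation X_separable (measurable_ray r)) mS).
  have := measurable_fun_ltr mc (measurable_cst s) measurableT (Y := [set true]) I.
  by rewrite setTI.
apply: (measurability _ (RGenInftyO.measurableE R)) => //.
move=> _ [_ [s ->] <-]; rewrite setTI.
rewrite (_ : _ @^-1` _ = \bigcup_(q in [set: rat])
    ([set w | cdf (as_probability (S w)) (ratr q) < s]%R `*` `]-oo, (ratr q)[)).
  by apply: countable_bigcup_measurable => q _; apply: measurableX.
apply/seteqP; split => -[w t] /=; rewrite in_itv/=.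
  move=> ts; have [t' tt' t's] := cdf_along_right ts.
  have ne : `]t, t'[ !=set0 by exists ((t + t') / 2)%R; rewrite /= in_itv/= !midf_lt.
  have ot : open (`]t, t'[%classic : set R) by exact: interval_open.
  have [r [tq [q _ qE]]] := dense_rat ne ot.
  move: tq; rewrite -qE /= in_itv/= => /andP[tq qt'].
  exists q => //; split => /=; last by rewrite in_itv.
  by apply: le_lt_trans t's; apply/cdf_along_nd/ltW.
case=> q _ [/= qs]; rewrite in_itv/= => tq.
by apply: le_lt_trans qs; apply/cdf_along_nd/ltW.
Qed.

Let iota_bound : exists M : R, forall x, (`|iota x - iota point| <= M)%R.
Proof.
by have [M hM] := X_bounded; exists M => x; rewrite -iotaP.
Qed.

Lemma cdf_along_support : exists m M : R, forall P,
  (forall t, (t < m)%R -> cdf P t = 0%R) /\ cdf P M = 1%R.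
Proof.
have [M hM] := iota_bound; exists (iota point - M)%R, (iota point + M)%R => P.
have b x : (iota point - M <= iota x <= iota point + M)%R.
  have := hM x; rewrite ler_norml => /andP[h1 h2]; apply/andP; split; lra.
split=> [t tm|].
  apply/EFin_inj; rewrite cdf_alongE (_ : _ @^-1` _ = set0) ?measure0//.
  apply/seteqP; split => x //=; rewrite in_itv/= => xt.
  by have /andP[bx _] := b x; have := le_lt_trans (le_trans bx xt) tm; rewrite ltxx.
apply/EFin_inj; rewrite cdf_alongE (_ : _ @^-1` _ = setT); first exact: probability_setT.
by apply/seteqP; split => x //= _; rewrite in_itv/=; have /andP[] := b x.
Qed.

(** The infimum is finite, also for [u = 1], because the range of [iota] is
    bounded. *)
Definition quantile P (u : R) : R :=
  if (0 < u <= 1)%R then inf [set t | u <= cdf P t]%R else 0%R.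

Lemma quantile_le P u t : (0 < u <= 1)%R -> (quantile P u <= t)%R = (u <= cdf P t)%R.
Proof.
move=> u01; rewrite /quantile u01; move: u01 => /andP[u0 u1].
have [m [M /(_ P)[hm hM]]] := cdf_along_support.
have lb : lbound [set t | u <= cdf P t]%R m.
  by move=> s /= us; rewrite leNgt; apply/negP => /hm s0; move: us; rewrite s0 leNgt u0.
have ne : [set t | u <= cdf P t]%R !=set0 by exists M; rewrite /= hM.
apply/idP/idP => [qt|ut]; last by apply: ge_inf => //; exists m.
rewrite leNgt; apply/negP => /cdf_along_right[t' tt' t'u].
have [s /= us st'] := inf_lt ne (le_lt_trans qt tt').
have := le_trans us (cdf_along_nd P (ltW st')).
by rewrite leNgt t'u.
Qed.

Lemma measurable_quantile P : measurable_fun setT (quantile P).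
Proof.
apply: (measurability _ (RGenOInfty.measurableE R)) => //.
move=> _ [_ [t ->] <-]; rewrite setTI.
have mI : measurable ([set u | 0 < u <= 1]%R : set R).
  by rewrite (_ : mkset _ = `]0%R, 1%R]%classic).
rewrite (_ : _ @^-1` _ =
  ([set u | 0 < u <= 1]%R `&` `]cdf P t, +oo[) `|`
  (~` [set u | 0 < u <= 1]%R `&` (if t < 0 then setT else set0)%R)).
  apply: measurableU; apply: measurableI => //; first exact: measurableC.
  by case: ifP.
apply/seteqP; split => u /=; rewrite !in_itv/= !andbT.
  case: (boolP (0 < u <= 1)%R) => u01.
    by rewrite ltNge quantile_le// -ltNge => tu; left.
  by rewrite /quantile (negbTE u01) => t0; right; rewrite t0; split => //; exact/negP.
case=> [[u01]|[/negP u01]]; first by rewrite ltNge -quantile_le// -ltNge.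
by rewrite /quantile (negbTE u01); case: ifP.
Qed.

End isometry.


Section isometric_line.
Context (R : realType) (X : completeMetricType R).
Hypothesis X_bounded : finite_diameter X.
Variable iota : X -> R.
Hypothesis iotaP : real_isometry iota.

Local Notation cdf := (cdf_along iota).

(** The subspace is complete, hence closed in the line. *)
Lemma closed_range_isometry : closed (range iota).
Proof.
move=> p clp.
have /choice[x_ xp] (n : nat) : exists x, (`|p - iota x| < n.+1%:R^-1)%R.
  have n0 : (0 < n.+1%:R^-1 :> R)%R by rewrite invr_gt0.
  have [_ [[x _ <-] hx]] := clp _ (nbhsx_ballx p _ n0).
  by exists x.
have x_cauchy : cauchy (x_ @ \oo).
  apply/cauchy_ballP => e e0.
  have e20 : (0 < e / 2)%R by rewrite divr_gt0.
  have : \forall n \near \oo, (n.+1%:R^-1 < e / 2)%R.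
    exact: (near_infty_natSinv_lt (PosNum e20)).
  move=> [n0 _ hn0].
  have xe n : (n0 <= n)%N -> (`|p - iota (x_ n)| < e / 2)%R.
    by move=> n0n; exact: lt_trans (xp n) (hn0 _ n0n).
  exists ([set x_ n | n in [set n | (n0 <= n)%N]],
          [set x_ n | n in [set n | (n0 <= n)%N]]).
    by split; exists n0 => // n n0n; exists n.
  move=> [_ _] [/= [i n0i <-] [j n0j <-]]; rewrite ballEmdist/= iotaP.
  rewrite [e]splitr (le_lt_trans (ler_distD p _ _))//.
  by apply: ltrD; [rewrite distrC; exact: xe|exact: xe].
have x_l : x_ n @[n --> \oo] --> lim (x_ n @[n --> \oo]) by exact: (@cauchy_cvg X _ _ x_cauchy).
set l := lim _ in x_l.
exists l => //.
have h1 : iota (x_ n) @[n --> \oo] --> iota l.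
  by apply: (cvg_comp _ _ x_l); exact: isometry_continuous.
have h2 : iota (x_ n) @[n --> \oo] --> p.
  apply/cvgrPdist_lt => e e0.
  have := near_infty_natSinv_lt (PosNum e0).
  by apply: filterS => n; exact: lt_trans.
exact: cvg_unique h1 h2.
Qed.

Let range_measurable : measurable (range iota : set R).
Proof. exact: closed_measurable closed_range_isometry. Qed.

Lemma isometry_inj x y : iota x = iota y -> x = y.
Proof.
move=> xy; apply: mdist_positivity; by rewrite iotaP xy subrr normr0.
Qed.

Definition isometry_inv (r : R) : X :=
  if pselect (exists x, iota x = r) is left h then sval (cid h) else point.

Lemma isometry_invK r : range iota r -> iota (isometry_inv r) = r.
Proof.
by move=> [x _ xr]; rewrite /isometry_inv; case: pselect => [h|[]]; [case: cid|exists x].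
Qed.

Lemma isometryK x : isometry_inv (iota x) = x.
Proof. by apply: isometry_inj; rewrite isometry_invK//; exists x. Qed.

(** The inverse is continuous on the closed range of [iota] and constant elsewhere. *)
Lemma measurable_isometry_inv : measurable_fun setT (isometry_inv : R -> borel X).
Proof.
apply: (@measurability _ _ R (borel X) setT _ (@open X)) => //.
move=> _ [G openG <-]; rewrite setTI.
pose V := \bigcup_(xe in [set xe : X * R | (0 < xe.2)%R /\ ball xe.1 xe.2 `<=` G])
  (ball (iota xe.1) xe.2 : set R).
have oV : open V by apply: bigcup_open => -[x e] [e0 _]; exact: ball_open.
have -> : isometry_inv @^-1` G =
    (range iota `&` V) `|` (~` range iota `&` (if pselect (G point) then setT else set0)).
  apply/seteqP; split => r /=.
    case: (pselect (range iota r)) => hr; last first.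
      rewrite /isometry_inv; case: pselect => [[x xr]|_ Op]; first by case: hr; exists x.
      by right; split => //; case: pselect.
    move=> Gr; left; split => //.
    have /nbhs_ballP[e /= e0 he] : nbhs (isometry_inv r) G by exact: open_nbhs_nbhs.
    exists (isometry_inv r, e) => //=.
    by rewrite isometry_invK//; exact: ballxx.
  case=> [[[x _ <-] [[y e] [/= e0 he]]]|[hr]].
    rewrite /ball/= => hyx; rewrite isometryK; apply: he.
    by rewrite ballEmdist/= iotaP.
  case: pselect => // Op _; rewrite /isometry_inv; case: pselect => // -[x xr].
  by case: hr; exists x.
apply: measurableU; apply: measurableI => //.
- exact: open_measurable.
- exact: measurableC.
- by case: pselect => ? /=; [exact: measurableT|exact: measurable0].
Qed.

Section quantile_coupling.
Variable lambda : probability R R.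
Hypothesis lambda_uniform : forall s : R, (0 <= s <= 1)%R ->
  lambda [set u | u <= s]%R = s%:E.

Lemma quantile_law (P : probability (borel X) R) A : measurable A ->
  lambda [set u | A (quantile iota P u)] = P (iota @^-1` A).
Proof.
have mI := measurable_isometry iotaP.
pose m1 : probability R R := distribution lambda (to_mfun (measurable_quantile X_bounded iotaP P)).
pose m2 : probability R R := distribution P (to_mfun mI).
move=> mA; apply: (@measure_unique _ R R (@RGenOInfty.G R) (fun n => `](- n%:R)%R, +oo[%classic)
  (RGenOInfty.measurableE R) _ _ _ m1 m2 _ _ A mA).
- move=> _ _ [s ->] [t ->]; exists (Num.max s t).
  by apply/seteqP; split => u /=; rewrite !in_itv/= !andbT gt_max => /andP.
- by move=> n; exists (- n%:R)%R.
- apply/seteqP; split => // u _.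
  exists (Num.truncn `|u|).+1 => //=; rewrite in_itv/= andbT.
  have := truncnS_gt `|u|%R; have := ler_norm (- u)%R; rewrite normrN => h1 h2.
  by rewrite ltrNl (le_lt_trans h1).
- move=> _ [t ->].
  have ray (m : probability R R) : m `]t, +oo[%classic = 1 - m [set u | u <= t]%R.
    have mt : measurable ([set u | u <= t]%R : set R).
      by rewrite -[X in measurable X]setTI; exact: measurable_fun_le.
    apply: (etrans _ (probability_setC m mt)); congr (m _).
    by apply/seteqP; split => u /=; rewrite in_itv/= andbT ltNge => /negP.
  apply: (etrans (ray m1)); apply: (etrans _ (esym (ray m2))); congr (_ - _).
  transitivity ((cdf P t)%:E); last first.
    by rewrite cdf_alongE.
  have /andP[F0 F1] := cdf_along01 iotaP P t.
  rewrite -[RHS]lambda_uniform ?F0//.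
  transitivity (lambda [set u | quantile iota P u <= t]%R) => //.
  have mq : measurable [set u | quantile iota P u <= t]%R.
    rewrite -[X in measurable X]setTI; apply: measurable_fun_le => //.
    exact: measurable_quantile.
  apply: ae_eq_measure => //.
    by rewrite -[X in measurable X]setTI; exact: measurable_fun_le.
  have [N [mN N0 sN]] := uniform_support lambda_uniform.
  exists N; split => // u /= hu; apply: sN => u01; apply: hu.
  by rewrite quantile_le.
- by move=> n; rewrite (le_lt_trans (probability_le1 _ _))// ltry.
Qed.

Let quantile_layer (P P' : probability (borel X) R) (t : R) :
  lambda [set u | quantile iota P u <= t < quantile iota P' u]%R =
  (Num.max 0 (cdf P t - cdf P' t))%:E.
Proof.
have /andP[F0 F1] := cdf_along01 iotaP P t.
have /andP[F'0 F'1] := cdf_along01 iotaP P' t.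
have mle s : measurable ([set u | u <= s]%R : set R).
  by rewrite -[X in measurable X]setTI; exact: measurable_fun_le.
have mitv (a b : R) : measurable ([set u | a < u <= b]%R : set R).
  by rewrite (_ : mkset _ = `]a, b]%classic).
transitivity (lambda [set u | cdf P' t < u <= cdf P t]%R).
  apply: ae_eq_measure => //.
    have mq (Q : probability (borel X) R) := measurable_quantile X_bounded iotaP Q.
    rewrite (_ : [set u | _] = [set u | quantile iota P u <= t]%R `&`
        ~` [set u | quantile iota P' u <= t]%R); last first.
      by apply/seteqP; split => u /=; rewrite ltNge; [case/andP => -> /negP|case=> -> /negP].
    apply: measurableI; last apply: measurableC;
    by rewrite -[X in measurable X]setTI; apply: measurable_fun_le.
  have [N [mN N0 sN]] := uniform_support lambda_uniform.
  exists N; split => // u /= hu; apply: sN => u01; apply: hu.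
  by rewrite ltNge !(quantile_le X_bounded iotaP)// -ltNge andbC.
have [F'F|FF'] := leP (cdf P' t) (cdf P t).
  by rewrite (uniform_itv lambda_uniform)// max_r// subr_ge0.
rewrite max_l ?subr_le0 ?(ltW FF')//.
rewrite (_ : mkset _ = set0) ?measure0//; apply/seteqP; split => // u /= /andP[Fu uF].
by have := lt_le_trans Fu uF; rewrite ltNge (ltW FF').
Qed.

(** The monotone coupling transports the quantiles of one law to those of the
    other; the layers of its cost are the gaps between the two distribution
    functions. *)
Lemma Wasserstein_le_cdf (P P' : probability (borel X) R) :
  Wasserstein P P' <= \int[@lebesgue_measure R]_t `|cdf P t - cdf P' t|%:E.
Proof.
pose k (Q : probability (borel X) R) (u : R) : borel X := isometry_inv (quantile iota Q u).
have mq Q := measurable_quantile X_bounded iotaP Q.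
have mk Q : measurable_fun setT (k Q) by exact: (measurableT_comp measurable_isometry_inv (mq Q)).
have k_law Q A : measurable A -> lambda [set u | A (k Q u)] = Q A.
  move=> mA; have mA' : measurable (isometry_inv @^-1` A).
    by rewrite -[X in measurable X]setTI; exact: measurable_isometry_inv.
  apply: (etrans (quantile_law Q mA')); congr (Q _).
  by apply/seteqP; split => x /=; rewrite isometryK.
have mK : measurable_fun setT (fun u => (k P u, k P' u)) by exact: measurable_fun_pair.
pose g : probability (borel X * borel X)%type R := distribution lambda (to_mfun mK).
have gP : coupling P P' g by split => A mA; exact: k_law.
apply: (@le_trans _ _ (\int[g]_z (mdist (z.1 : X) (z.2 : X))%:E)).
  by apply: ereal_inf_lbound; exists g.
have mabs (f h : R -> R) : measurable_fun setT f -> measurable_fun setT h ->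
    measurable_fun setT (fun u => `|f u - h u|%:E).
  move=> mf mh; apply/measurable_EFinP; exact: (measurableT_comp (@normr_measurable R setT) (measurable_funB mf mh)).
have miota Q : measurable_fun setT (fun u => iota (k Q u)).
  exact: (measurableT_comp (measurable_isometry iotaP) (mk Q)).
have kE Q : {ae lambda, forall u, iota (k Q u) = quantile iota Q u}.
  have mr : measurable [set u | range iota (quantile iota Q u)].
    by rewrite -[X in measurable X]setTI; exact: mq.
  exists (~` [set u | range iota (quantile iota Q u)]); split; first exact: measurableC.
    apply: (etrans (probability_setC lambda mr)).
    rewrite [X in 1 - X](quantile_law Q range_measurable).
    rewrite (_ : _ @^-1` _ = setT); last by apply/seteqP; split => x //= _; exists x.
    by rewrite [X in 1 - X]probability_setT subee.
  by move=> u /= hu hr; apply: hu; exact: isometry_invK.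
have -> : \int[g]_z (mdist (z.1 : X) (z.2 : X))%:E =
    \int[lambda]_u `|quantile iota P u - quantile iota P' u|%:E.
  transitivity (\int[lambda]_u `|iota (k P u) - iota (k P' u)|%:E).
    apply: esym; under eq_integral do rewrite -iotaP.
    apply: (@ge0_integral_comp _ _ _ _ R lambda _ mK (fun z => (mdist (z.1 : X) (z.2 : X))%:E)).
      by move=> z; rewrite lee_fin mdist_ge0.
    apply/measurable_EFinP.
    rewrite (_ : (fun z => _) = fun z : borel X * borel X => `|iota z.1 - iota z.2|%R).
      apply: (measurableT_comp (@normr_measurable R setT)); apply: measurable_funB.
        exact: (measurableT_comp (measurable_isometry iotaP) measurable_fst).
      exact: (measurableT_comp (measurable_isometry iotaP) measurable_snd).
    by apply/funext => z; exact: iotaP.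
  apply: ge0_ae_eq_integral => //.
  - exact: mabs.
  - exact: mabs.
  have [N [mN N0 sN]] := kE P; have [N' [mN' N'0 sN']] := kE P'.
  exists (N `|` N'); split; [exact: measurableU|exact: null_set_setU|].
  move=> u hu; case: (pselect (iota (k P u) = quantile iota P u)) => h; last first.
    by left; exact: sN.
  right; apply: sN' => /= h'; apply: hu => _.
  by rewrite h h'.
rewrite integral_dist_layers//; apply: ge0_le_lower_integral => t.
  by rewrite adde_ge0.
rewrite [X in X + _](quantile_layer P P') [X in _ + X](quantile_layer P' P).
rewrite -EFinD lee_fin.
have [h|h] := leP (cdf P t) (cdf P' t).
  by rewrite ler0_norm ?subr_le0// max_l ?subr_le0// max_r ?subr_ge0// opprB add0r.
rewrite ger0_norm ?subr_ge0 ?(ltW h)// max_r ?subr_ge0 ?(ltW h)//.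
by rewrite max_l ?subr_le0 ?(ltW h)// addr0.
Qed.

End quantile_coupling.
End isometric_line.


(** * Fluctuations of an empirical measure *)

(** By the inequality [2 * `|f| <= f ^+ 2 / m + m], used for the best [m]. *)
Lemma integral_abs_le_sqrt d (T : measurableType d) (R : realType)
    (P : probability T R) (f : T -> R) (v : R) :
  measurable_fun setT f -> \int[P]_x ((f x) ^+ 2)%:E = v%:E ->
  \int[P]_x `|f x|%:E <= (Num.sqrt v)%:E.
Proof.
move=> mf fv.
have v0 : (0 <= v)%R.
  by rewrite -lee_fin -fv; apply: integral_ge0 => x _; rewrite lee_fin sqr_ge0.
have mf2 : measurable_fun setT (fun x => ((f x) ^+ 2)%:E).
  by apply/measurable_EFinP; exact: measurable_funX.
have bound (m : R) : (0 < m)%R -> \int[P]_x `|f x|%:E <= ((2 * m)^-1 * v + m / 2)%:E.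
  move=> m0; have m20 : (0 <= (2 * m)^-1)%R by rewrite invr_ge0 mulr_ge0// ltW.
  rewrite EFinD EFinM -fv -(probability_integral_cst P (m / 2)%:E).
  rewrite -ge0_integralZl//; last by move=> x _; rewrite lee_fin sqr_ge0.
  rewrite -ge0_integralD//; last 3 first.
  - by move=> x _; rewrite lee_fin mulr_ge0// sqr_ge0.
  - by apply: emeasurable_funM.
  - by move=> x _; rewrite lee_fin divr_ge0// ltW.
  apply: ge0_le_lower_integral => x; rewrite ?lee_fin//.
  have -> : ((2 * m)^-1 * f x ^+ 2 + m / 2 = `|f x| + (2 * m)^-1 * (`|f x| - m) ^+ 2)%R.
    rewrite -(real_normK (num_real (f x))); field.
    by rewrite gt_eqF.
  by rewrite lerDl mulr_ge0// sqr_ge0.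
have [v_gt0|] := ltP 0%R v.
  have sv : (0 < Num.sqrt v)%R by rewrite sqrtr_gt0.
  apply: (le_trans (bound _ sv)); rewrite lee_fin -{2}(sqr_sqrtr v0).
  rewrite le_eqVlt; apply/orP; left; apply/eqP; field.
  by rewrite gt_eqF.
move=> v_le0; have -> : v = 0%R by apply/eqP; rewrite eq_le v_le0.
rewrite sqrtr0; apply/lee_addgt0Pr => e e0; rewrite add0e.
apply: (le_trans (bound _ e0)); rewrite lee_fin.
have -> : v = 0%R by apply/eqP; rewrite eq_le v_le0.
by rewrite mulr0 add0r; move: e0; clear; lra.
Qed.

Section sample.
Context (R : realType) (X : completeMetricType R).
Hypothesis X_separable : separable_space X.
Context d (Omega : measurableType d) (Pr : probability Omega R) (N : nat).
Variables (Pt : {RV Pr >-> Pspace R X}) (Y_ : 'I_N -> {RV Pr >-> borel X}).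
Hypothesis N_gt0 : (0 < N)%N.
Hypothesis hY : conditionally_iid Pt Y_.
Variable A : set (borel X).
Hypothesis mA : measurable A.

Let p (w : Omega) : R := fine (as_probability (Pt w) A).
Let ind i (w : Omega) : R := \1_A (Y_ i w).

Let pE w : (p w)%:E = as_probability (Pt w) A.
Proof. by rewrite /p fineK// fin_num_measure. Qed.

Let p01 w : (0 <= p w <= 1)%R.
Proof. by rewrite -!lee_fin pE measure_ge0 probability_le1. Qed.

Let mp : measurable_fun setT p.
Proof.
apply: (measurableT_comp (f := fine)); first exact: fine_measurable.
exact: (measurableT_comp (measurable_evaluation X_separable mA)).
Qed.

Let mind i : measurable_fun setT (ind i).
Proof. exact: (measurableT_comp (measurable_indic mA)). Qed.

Let mY i : measurable (Y_ i @^-1` A).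
Proof. by rewrite -[X in measurable X]setTI; exact: measurable_funP. Qed.

Let mPt B : measurable B -> measurable (Pt @^-1` B).
Proof. by move=> mB; rewrite -[X in measurable X]setTI; exact: measurable_funP. Qed.

(* The event that the members of the sample of index in [J] lie in [A]. *)
Let sample_event (J : {set 'I_N}) (B : set (Pspace R X)) : measurable B ->
  Pr (Pt @^-1` B `&` \bigcap_(i in [set` J]) (Y_ i @^-1` A)) =
  \int[Pr]_(w in Pt @^-1` B) ((p w) ^+ #|J|)%:E.
Proof.
move=> mB; have mJ i : measurable (if i \in J then A else setT) by case: ifP.
have := hY mB mJ.
rewrite (_ : \bigcap_i _ = \bigcap_(i in [set` J]) (Y_ i @^-1` A)); last first.
  apply/seteqP; split => w /= h i.
    by move=> iJ; have := h i I; rewrite iJ.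
  by move=> _; case: ifP => // iJ; exact: h.
move=> ->; apply: eq_integral => w _.
rewrite (eq_bigr (fun i => if i \in J then (p w)%:E else 1)); last first.
  by move=> i _; case: ifP => _; [rewrite pE|exact: probability_setT].
rewrite -big_mkcond/= prodEFin; congr EFin.
by rewrite prodr_const.
Qed.

Let integral_ind i : \int[Pr]_w (ind i w)%:E = \int[Pr]_w (p w)%:E.
Proof.
have := @sample_event [set i]%SET setT measurableT.
rewrite preimage_setT setTI cards1 => <-.
rewrite (_ : \bigcap_(j in _) _ = Y_ i @^-1` A); last first.
  rewrite (_ : [set` _] = [set i]) ?bigcap_set1//.
  by apply/seteqP; split => j /=; rewrite inE => /eqP.
by rewrite -measure_integral_indic//; apply: eq_integral => w _.
Qed.

Let integral_ind2 i j : i != j ->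
  \int[Pr]_w (ind i w * ind j w)%:E = \int[Pr]_w ((p w) ^+ 2)%:E.
Proof.
move=> ij; have := @sample_event [set i; j]%SET setT measurableT.
rewrite preimage_setT setTI cards2 ij => <-.
rewrite (_ : \bigcap_(k in _) _ = Y_ i @^-1` A `&` Y_ j @^-1` A); last first.
  apply/seteqP; split => w /=.
    by move=> h; split; apply: h; rewrite /= !inE eqxx ?orbT.
  by move=> [hi hj] k; rewrite /= !inE => /orP[] /eqP ->.
rewrite -measure_integral_indic; last exact: measurableI.
by apply: eq_integral => w _; rewrite /ind indicI.
Qed.

(* The conditional probability of the event [Y_ i \in A] given [Pt] is [Pt A],
   because both have the same integral over each event defined by [Pt]. *)
Let integral_p_ind i : \int[Pr]_w (p w * ind i w)%:E = \int[Pr]_w ((p w) ^+ 2)%:E.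
Proof.
pose M : probability (Pspace R X) R := distribution Pr Pt.
have mPY : measurable_fun setT (fun w => (Pt w, Y_ i w)) by exact: measurable_fun_pair.
pose g : probability (Pspace R X * borel X)%type R := distribution Pr (to_mfun mPY).
pose q (P : Pspace R X) : \bar R := as_probability P A.
have mq : measurable_fun setT q := measurable_evaluation X_separable mA.
have q0 P : 0 <= q P by [].
pose D : set (Pspace R X * borel X) := snd @^-1` A.
have mD : measurable D by rewrite -[X in measurable X]setTI; exact: measurable_snd.
have gM B : measurable B -> g (fst @^-1` B) = M B by [].
have [r [mr r0 rE]] := conditional_density gM mD.
have qr : ae_eq M setT q (fun P => (r P)%:E).
  apply: integral_ae_eq => //.
  - apply/integrableP; split => //; apply: (@le_lt_trans _ _ (\int[M]_P 1)).
      apply: ge0_le_lower_integral => P; first exact: abse_ge0.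
      by rewrite gee0_abs//; exact: probability_le1.
    by rewrite probability_integral_cst ltry.
  - exact/measurable_EFinP.
  - move=> B _ mB.
    transitivity (Pr (Pt @^-1` B `&` Y_ i @^-1` A)).
      have := @sample_event [set i]%SET B mB; rewrite cards1.
      rewrite (_ : \bigcap_(j in _) _ = Y_ i @^-1` A); last first.
        rewrite (_ : [set` _] = [set i]) ?bigcap_set1//.
        by apply/seteqP; split => j /=; rewrite inE => /eqP.
      move=> ->; rewrite ge0_integral_pushforward//; last exact: measurable_funTS.
      by apply: eq_integral => w _; rewrite expr1 pE.
    have mB1 : measurable_fun setT (fun P => (\1_B P)%:E : \bar R).
      by apply/measurable_EFinP; exact: measurable_indic.
    have B0 P : 0 <= (\1_B P)%:E :> \bar R by rewrite lee_fin.
    have rB := rE _ mB1 B0.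
    rewrite [RHS]integral_mkcond epatch_indic.
    under [RHS]eq_integral do rewrite muleC.
    rewrite rB [RHS]integral_mkcond epatch_indic.
    have mfB : measurable (fst @^-1` B : set (Pspace R X * borel X)).
      by rewrite -[X in measurable X]setTI; exact: measurable_fst.
    rewrite -[LHS]/(g (fst @^-1` B `&` D)) -measure_integral_indic; last exact: measurableI.
    by apply: eq_integral => z _; rewrite indicI -EFinM.
transitivity (\int[M]_P (q P * q P)); last first.
  have mqq : measurable_fun setT (fun P => q P * q P) by exact: emeasurable_funM.
  have qq0 P : 0 <= q P * q P by rewrite mule_ge0.
  apply: (etrans (@ge0_integral_distribution _ _ _ _ _ Pr Pt _ mqq qq0)).
  by apply: eq_integral => w _; rewrite /= /q -pE.
transitivity (\int[M]_P (q P * (r P)%:E)); last first.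
  apply: ge0_ae_eq_integral => //.
  - by apply: emeasurable_funM => //; exact/measurable_EFinP.
  - exact: emeasurable_funM.
  - by move=> P _; rewrite mule_ge0// lee_fin.
  - by move=> P _; rewrite mule_ge0.
  have [N0 [mN0 N00 sN0]] := qr; exists N0; split => // P hP; apply: sN0 => /= h.
  by apply: hP => _; rewrite h.
rewrite rE// [RHS]integral_mkcond epatch_indic.
pose h z := q z.1 * (\1_D z)%:E.
have mh : measurable_fun setT h.
  apply: emeasurable_funM; first exact: (measurableT_comp mq measurable_fst).
  by apply/measurable_EFinP; exact: measurable_indic.
have h0 z : 0 <= h z by rewrite mule_ge0// lee_fin.
apply: esym.
apply: (etrans (@ge0_integral_distribution _ _ _ _ _ Pr (to_mfun mPY) _ mh h0)).
by apply: eq_integral => w _; rewrite /h /= EFinM pE.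
Qed.

Local Notation Nr := (N%:R : R).

Let freq (w : Omega) : R := (Nr^-1 * \sum_i ind i w)%R.

Let empirical_freq w : empirical R [tuple Y_ i w | i < N] A = (freq w)%:E.
Proof.
rewrite empiricalE// /freq EFinM sumEFin; congr (_ * _%:E).
by apply: eq_bigr => i _; rewrite tnth_mktuple.
Qed.

Let mfreq : measurable_fun setT freq.
Proof. by apply: measurable_funM => //; exact: measurable_sum. Qed.

(* The square is expanded: conditionally on [Pt], the indicators of two different
   members of the sample are independent with mean [p]. *)
Let freq_fluctuation (v : R) :
  \int[Pr]_w (p w * (1 - p w))%:E = v%:E ->
  \int[Pr]_w `|freq w - p w|%:E <= (Num.sqrt (v / N%:R))%:E.
Proof.
move=> vE; apply: integral_abs_le_sqrt; first exact: measurable_funB.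
have N0 : (0 < Nr)%R by rewrite ltr0n.
have fin01 (f : Omega -> R) : (forall w, 0 <= f w <= 1)%R ->
    \int[Pr]_w (f w)%:E \is a fin_num.
  move=> f01; rewrite ge0_fin_numE.
    apply: (@le_lt_trans _ _ (\int[Pr]_w 1)); last by rewrite probability_integral_cst ltry.
    by apply: ge0_le_lower_integral => w; rewrite lee_fin; case/andP: (f01 w).
  by apply: integral_ge0 => w _; rewrite lee_fin; case/andP: (f01 w).
have p0 w : (0 <= p w)%R by case/andP: (p01 w).
have p1 w : (p w <= 1)%R by case/andP: (p01 w).
have i0 i w : (0 <= ind i w)%R by rewrite /ind indicE.
have [m1 m1E] : exists m1, \int[Pr]_w (p w)%:E = m1%:E.
  by exists (fine (\int[Pr]_w (p w)%:E)); rewrite fineK// fin01.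
have [m2 m2E] : exists m2, \int[Pr]_w ((p w) ^+ 2)%:E = m2%:E.
  exists (fine (\int[Pr]_w ((p w) ^+ 2)%:E)); rewrite fineK// fin01// => w.
  by rewrite exprn_ge0// exprn_ile1.
have vm : (v = m1 - m2)%R.
  apply/eqP; rewrite eq_sym subr_eq eq_sym; apply/eqP/EFin_inj.
  rewrite EFinD -vE -m1E -m2E -ge0_integralD//.
  - apply: eq_integral => w _; rewrite -EFinD; congr EFin; ring.
  - by move=> w _; rewrite lee_fin mulr_ge0// subr_ge0.
  - apply/measurable_EFinP; apply: measurable_funM => //; exact: measurable_funB.
  - by move=> w _; rewrite lee_fin exprn_ge0.
  - by apply/measurable_EFinP; exact: measurable_funX.
have int_sum (F : 'I_N -> Omega -> R) (c : 'I_N -> R) :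
    (forall i, measurable_fun setT (F i)) -> (forall i w, 0 <= F i w)%R ->
    (forall i, \int[Pr]_w (F i w)%:E = (c i)%:E) ->
    \int[Pr]_w (\sum_i F i w)%:E = (\sum_i c i)%:E.
  move=> mF F0 Fc; under eq_integral do rewrite -sumEFin.
  rewrite ge0_integral_sum//.
  - by under eq_bigr do rewrite Fc; rewrite sumEFin.
  - by move=> i; exact/measurable_EFinP.
  - by move=> i w _; rewrite lee_fin.
have int_scale (k : R) (F : Omega -> R) (c : R) : (0 <= k)%R ->
    measurable_fun setT F -> (forall w, 0 <= F w)%R ->
    \int[Pr]_w (F w)%:E = c%:E -> \int[Pr]_w (k * F w)%:E = (k * c)%:E.
  move=> k0 mF F0 Fc; under eq_integral do rewrite EFinM.
  rewrite ge0_integralZl// ?Fc//; last by move=> w _; rewrite lee_fin.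
  exact/measurable_EFinP.
have c1 : \int[Pr]_w (\sum_i (2 / Nr * (p w * ind i w)))%:E = (2 * m2)%:E.
  rewrite (int_sum _ (fun=> 2 / Nr * m2)%R).
  - rewrite sumr_const card_ord; congr EFin; rewrite -mulr_natl; field.
    by rewrite gt_eqF.
  - by move=> i; apply: measurable_funM => //; exact: measurable_funM.
  - by move=> i w; rewrite mulr_ge0// ?divr_ge0 ?ler0n// mulr_ge0.
  - move=> i; apply: int_scale; rewrite ?divr_ge0 ?ler0n//.
    + exact: measurable_funM.
    + by move=> w; rewrite mulr_ge0.
    + by rewrite integral_p_ind.
have c2 : \int[Pr]_w (\sum_i (Nr ^- 2 * \sum_j (ind i w * ind j w)))%:E =
    (Nr^-1 * (m1 + (Nr - 1) * m2))%:E.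
  rewrite (int_sum _ (fun=> Nr ^- 2 * (m1 + (Nr - 1) * m2))%R).
  - rewrite sumr_const card_ord; congr EFin; rewrite -mulr_natl; field.
    by rewrite gt_eqF.
  - move=> i; apply: measurable_funM => //; apply: measurable_sum => j.
    exact: measurable_funM.
  - by move=> i w; rewrite mulr_ge0 ?invr_ge0 ?exprn_ge0 ?ler0n// sumr_ge0// => j _; rewrite mulr_ge0.
  - move=> i; apply: int_scale; rewrite ?invr_ge0 ?exprn_ge0 ?ler0n//.
    + by apply: measurable_sum => j; exact: measurable_funM.
    + by move=> w; rewrite sumr_ge0// => j _; rewrite mulr_ge0.
    rewrite (int_sum _ (fun j => if j == i then m1 else m2)).
    + congr EFin; rewrite (bigD1 i)//= eqxx; congr (_ + _)%R.
      rewrite (eq_bigr (fun=> m2)) => [|j /negbTE ->//].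
      have := sumr_const 'I_N m2; rewrite (bigD1 i)//= card_ord => h.
      by rewrite mulrBl mul1r mulr_natl -h [RHS]addrC addKr.
    + by move=> j; exact: measurable_funM.
    + by move=> j w; rewrite mulr_ge0.
    + move=> j; case: eqVneq => [->|ji]; last by rewrite integral_ind2// eq_sym.
      rewrite -m1E -(integral_ind i); apply: eq_integral => w _; congr EFin.
      by rewrite /ind indicE; case: (_ \in _); rewrite ?mulr1 ?mulr0.
have expand w : ((freq w - p w) ^+ 2 + \sum_i (2 / Nr * (p w * ind i w)) =
    (p w) ^+ 2 + \sum_i (Nr ^- 2 * \sum_j (ind i w * ind j w)))%R.
  under [in RHS]eq_bigr do rewrite -mulr_sumr mulrCA.
  rewrite -[in RHS]mulr_suml -!mulr_sumr /freq; set s := (\sum_i ind i w)%R.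
  field; by rewrite gt_eqF.
have mfp : measurable_fun setT (fun w => ((freq w - p w) ^+ 2)%:E).
  by apply/measurable_EFinP/measurable_funX; exact: measurable_funB.
have total : \int[Pr]_w ((freq w - p w) ^+ 2)%:E + (2 * m2)%:E =
    (m2 + Nr^-1 * (m1 + (Nr - 1) * m2))%:E.
  have s1 w : (0 <= \sum_i (2 / Nr * (p w * ind i w)))%R.
    by rewrite sumr_ge0// => i _; rewrite mulr_ge0 ?divr_ge0 ?ler0n// mulr_ge0.
  have s2 w : (0 <= \sum_i (Nr ^- 2 * \sum_j (ind i w * ind j w)))%R.
    rewrite sumr_ge0// => i _; rewrite mulr_ge0 ?invr_ge0 ?exprn_ge0 ?ler0n//.
    by rewrite sumr_ge0// => j _; rewrite mulr_ge0.
  have ms1 : measurable_fun setT (fun w => (\sum_i (2 / Nr * (p w * ind i w)))%:E).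
    apply/measurable_EFinP; apply: measurable_sum => i.
    by apply: measurable_funM => //; exact: measurable_funM.
  have ms2 : measurable_fun setT
      (fun w => (\sum_i (Nr ^- 2 * \sum_j (ind i w * ind j w)))%:E).
    apply/measurable_EFinP; apply: measurable_sum => i.
    apply: measurable_funM => //; apply: measurable_sum => j.
    exact: measurable_funM.
  have mp2 : measurable_fun setT (fun w => ((p w) ^+ 2)%:E).
    by apply/measurable_EFinP; exact: measurable_funX.
  rewrite EFinD -m2E -c1 -c2 -ge0_integralD//; last 2 first.
  - by move=> w _; rewrite lee_fin sqr_ge0.
  - by move=> w _; rewrite lee_fin.
  rewrite -ge0_integralD//; last 2 first.
  - by move=> w _; rewrite lee_fin sqr_ge0.
  - by move=> w _; rewrite lee_fin.
  by apply: eq_integral => w _; rewrite -!EFinD expand.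
have -> : \int[Pr]_w ((freq w - p w) ^+ 2)%:E =
    (m2 + Nr^-1 * (m1 + (Nr - 1) * m2))%:E - (2 * m2)%:E.
  by rewrite -total addeK.
rewrite -EFinB vm; congr EFin; field.
by rewrite gt_eqF.
Qed.

Lemma sample_fluctuation (v : R) :
  let prob (Q : probability (borel X) R) := fine (Q A) in
  \int[Pr]_w (prob (as_probability (Pt w)) * (1 - prob (as_probability (Pt w))))%:E = v%:E ->
  \int[Pr]_w `|prob (as_probability (Pt w)) - prob (empirical R [tuple Y_ i w | i < N])|%:E
    <= (Num.sqrt (v / N%:R))%:E.
Proof.
move=> prob vE; apply: le_trans (freq_fluctuation vE).
rewrite le_eqVlt; apply/orP; left; apply/eqP; apply: eq_integral => w _.
by rewrite distrC /prob empirical_freq.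
Qed.

End sample.


(** * The variance of a Dirichlet process *)

Section dirichlet_variance.
Context (R : realType) (X : completeMetricType R).
Hypothesis X_separable : separable_space X.
Variables (alpha : R) (P0 : probability (borel X) R) (A : set (borel X)).
Hypothesis alpha_gt0 : (0 < alpha)%R.
Hypothesis mA : measurable A.

Local Notation T := (borel X * R)%type.
Local Notation v := (@stick_of R X).
Local Notation p := (fine (P0 A)).

Section stick_breaking.
Variables (b : probability R R) (mu : probability (seqspace T) R).
Hypothesis bE : forall B, measurable B -> b B = beta_law 1 alpha B.
Hypothesis mu_iid : iid_law mu (P0 \x b).

Let ind (C : set (borel X)) (t : T) : \bar R := (\1_C t.1)%:E.
Let S C (z : nat -> T) : \bar R := stick_sum v (ind C) z.

Let ind0 C t : 0 <= ind C t.
Proof. by rewrite lee_fin. Qed.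

Let mind C : measurable C -> measurable_fun setT (ind C).
Proof.
move=> mC; apply/measurable_EFinP.
exact: (measurableT_comp (measurable_indic mC) measurable_fst).
Qed.

Let S0 C z : 0 <= S C z.
Proof. by apply: stick_sum_ge0; [exact: stick_of01|exact: ind0]. Qed.

Let S1 C z : S C z <= 1.
Proof.
apply: (@stick_sum_le _ R v (@stick_of01 R X) 1%R) => // t.
by rewrite ind0 /ind lee_fin indicE; case: (_ \in _); rewrite ?lexx ?ler01.
Qed.

Let Sfin C z : S C z \is a fin_num.
Proof. by rewrite ge0_fin_numE// (le_lt_trans (S1 C z))// ltry. Qed.

Let mS C : measurable C -> measurable_fun setT (S C : seqspace T -> \bar R).
Proof.
move=> mC; apply: measurable_stick_sum; [exact: measurable_stick_of|exact: stick_of01|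
  exact: ind0|exact: mind].
Qed.

Let integral_S C : measurable C -> \int[mu]_z S C z = P0 C.
Proof.
move=> mC; rewrite -(measure_integral_indic P0 mC).
apply: (integral_stick_sum_atoms alpha_gt0 bE mu_iid (M := 1) (f := fun x => (\1_C x)%:E)) => //.
- by move=> x; rewrite !lee_fin indicE; case: (_ \in _); rewrite lexx ler01.
- by apply/measurable_EFinP; exact: measurable_indic.
Qed.

Let c : \bar R := \int[mu]_z (S A z * S (~` A) z).

(** Isolating the first stick gives an equation for [c], as in the computation of
    the mean: the first atom lies in only one of [A] and its complement. *)
Lemma stick_covariance : c = (alpha / (alpha + 1) * (p * (1 - p)))%:E.
Proof.
have mAC : measurable (~` A) by exact: measurableC.
pose w1 (t : T) : \bar R := (clip t.2 * (1 - clip t.2))%:E.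
pose w2 (t : T) : \bar R := ((1 - clip t.2) ^+ 2)%:E.
pose f (tz : T * seqspace T) : \bar R :=
  w1 tz.1 * (ind A tz.1 * S (~` A) tz.2 + ind (~` A) tz.1 * S A tz.2) +
  w2 tz.1 * (S A tz.2 * S (~` A) tz.2).
have clipw (r : R) : (0 <= clip r)%R /\ (0 <= 1 - clip r)%R.
  by have /andP[? ?] := clip01 r; rewrite subr_ge0.
have w10 t : 0 <= w1 t by rewrite lee_fin mulr_ge0 ?(clipw t.2).1 ?(clipw t.2).2.
have w20 t : 0 <= w2 t by rewrite lee_fin sqr_ge0.
have mclip : measurable_fun setT (@clip R) by exact: measurable_clip.
have mc1 : measurable_fun setT (fun r : R => 1 - clip r)%R by exact: measurable_funB.
have mk1 : measurable_fun setT (fun r : R => (clip r * (1 - clip r))%:E).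
  by apply/measurable_EFinP; exact: measurable_funM.
have mk2 : measurable_fun setT (fun r : R => ((1 - clip r) ^+ 2)%:E).
  by apply/measurable_EFinP; exact: measurable_funX.
have mw1 : measurable_fun setT w1 by exact: (measurableT_comp mk1 measurable_snd).
have mw2 : measurable_fun setT w2 by exact: (measurableT_comp mk2 measurable_snd).
have f0 tz : 0 <= f tz.
  by rewrite adde_ge0// mule_ge0// ?adde_ge0// mule_ge0.
have mS1 C : measurable C -> measurable_fun setT (fun tz : T * seqspace T => S C tz.2).
  by move=> mC; exact: (measurableT_comp (mS mC) measurable_snd).
have mi1 C : measurable C -> measurable_fun setT (fun tz : T * seqspace T => ind C tz.1).
  by move=> mC; exact: (measurableT_comp (mind mC) measurable_fst).
have mf : measurable_fun setT f.
  apply: emeasurable_funD; apply: emeasurable_funM.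
  - exact: (measurableT_comp mw1 measurable_fst).
  - by apply: emeasurable_funD; apply: emeasurable_funM; [exact: mi1|exact: mS1|exact: mi1|exact: mS1].
  - exact: (measurableT_comp mw2 measurable_fst).
  - by apply: emeasurable_funM; exact: mS1.
have SSf z : S A z * S (~` A) z = f (z 0%N, shift z).
  have uncons C : S C z = (v (z 0%N))%:E * ind C (z 0%N) +
      (1 - v (z 0%N))%:E * S C (shift z).
    by apply: stick_sum_uncons; [exact: stick_of01|exact: ind0].
  rewrite (uncons A) (uncons (~` A)) /f/=.
  rewrite -(fineK (Sfin A (shift z))) -(fineK (Sfin (~` A) (shift z))).
  rewrite /ind !indicE in_setC /w1/w2/stick_of.
  rewrite -!(EFinM, EFinD); congr EFin.
  by case: (_ \in A) => /=; ring.
have cE : c = \int[P0 \x b]_t \int[mu]_z f (t, z).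
  rewrite -(iid_law_integral_uncons mu_iid f0 mf).
  by apply: eq_integral => z _; exact: SSf.
have cfin : c \is a fin_num.
  rewrite ge0_fin_numE; last by apply: integral_ge0 => z _; rewrite mule_ge0.
  apply: (@le_lt_trans _ _ (\int[mu]_z 1)); last by rewrite probability_integral_cst ltry.
  apply: ge0_le_lower_integral => z; first by rewrite mule_ge0.
  by rewrite -(mule1 1) lee_pmul.
have inner t : \int[mu]_z f (t, z) =
    w1 t * (ind A t * P0 (~` A) + ind (~` A) t * P0 A) + w2 t * c.
  have wi C : 0 <= ind C t by exact: ind0.
  have mSA := mS mA; have mSAC := mS mAC.
  have mSS : measurable_fun setT (fun z : seqspace T => S A z * S (~` A) z).
    exact: emeasurable_funM.
  rewrite /f ge0_integralD//=; last 4 first.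
  - by move=> z _; rewrite mule_ge0// adde_ge0// mule_ge0.
  - by apply: emeasurable_funM => //; apply: emeasurable_funD; exact: emeasurable_funM.
  - by move=> z _; rewrite mule_ge0// mule_ge0.
  - exact: emeasurable_funM.
  rewrite ge0_integralZl//; last 2 first.
  - by apply: emeasurable_funD; exact: emeasurable_funM.
  - by move=> z _; rewrite adde_ge0// mule_ge0.
  rewrite ge0_integralD//; last 4 first.
  - by move=> z _; rewrite mule_ge0.
  - exact: emeasurable_funM.
  - by move=> z _; rewrite mule_ge0.
  - exact: emeasurable_funM.
  by rewrite !ge0_integralZl// ?(integral_S mA) ?(integral_S mAC)// => z _; rewrite mule_ge0.
have PA : P0 A = p%:E by rewrite fineK// fin_num_measure.
have PAC : P0 (~` A) = (1 - p)%:E.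
  by apply: (etrans (probability_setC P0 mA)); rewrite EFinB -PA.
have p01 : (0 <= p <= 1)%R by rewrite -!lee_fin -PA measure_ge0 probability_le1.
have q0 : (0 <= 1 - p)%R by rewrite subr_ge0; case/andP: p01.
have p0 : (0 <= p)%R by case/andP: p01.
have iprod (k : R -> \bar R) C : measurable_fun setT k -> (forall r, 0 <= k r) ->
    measurable C ->
    \int[P0 \x b]_t (ind C t * k t.2) = P0 C * \int[b]_r k r.
  move=> mk k0 mC; rewrite -(measure_integral_indic P0 mC).
  rewrite -(@integral_prodM _ _ _ _ R P0 b (fun x => (\1_C x)%:E) k)//.
  by apply/measurable_EFinP; exact: measurable_indic.
have cR : c = (fine c)%:E by rewrite fineK.
have step : c = ((alpha / (alpha + 1) - alpha / (alpha + 2)) * (p * (1 - p) * 2) +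
    alpha / (alpha + 2) * fine c)%:E.
  pose nu : probability T R := P0 \x b.
  pose F1 t := w1 t * (ind A t * P0 (~` A) + ind (~` A) t * P0 A).
  pose F2 t := w2 t * c.
  have F10 t : [set: T] t -> 0 <= F1 t by rewrite mule_ge0// adde_ge0// mule_ge0.
  have F20 t : [set: T] t -> 0 <= F2 t.
    by rewrite mule_ge0// integral_ge0// => z _; rewrite mule_ge0.
  have mF1 : measurable_fun setT F1.
    apply: emeasurable_funM => //; apply: emeasurable_funD; apply: emeasurable_funM => //;
    exact: mind.
  have mF2 : measurable_fun setT F2 by exact: emeasurable_funM.
  transitivity (\int[nu]_t (F1 t + F2 t)).
    by rewrite [LHS]cE; apply: eq_integral => t _; rewrite inner.
  rewrite (ge0_integralD nu measurableT F10 mF1 F20 mF2) EFinD; congr (_ + _).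
    pose G C t : \bar R := ind C t * (clip t.2 * (1 - clip t.2))%:E.
    have G0 C t : [set: T] t -> 0 <= G C t.
      by rewrite mule_ge0// lee_fin mulr_ge0 ?(clipw t.2).1 ?(clipw t.2).2.
    have mG C : measurable C -> measurable_fun setT (G C).
      by move=> mC; apply: emeasurable_funM; [exact: mind|exact: mw1].
    have GE C : measurable C -> \int[nu]_t G C t =
        P0 C * (alpha / (alpha + 1) - alpha / (alpha + 2))%:E.
      move=> mC; rewrite -(beta_mean_mul_onem alpha_gt0 bE).
      apply: (iprod (fun r => (clip r * (1 - clip r))%:E)) => // r.
      by rewrite lee_fin mulr_ge0 ?(clipw r).1 ?(clipw r).2.
    transitivity (\int[nu]_t (G A t * (1 - p)%:E + G (~` A) t * p%:E)).
      apply: eq_integral => t _; rewrite /F1 /G /w1 /ind PA PAC -!(EFinM, EFinD).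
      by congr EFin; ring.
    have mGZ C (r : R) : measurable C -> measurable_fun setT (fun t => G C t * r%:E).
      by move=> mC; apply: emeasurable_funM => //; exact: mG.
    have G0Z C (r : R) t : (0 <= r)%R -> [set: T] t -> 0 <= G C t * r%:E.
      by move=> r0 Tt; apply: mule_ge0; [exact: G0|rewrite lee_fin].
    rewrite (ge0_integralD nu measurableT (fun t => G0Z A _ t q0) (mGZ A _ mA)
      (fun t => G0Z (~` A) _ t p0) (mGZ (~` A) _ mAC)).
    have GZ C (r : R) : (0 <= r)%R -> measurable C ->
        \int[nu]_t (G C t * r%:E) = P0 C * (alpha / (alpha + 1) - alpha / (alpha + 2))%:E * r%:E.
      move=> r0 mC; rewrite -(GE C mC).
      exact: (ge0_integralZr nu measurableT (mG C mC) (G0 C) _).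
    rewrite (GZ A _ q0 mA) (GZ _ _ p0 mAC) PA PAC -!(EFinM, EFinD).
    by congr EFin; ring.
  have w2E : \int[nu]_t w2 t = (alpha / (alpha + 2))%:E.
    rewrite -(beta_mean_onem2 alpha_gt0 bE).
    have := iprod (fun r => ((1 - clip r) ^+ 2)%:E) setT mk2 _ measurableT.
    rewrite [P0 _]probability_setT mul1e => <- => [|r]; last by rewrite lee_fin sqr_ge0.
    by apply: eq_integral => t _; rewrite /ind indicE in_setT mul1e.
  rewrite EFinM -cR -w2E.
  apply: (ge0_integralZr nu measurableT mw2) => //.
  by rewrite integral_ge0// => z _; rewrite mule_ge0.
rewrite cR; congr EFin.
have fcE : fine c = ((alpha / (alpha + 1) - alpha / (alpha + 2)) * (p * (1 - p) * 2) +
    alpha / (alpha + 2) * fine c)%R by rewrite {1}step.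
have a1 : (alpha + 1 != 0)%R by rewrite gt_eqF// addr_gt0.
have a2 : (alpha + 2 != 0)%R by rewrite gt_eqF// addr_gt0.
have e2 : (2 / (alpha + 2) * fine c =
    2 / (alpha + 2) * (alpha / (alpha + 1) * (p * (1 - p))))%R.
  have -> : (2 / (alpha + 2) * fine c = fine c - alpha / (alpha + 2) * fine c)%R.
    by field.
  by rewrite [X in (X - _)%R]fcE addrK; field; rewrite a1 a2.
apply: mulfI e2.
by rewrite mulf_neq0 ?invr_eq0// pnatr_eq0.
Qed.

Lemma integral_stick_prob_variance :
  \int[mu]_z (fine (stick_prob v fst z A) * (1 - fine (stick_prob v fst z A)))%:E =
  (alpha / (alpha + 1) * (p * (1 - p)))%:E.
Proof.
have mAC : measurable (~` A) by exact: measurableC.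
have msp B (mB : measurable B) := measurable_stick_prob (@measurable_stick_of R X)
  (@stick_of01 R X) (@measurable_fst _ _ (borel X) R) mB.
have mfine : measurable_fun setT (fun z : seqspace T => fine (stick_prob v fst z A)).
  apply: (measurableT_comp (f := fine)); first exact: fine_measurable.
  exact: msp.
rewrite -stick_covariance; apply: ge0_ae_eq_integral => //.
- apply/measurable_EFinP; apply: measurable_funM => //; exact: measurable_funB.
- by apply: emeasurable_funM; exact: mS.
- move=> z _; rewrite lee_fin mulr_ge0 ?fine_ge0// subr_ge0.
  by rewrite -lee_fin fineK ?probability_le1// fin_num_measure.
- by move=> z _; rewrite mule_ge0.
have [N [mN N0 sN]] := mass_ae alpha_gt0 bE mu_iid.
exists N; split => // z hz; apply: sN => /= z1; apply: hz => _.
have SE C : stick_prob v fst z C = S C z by apply: (stick_probE (@stick_of01 R X)).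
have SAC : S (~` A) z = 1 - S A z.
  rewrite -!SE; exact: (probability_setC (stick_prob v fst z) mA).
rewrite SAC SE EFinM EFinB fineK//.
Qed.

End stick_breaking.

Lemma dirichlet_variance d (Omega : measurableType d) (Pr : probability Omega R)
    (Pt : {RV Pr >-> Pspace R X}) :
  dirichlet_process alpha P0 (distribution Pr Pt) ->
  let prob (Q : probability (borel X) R) := fine (Q A) in
  \int[Pr]_w (prob (as_probability (Pt w)) * (1 - prob (as_probability (Pt w))))%:E =
  (alpha / (alpha + 1) * (p * (1 - p)))%:E.
Proof.
move=> /(dirichlet_process_data X_separable)[b [mu [bE mu_iid QE]]] prob.
rewrite -(integral_stick_prob_variance bE mu_iid).
have msp := measurable_stick_prob_Pspace X_separable (@stick_of01 R X)
  (@measurable_stick_of R X) (@measurable_fst _ _ (borel X) R).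
pose h (q : Pspace R X) : \bar R :=
  (prob (as_probability q) * (1 - prob (as_probability q)))%:E.
have h0 q : 0 <= h q.
  rewrite lee_fin mulr_ge0 ?fine_ge0// subr_ge0.
  by rewrite -lee_fin fineK ?probability_le1// fin_num_measure.
have mprob : measurable_fun setT (fun q : Pspace R X => prob (as_probability q)).
  apply: (measurableT_comp (f := fine)); first exact: fine_measurable.
  exact: measurable_evaluation.
have mh : measurable_fun setT h.
  by apply/measurable_EFinP; apply: measurable_funM => //; exact: measurable_funB.
rewrite -[LHS]/(\int[Pr]_w h (Pt w)) -[RHS]/(\int[mu]_z h (stick_prob v fst z)).
rewrite (ge0_integral_comp mu msp h0 mh).
rewrite -(@ge0_integral_distribution _ _ _ _ _ Pr Pt _ mh h0).
by apply: eq_measure_integral => B mB _; exact: QE.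
Qed.

End dirichlet_variance.


(** * Expected distances on the real line *)

(** An i.i.d. sample is a sample from a constant random probability, so that the
    bounds on fluctuations apply to it. *)
Lemma conditionally_iid_cst (R : realType) (X : completeMetricType R)
    (P0 : probability (borel X) R) d (Omega : measurableType d)
    (Pr : probability Omega R) (N : nat) (X_ : 'I_N -> {RV Pr >-> borel X}) :
  (forall B, (forall i, measurable (B i)) ->
    Pr (rv_tuple X_ @^-1` rectangle B) = \prod_(i < N) P0 (B i)) ->
  conditionally_iid
    (to_mfun (@measurable_cst _ _ Omega (Pspace R X) setT P0) : {RV Pr >-> Pspace R X}) X_.
Proof.
move=> Xrect C B mC mB; rewrite -rv_tuple_rectangle.
rewrite -[X in X `&` _]/((cst (P0 : Pspace R X) : Omega -> Pspace R X) @^-1` C).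
rewrite -[X in \int[Pr]_(w in X) _]/((cst (P0 : Pspace R X) : Omega -> Pspace R X) @^-1` C).
rewrite preimage_cst; case: ifP => _.
  rewrite setTI Xrect//.
  exact: (esym (probability_integral_cst Pr (\prod_(i < N) P0 (B i)))).
by rewrite set0I measure0 integral_set0.
Qed.

Lemma iid_pair_integral (R : realType) (X : completeMetricType R)
    (X_separable : separable_space X) (P0 : probability (borel X) R)
    d (Omega : measurableType d) (Pr : probability Omega R)
    (X_ : nat -> {RV Pr >-> borel X}) :
  iid X_ P0 ->
  'E_Pr[fun w => mdist (X_ 0%N w : X) (X_ 1%N w : X)] =
  \int[P0]_x \int[P0]_y (mdist (y : X) (x : X))%:E.
Proof.
move=> hX; rewrite unlock.
have mXX : measurable_fun setT (fun w => (X_ 1%N w, X_ 0%N w)) by exact: measurable_fun_pair.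
pose f (z : borel X * borel X) : \bar R := (mdist (z.2 : X) (z.1 : X))%:E.
have f0 z : 0 <= f z by rewrite lee_fin mdist_ge0.
have mf : measurable_fun setT f.
  by apply/measurable_EFinP; exact: measurable_fun_mdist.
rewrite -[LHS]/(\int[Pr]_w f (X_ 1%N w, X_ 0%N w)) (ge0_integral_comp Pr mXX f0 mf).
transitivity (\int[P0 \x P0]_z f z); last exact: fubini_tonelli1.
apply: eq_measure_integral => C mC _.
apply: (rectangle_measure_unique (m1 := distribution Pr (to_mfun mXX))) => //.
  by rewrite (le_lt_trans (probability_le1 _ _))// ltry.
move=> A B mA mB; apply: (etrans _ (esym (product_measure1E P0 P0 mA mB))).
pose D (i : 'I_2) := if val i == 0%N then B else A.
have mD i : measurable (D i) by rewrite /D; case: ifP.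
have := iid_rectangle val_inj hX mD.
rewrite rv_tuple_rectangle !big_ord_recl big_ord0 mule1 /D/= muleC => <-.
congr (Pr _); apply/seteqP; split => w /=.
  by move=> [hA hB] [[|[|//]] i2] _ /=.
by move=> h; split; [exact: (h (@Ordinal 2 1 isT))|exact: (h (@Ordinal 2 0 isT))].
Qed.

Section real_line.
Context (R : realType) (X : completeMetricType R).
Hypothesis X_separable : separable_space X.
Hypothesis X_bounded : finite_diameter X.
Variable iota : X -> R.
Hypothesis iotaP : real_isometry iota.

Local Notation cdf := (cdf_along iota).
Local Notation leb := (@lebesgue_measure R).

Lemma measurable_cdf_along (P : probability (borel X) R) : measurable_fun setT (cdf P).
Proof.
have := measurable_cdf_along_joint iotaP X_separable
  (@measurable_cst _ _ unit (Pspace R X) setT P).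
by move=> /measurableT_comp /(_ (pair1_measurable tt)).
Qed.

(** For independent [x] and [y] of law [P0], each of the two layers of
    [integral_dist_layers] at level [t] has probability
    [cdf P0 t * (1 - cdf P0 t)]. *)
Lemma integral_dist_cdf (P0 : probability (borel X) R) :
  \int[P0]_x \int[P0]_y (mdist (y : X) (x : X))%:E =
  2%:E * \int[leb]_t (cdf P0 t * (1 - cdf P0 t))%:E.
Proof.
have miota := measurable_isometry iotaP.
have mi1 : measurable_fun setT (fun z : borel X * borel X => iota z.1).
  exact: (measurableT_comp miota measurable_fst).
have mi2 : measurable_fun setT (fun z : borel X * borel X => iota z.2).
  exact: (measurableT_comp miota measurable_snd).
pose f (z : borel X * borel X) : \bar R := (mdist (z.2 : X) (z.1 : X))%:E.
have f0 z : 0 <= f z by rewrite lee_fin mdist_ge0.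
have mf : measurable_fun setT f.
  by apply/measurable_EFinP; exact: measurable_fun_mdist.
transitivity (\int[P0 \x P0]_z f z).
  exact: (esym (@fubini_tonelli1 _ _ _ _ R P0 P0 _ mf f0)).
transitivity (\int[P0 \x P0]_z `|iota z.2 - iota z.1|%:E).
  by apply: eq_integral => z _; rewrite /f iotaP.
rewrite (integral_dist_layers _ mi2 mi1).
have mray t : measurable (iota @^-1` `]-oo, t] : set (borel X)).
  by rewrite -[X in measurable X]setTI; exact: miota.
have rayC t : P0 (~` (iota @^-1` `]-oo, t])) = (1 - cdf P0 t)%:E.
  by apply: (etrans (probability_setC P0 (mray t))); rewrite EFinB cdf_alongE.
have cdf01 t := cdf_along01 iotaP P0 t.
transitivity (\int[leb]_t (2%:E * (cdf P0 t * (1 - cdf P0 t))%:E)); last first.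
  apply: ge0_integralZl => //.
  - apply/measurable_EFinP; apply: measurable_funM; first exact: measurable_cdf_along.
    by apply: measurable_funB => //; exact: measurable_cdf_along.
  - by move=> t _; have /andP[? ?] := cdf01 t; rewrite lee_fin mulr_ge0// subr_ge0.
apply: eq_integral => t _.
have E1 : (P0 \x P0) [set z | iota z.2 <= t < iota z.1]%R =
    (cdf P0 t * (1 - cdf P0 t))%:E.
  rewrite (_ : [set z | _] = (~` (iota @^-1` `]-oo, t])) `*` (iota @^-1` `]-oo, t])).
    apply: (etrans (product_measure1E P0 P0 (measurableC (mray t)) (mray t))).
    by rewrite EFinM [in RHS]muleC; congr (_ * _); [exact: rayC|rewrite cdf_alongE].
  apply/seteqP; split => -[x y] /=; rewrite !in_itv/= ltNge.
    by move=> /andP[yt /negP xt].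
  by move=> [/negP xt yt]; rewrite yt.
have E2 : (P0 \x P0) [set z | iota z.1 <= t < iota z.2]%R =
    (cdf P0 t * (1 - cdf P0 t))%:E.
  rewrite (_ : [set z | _] = (iota @^-1` `]-oo, t]) `*` (~` (iota @^-1` `]-oo, t]))).
    apply: (etrans (product_measure1E P0 P0 (mray t) (measurableC (mray t)))).
    by rewrite EFinM; congr (_ * _); [rewrite cdf_alongE|exact: rayC].
  apply/seteqP; split => -[x y] /=; rewrite !in_itv/= (ltNge t).
    by move=> /andP[yt /negP xt].
  by move=> [yt /negP xt]; rewrite yt.
by rewrite [X in X + _]E1 [X in _ + X]E2 -EFinD -EFinM; congr EFin; ring.
Qed.

Section sample.
Variable lambda : probability R R.
Hypothesis lambda_uniform : forall s : R, (0 <= s <= 1)%R ->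
  lambda [set u | u <= s]%R = s%:E.

(** The expectation is exchanged with the integral over [t], and at each [t] the
    fluctuation of the empirical distribution function is bounded. *)
Lemma expected_Wasserstein_le d (Omega : measurableType d) (Pr : probability Omega R)
    (N : nat) (Pt : {RV Pr >-> Pspace R X}) (Y_ : 'I_N -> {RV Pr >-> borel X})
    (v : R -> R) :
  (0 < N)%N -> conditionally_iid Pt Y_ ->
  (forall t, \int[Pr]_w (cdf (as_probability (Pt w)) t *
    (1 - cdf (as_probability (Pt w)) t))%:E = (v t)%:E) ->
  \int[Pr]_w Wasserstein (as_probability (Pt w)) (empirical R [tuple Y_ i w | i < N]) <=
  \int[leb]_t (Num.sqrt (v t / N%:R))%:E.
Proof.
move=> N0 hY vE.
pose emp (w : Omega) : Pspace R X := empirical R (rv_tuple Y_ w).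
have memp : measurable_fun setT emp.
  exact: (measurableT_comp (measurable_empirical X_separable N0) (measurable_rv_tuple Y_)).
pose F (p : Omega * R) : \bar R :=
  `|cdf (as_probability (Pt p.1)) p.2 - cdf (as_probability (emp p.1)) p.2|%:E.
have F0 p : 0 <= F p by rewrite lee_fin.
have mF : measurable_fun setT F.
  apply/measurable_EFinP; apply: (measurableT_comp (@normr_measurable R setT)).
  apply: measurable_funB; apply: measurable_cdf_along_joint => //.
apply: (@le_trans _ _ (\int[Pr]_w \int[leb]_t F (w, t))).
  apply: ge0_le_lower_integral => w; first exact: Wasserstein_ge0.
  exact: (Wasserstein_le_cdf X_bounded iotaP lambda_uniform).
apply: (@le_trans _ _ (\int[leb]_t \int[Pr]_w F (w, t))).
  by rewrite le_eqVlt; apply/orP; left; apply/eqP; exact: (@fubini_tonelli _ _ _ _ R Pr leb F mF F0).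
apply: ge0_le_lower_integral => t; first exact: integral_ge0.
apply: (sample_fluctuation X_separable N0 hY _ (vE t)).
by rewrite -[X in measurable X]setTI; exact: (measurable_isometry iotaP).
Qed.

End sample.
End real_line.


Lemma integral_sqrtZ (R : realType) (k : R) (g : R -> R) :
  (0 <= k)%R -> measurable_fun setT g ->
  \int[@lebesgue_measure R]_t (Num.sqrt (k * g t))%:E =
  (Num.sqrt k)%:E * \int[@lebesgue_measure R]_t (Num.sqrt (g t))%:E.
Proof.
move=> k0 mg; rewrite -ge0_integralZl//.
- by apply: eq_integral => t _; rewrite sqrtrM.
- apply/measurable_EFinP.
  exact: (measurableT_comp (continuous_measurable_fun (@sqrt_continuous R)) mg).
Qed.

Theorem proposition6p1 (R : realType) (X : completeMetricType R)
  (X_separable : separable_space X) (X_bounded : finite_diameter X)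
  (alpha : R) (alpha_gt0 : (0 < alpha)%R) (P0 : probability (borel X) R)
  (N : nat) (N_gt0 : (0 < N)%N)
  (d : measure_display) (Omega : measurableType d) (Pr : probability Omega R)
  (Pt Pt1 Pt2 Pt3 : {RV Pr >-> Pspace R X})
  (X_ : nat -> {RV Pr >-> borel X}) (Y_ : 'I_N -> {RV Pr >-> borel X})
  (hPt : dirichlet_process alpha P0 (distribution Pr Pt))
  (hPt1 : dirichlet_multinomial alpha P0 N (distribution Pr Pt1))
  (hPt2 : truncated_stick_breaking alpha P0 N (distribution Pr Pt2))
  (hPt3 : hierarchical_empirical alpha P0 N (distribution Pr Pt3))
  (hX : iid X_ P0) (hY : conditionally_iid Pt Y_) :
  let leb := @lebesgue_measure R in
  [/\ WoW_rv Pt Pt1 <=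
        \int[Pr]_w Wasserstein P0 (empirical R [tuple X_ i w | i < N]),
      WoW_rv Pt Pt2 <=
        'E_Pr[fun w => mdist (X_ 0%N w : X) (X_ 1%N w : X)] *
        ((alpha / (alpha + 1)) ^+ N)%R%:E &
      WoW_rv Pt Pt3 <=
        \int[Pr]_w Wasserstein (as_probability (Pt w))
                               (empirical R [tuple Y_ i w | i < N])] /\
  forall iota : X -> R, real_isometry iota ->
  let F0 := cdf_along iota P0 in
  [/\ WoW_rv Pt Pt1 <=
        ((Num.sqrt N%:R)^-1)%:E *
        \int[leb]_x (Num.sqrt (F0 x * (1 - F0 x)))%:E,
      WoW_rv Pt Pt2 <=
        (2 * (alpha / (alpha + 1)) ^+ N)%:E *
        \int[leb]_x (F0 x * (1 - F0 x))%:E &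
      WoW_rv Pt Pt3 <=
        (Num.sqrt (alpha / (N%:R * (alpha + 1))))%:E *
        \int[leb]_x (Num.sqrt (F0 x * (1 - F0 x)))%:E].
Proof.
move=> leb.
have Xrect B : (forall i, measurable (B i)) ->
    Pr (rv_tuple (fun i : 'I_N => X_ i) @^-1` rectangle B) = \prod_(i < N) P0 (B i).
  exact: (iid_rectangle val_inj hX).
have bound1 : WoW_rv Pt Pt1 <=
    \int[Pr]_w Wasserstein P0 (empirical R [tuple X_ i w | i < N]).
  exact: (WoW_multinomial X_separable X_bounded alpha_gt0 N_gt0 hPt hPt1 Xrect).
have bound2 : WoW_rv Pt Pt2 <= 'E_Pr[fun w => mdist (X_ 0%N w : X) (X_ 1%N w : X)] *
    ((alpha / (alpha + 1)) ^+ N)%R%:E.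
  rewrite (iid_pair_integral X_separable hX) muleC.
  exact: (WoW_truncated X_separable X_bounded alpha_gt0 N_gt0 hPt hPt2).
have bound3 : WoW_rv Pt Pt3 <= \int[Pr]_w Wasserstein (as_probability (Pt w))
    (empirical R [tuple Y_ i w | i < N]).
  exact: (WoW_hierarchical X_separable alpha_gt0 N_gt0 hPt hY hPt3).
split => [//|iota iotaP F0].
have [b [mu [bE _ _]]] := dirichlet_process_data X_separable hPt.
have [U mU U_uniform] := beta_uniform_variable alpha_gt0 bE.
pose lambda : probability R R := distribution b (to_mfun mU).
have lambda_uniform s : (0 <= s <= 1)%R -> lambda [set u | u <= s]%R = s%:E.
  exact: U_uniform.
have N_pos : (0 < N%:R :> R)%R by rewrite ltr0n.
have mF0 : measurable_fun setT F0 by exact: (measurable_cdf_along X_separable iotaP).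
have mg : measurable_fun setT (fun t => F0 t * (1 - F0 t))%R.
  by apply: measurable_funM => //; exact: measurable_funB.
split.
- apply: (le_trans bound1).
  have hX' := conditionally_iid_cst Xrect.
  set Pc := to_mfun _ in hX'.
  have vE t : \int[Pr]_w (cdf_along iota (as_probability (Pc w)) t *
      (1 - cdf_along iota (as_probability (Pc w)) t))%:E = (F0 t * (1 - F0 t))%:E.
    exact: (probability_integral_cst Pr (F0 t * (1 - F0 t))%:E).
  have := expected_Wasserstein_le X_separable X_bounded iotaP lambda_uniform N_gt0 hX' vE.
  under [in X in _ <= X -> _]eq_integral do rewrite mulrC.
  rewrite (integral_sqrtZ _ mg) ?invr_ge0 ?ler0n// sqrtrV ?ler0n//.
- apply: (le_trans bound2); rewrite (iid_pair_integral X_separable hX).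
  rewrite (integral_dist_cdf X_separable iotaP) EFinM.
  by rewrite muleAC.
- apply: (le_trans bound3).
  have vE t : \int[Pr]_w (cdf_along iota (as_probability (Pt w)) t *
      (1 - cdf_along iota (as_probability (Pt w)) t))%:E =
      (alpha / (alpha + 1) * (F0 t * (1 - F0 t)))%:E.
    apply: (dirichlet_variance X_separable alpha_gt0 _ hPt).
    by rewrite -[X in measurable X]setTI; exact: (measurable_isometry iotaP).
  have := expected_Wasserstein_le X_separable X_bounded iotaP lambda_uniform N_gt0 hY vE.
  rewrite (_ : (fun t => _) = (fun t : R =>
      (Num.sqrt (alpha / (N%:R * (alpha + 1)) * (F0 t * (1 - F0 t))))%:E)); last first.
    apply/funext => t; congr (Num.sqrt _)%:E.
    by field; rewrite !gt_eqF// addr_gt0.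
  rewrite (integral_sqrtZ _ mg)//.
  by rewrite divr_ge0 ?(ltW alpha_gt0)// mulr_ge0 ?ler0n// addr_ge0// ltW.
Qed.
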